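(* Let $(M,\pi_M,E_M)$ be a Jacobi manifold of dimension $2n+1$. Then $(M,\pi_M,E_M)$ admits a contact resolution if and only if its poissonification $(P,\pi_P,Z_P)$ admits a homogeneous symplectic resolution.
   Context: A Jacobi structure on a manifold $M$ is a pair $(\pi_M,E_M)$ of a bivector field and a vector field such that $[\pi_M,\pi_M]=2E_M\wedge\pi_M$ and $[E_M,\pi_M]=0$, with the sign of the Schouten bracket normalized so that this is equivalent to the Jacobi identity for $\{f,g\}=\pi_M(df,dg)+fE_M[g]-gE_M[f]$. A contact manifold of dimension $2n+1$ is regarded as a manifold $\Sigma$ with a Jacobi structure $(\Pi_\Sigma,E_\Sigma)$ such that $E_\Sigma\wedge\Pi_\Sigma^n$ vanishes at no point. A map $\varphi:\Sigma\to M$ between Jacobi manifolds is a Jacobi morphism if $\Pi_\Sigma$ and $E_\Sigma$ are projected by $\varphi$ onto $\pi_M$ and $E_M$, i.e. $\wedge^2T_\sigma\varphi(\Pi_\Sigma|_\sigma)=\pi_M|_{\varphi(\sigma)}$ and $T_\sigma\varphi(E_\Sigma|_\sigma)=E_M|_{\varphi(\sigma)}$ for all $\sigma$. A contact resolution of a Jacobi manifold $M$ is a contact manifold $\Sigma$ of the same dimension together with a surjective Jacobi morphism $\varphi:\Sigma\to M$. A homogeneous Poisson manifold $(P,\pi_P,Z_P)$ is a Poisson manifold $(P,\pi_P)$ with a complete vector field $Z_P$ such that $[Z_P,\pi_P]=L_{Z_P}\pi_P=-\pi_P$. The poissonification of $(M,\pi_M,E_M)$ is the homogeneous Poisson manifold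 $P=\mathbb{R}\times M$, with $t$ the coordinate on $\mathbb{R}$, $Z_P=\frac{\partial}{\partial t}$ and $\pi_P=e^{-t}\left(\pi_M+Z_P\wedge E_M\right)$. A symplectic resolution of a Poisson manifold $(P,\pi_P)$ is a triple $(\widetilde\Sigma,\Pi_{\widetilde\Sigma},\widetilde\varphi)$ where $(\widetilde\Sigma,\Pi_{\widetilde\Sigma})$ is a symplectic manifold (a Poisson manifold with nondegenerate bivector) of the same dimension as $P$ and $\widetilde\varphi:\widetilde\Sigma\to P$ is a surjective Poisson morphism. A homogeneous symplectic resolution of $(P,\pi_P,Z_P)$ is a symplectic resolution such that $\widetilde\Sigma$ is moreover a homogeneous Poisson manifold via a (complete) vector field $Z_{\widetilde\Sigma}$ that is projected by $\widetilde\varphi$ onto $Z_P$. *)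

(* Defs.v *)
From HB Require Import structures.
From mathcomp Require Import all_boot all_order all_fingroup all_algebra.
From mathcomp Require Import all_classical all_reals all_analysis.

Set Implicit Arguments.
Unset Strict Implicit.
Unset Printing Implicit Defensive.

Import Order.TTheory GRing.Theory Num.Theory.
Import numFieldNormedType.Exports.

Local Open Scope classical_set_scope.
Local Open Scope ring_scope.

Fixpoint Ck_on (R : realType) (m k : nat) (U : set 'rV[R]_m)
    (f : 'rV[R]_m -> R) : Prop :=
  (forall x, U x -> {for x, continuous f}) /\
  if k is k'.+1 then
    forall i : 'I_m,
      (forall x, U x -> derivable f x (delta_mx 0 i)) /\
      Ck_on k' U (fun x => 'D_(delta_mx 0 i) f x)
  else True.

Definition smooth_on_rV (R : realType) (m : nat) (U : set 'rV[R]_m)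
    (f : 'rV[R]_m -> R) : Prop := forall k, Ck_on k U f.

Record chart (R : realType) (m : nat) (T : topologicalType) := Chart {
  dom : set T;
  coord : T -> 'rV[R]_m;
  inv_coord : 'rV[R]_m -> T }.

Record is_chart (R : realType) (m : nat) (T : topologicalType)
    (c : chart R m T) : Prop := IsChart {
  open_dom : open (dom c);
  open_codom : open (coord c @` dom c);
  coordK : forall x, dom c x -> inv_coord c (coord c x) = x;
  continuous_coord : forall x, dom c x -> {for x, continuous (coord c)};
  continuous_inv_coord :
    forall v, (coord c @` dom c) v -> {for v, continuous (inv_coord c)} }.

Definition compatible (R : realType) (m : nat) (T : topologicalType)
    (c d : chart R m T) : Prop :=
  forall j : 'I_m, smooth_on_rV (coord c @` (dom c `&` dom d))
                                (fun v => coord d (inv_coord c v) 0 j).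

Structure manifold (R : realType) (m : nat) := Manifold {
  carrier :> topologicalType;
  atlas : set (chart R m carrier);
  manifold_hausdorff : hausdorff_space carrier;
  manifold_second_countable : @second_countable carrier;
  atlas_chart : forall c, atlas c -> is_chart c;
  atlas_cover : forall p, exists2 c, atlas c & dom c p;
  atlas_compatible : forall c d, atlas c -> atlas d -> compatible c d }.

Section Tensors.
Context {R : realType} {m : nat} (M : manifold R m).
Implicit Types (f g h : M -> R) (p : M) (c : chart R m M).

Definition smooth_on (U : set M) f : Prop :=
  forall c, atlas c ->
    smooth_on_rV (coord c @` (dom c `&` U)) (f \o inv_coord c).

Definition smooth_at p f : Prop :=
  exists U : set M, [/\ open U, U p & smooth_on U f].

(** The partial derivative of [f] at [p] with respect to the [i]-th coordinate
    of the chart [c]. *)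
Definition pderiv c (i : 'I_m) f : M -> R :=
  fun p => 'D_(delta_mx 0 i) (f \o inv_coord c) (coord c p).

(** Vector and bivector fields are represented by their action on functions,
    [X f] being [X[f]] and [B f g] being [B(df,dg)].  The operators are defined
    on all functions, but the value at [p] is only meaningful for functions
    that are smooth at [p]; all conditions below are restricted accordingly. *)

Definition vop := (M -> R) -> (M -> R).
Definition bop := (M -> R) -> (M -> R) -> (M -> R).
Implicit Types (X Y E Z : vop) (B P Q : bop).

Definition is_vector_field X : Prop :=
  forall c, atlas c -> exists a : 'I_m -> M -> R,
    (forall i, smooth_on (dom c) (a i)) /\
    forall p f, dom c p -> smooth_at p f ->
      X f p = \sum_i a i p * pderiv c i f p.

Definition is_bivector_field B : Prop :=
  forall c, atlas c -> exists b : 'I_m -> 'I_m -> M -> R,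
    [/\ forall i j, smooth_on (dom c) (b i j),
        forall i j p, dom c p -> b j i p = - b i j p &
        forall p f g, dom c p -> smooth_at p f -> smooth_at p g ->
          B f g p = \sum_i \sum_j b i j p * (pderiv c i f p * pderiv c j g p)].

Definition integral_curve X (gamma : R -> M) : Prop :=
  continuous gamma /\
  forall t f, smooth_at (gamma t) f ->
    is_derive t 1 (f \o gamma) (X f (gamma t)).

(** By uniqueness of integral curves, it is equivalent to ask that every point
    be the origin of an integral curve defined on all of R and that every
    maximal integral curve be defined on all of R. *)
Definition complete X : Prop :=
  forall p, exists2 gamma : R -> M, gamma 0 = p & integral_curve X gamma.

Definition wedge11 X Y : bop := fun f g p => X f p * Y g p - Y f p * X g p.

Definition wedge12 X B f g h : M -> R := fun p =>
  X f p * B g h p + X g p * B h f p + X h p * B f g p.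

(** The multivector [E /\ P^n] evaluated on [df_0, ..., df_2n]; the factor
    [2^-n] comes from the two slots of each copy of [P]. *)
Definition wedge_power E P n (f : 'I_n.*2.+1 -> M -> R) : M -> R := fun p =>
  2%:R ^- n * \sum_(s : 'S_n.*2.+1) (-1) ^+ s *
    (E (f (s ord0)) p *
     \prod_(i < n) P (f (s (inord i.*2.+1))) (f (s (inord i.*2.+2))) p).

(** The Schouten brackets [[X, B]] (which is the Lie derivative of [B] along
    [X]) and [[P, Q]], as brackets of multiderivations.  With this sign,
    [[P, P]](f, g, h) is twice the Jacobiator [{{f,g},h} + cycl.] of
    [{f, g} = P f g]; hence [[P, P] = 2 E /\ P] and [[E, P] = 0] amount to the
    Jacobi identity of [{f, g} = P f g + f * E g - g * E f]. *)
Definition schouten12 X B : bop := fun f g p =>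
  X (B f g) p - B (X f) g p - B f (X g) p.

Definition schouten22 P Q f g h : M -> R := fun p =>
  P (Q f g) h p + P (Q g h) f p + P (Q h f) g p +
  (Q (P f g) h p + Q (P g h) f p + Q (P h f) g p).

Definition is_jacobi P E : Prop :=
  [/\ is_bivector_field P, is_vector_field E,
      forall p f g h, smooth_at p f -> smooth_at p g -> smooth_at p h ->
        schouten22 P P f g h p = 2%:R * wedge12 E P f g h p &
      forall p f g, smooth_at p f -> smooth_at p g ->
        schouten12 E P f g p = 0].

Definition is_poisson P : Prop :=
  is_bivector_field P /\
  forall p f g h, smooth_at p f -> smooth_at p g -> smooth_at p h ->
    schouten22 P P f g h p = 0.

Definition is_homogeneous_poisson P Z : Prop :=
  [/\ is_poisson P, is_vector_field Z, complete Z &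
      forall p f g, smooth_at p f -> smooth_at p g ->
        schouten12 Z P f g p = - P f g p].

Definition differential_zero p f : Prop :=
  forall c, atlas c -> dom c p -> forall i, pderiv c i f p = 0.

(** [P] is nondegenerate: the map [T*_p M -> T_p M, df |-> P(df, .)] is
    injective at every point [p]. *)
Definition nondegenerate P : Prop :=
  forall p f, smooth_at p f ->
    (forall g, smooth_at p g -> P f g p = 0) -> differential_zero p f.

Definition is_symplectic P : Prop := is_poisson P /\ nondegenerate P.

End Tensors.

Definition is_contact (R : realType) (n : nat) (S : manifold R n.*2.+1)
    (P : bop S) (E : vop S) : Prop :=
  is_jacobi P E /\
  forall p : S, exists f : 'I_n.*2.+1 -> S -> R,
    (forall i, smooth_at p (f i)) /\ wedge_power E P f p != 0.

Section Morphisms.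
Context {R : realType} {m l : nat} (N : manifold R m) (M : manifold R l).
Implicit Type phi : N -> M.

Definition smooth_map phi : Prop :=
  continuous phi /\
  forall c d, atlas c -> atlas d -> forall j : 'I_l,
    smooth_on_rV (coord c @` (dom c `&` phi @^-1` dom d))
                 (fun v => coord d (phi (inv_coord c v)) 0 j).

(** The tangent map acts by [(T_s phi v)[f] = v[f \o phi]], and likewise for
    its second exterior power. *)
Definition projects_vector phi (X : vop N) (Y : vop M) : Prop :=
  forall s f, smooth_at (phi s) f -> X (f \o phi) s = Y f (phi s).

Definition projects_bivector phi (P : bop N) (Q : bop M) : Prop :=
  forall s f g, smooth_at (phi s) f -> smooth_at (phi s) g ->
    P (f \o phi) (g \o phi) s = Q f g (phi s).

Definition jacobi_morphism phi (P : bop N) (E : vop N) (Q : bop M) (F : vop M) :=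
  [/\ smooth_map phi, projects_bivector phi P Q & projects_vector phi E F].

Definition poisson_morphism phi (P : bop N) (Q : bop M) : Prop :=
  smooth_map phi /\ projects_bivector phi P Q.

End Morphisms.

Definition contact_resolution (R : realType) (n : nat)
    (M : manifold R n.*2.+1) (piM : bop M) (EM : vop M)
    (S : manifold R n.*2.+1) (P : bop S) (E : vop S) (phi : S -> M) : Prop :=
  [/\ is_contact P E, jacobi_morphism phi P E piM EM & set_surj setT setT phi].

Definition symplectic_resolution (R : realType) (m : nat)
    (M : manifold R m) (piM : bop M)
    (S : manifold R m) (P : bop S) (phi : S -> M) : Prop :=
  [/\ is_symplectic P, poisson_morphism phi P piM & set_surj setT setT phi].

Definition homogeneous_symplectic_resolution (R : realType) (m : nat)
    (M : manifold R m) (piM : bop M) (ZM : vop M)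
    (S : manifold R m) (P : bop S) (Z : vop S) (phi : S -> M) : Prop :=
  [/\ symplectic_resolution piM P phi, is_homogeneous_poisson P Z &
      projects_vector phi Z ZM].

Lemma Ck_on_cst (R : realType) (m k : nat) (U : set 'rV[R]_m) (a : R) :
  Ck_on k U (fun=> a).
Proof.
have C b x : {for x, continuous (fun _ : 'rV[R]_m => b : R)}.
  exact: cst_continuous.
elim: k a => [|k IH] a /=; split => // i.
split => [x _|]; first exact: (derivable_cst (a : R^o)).
rewrite (_ : (fun x => _) = (fun=> 0 : R)); first exact: IH.
by apply/funext => x; exact: (derive_cst (a : R^o)).
Qed.

Lemma Ck_on_coord (R : realType) (m k : nat) (U : set 'rV[R]_m) (j : 'I_m) :
  Ck_on k U (fun x => x 0 j).
Proof.
have D (x v : 'rV[R]_m) : is_derive x v (fun x : 'rV[R]_m => x 0 j : R^o) (v 0 j).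
  have df := differentiable_coord x 0 j.
  split; first exact: diff_derivable.
  rewrite deriveE //.
  have lin : linear (fun x : 'rV[R]_m => x 0 j : R^o).
    by move=> a u w; rewrite !mxE.
  pose h := GRing.isLinear.Build _ _ _ _ _ lin.
  pose g : {linear 'rV[R]_m -> R^o} := HB.pack (fun x : 'rV[R]_m => x 0 j : R^o) h.
  by rewrite (@diff_lin _ _ _ g) //; exact: coord_continuous.
have C x : {for x, continuous (fun x : 'rV[R]_m => x 0 j)}.
  exact: coord_continuous.
case: k => [|k] /=; split => // i.
split => [x _|]; first exact: ex_derive.
rewrite (_ : (fun x => _) = (fun=> (delta_mx 0 i : 'rV[R]_m) 0 j)).
  exact: Ck_on_cst.
by apply/funext => x; rewrite derive_val.
Qed.

Lemma Ck_on_rsubmx (R : realType) (m k : nat) (U : set 'rV[R]_m) f :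
  Ck_on k U f ->
  Ck_on k ((rsubmx : 'rV[R]_(1 + m) -> 'rV[R]_m) @^-1` U) (f \o rsubmx).
Proof.
have L (x v : 'rV[R]_(1 + m)) (h : R) :
    rsubmx (h *: v + x) = h *: rsubmx v + rsubmx x.
  by apply/matrixP => a b; rewrite !mxE.
have Ed (g : 'rV[R]_m -> R) (x v : 'rV[R]_(1 + m)) :
    derivable (g \o rsubmx) x v = derivable g (rsubmx x) (rsubmx v).
  by rewrite /derivable /=; under eq_fun do rewrite L.
have ED (g : 'rV[R]_m -> R) (x v : 'rV[R]_(1 + m)) :
    'D_v (g \o rsubmx) x = 'D_(rsubmx v) g (rsubmx x).
  by rewrite /derive /=; under eq_fun do rewrite L.
elim: k f => [|k IH] f /= [cf df].
  split=> // x Ux; apply: continuous_comp; last exact: cf.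
  exact: continuous_rsubmx.
split.
  move=> x Ux; apply: continuous_comp; last exact: cf.
  exact: continuous_rsubmx.
move=> i; rewrite (funext (fun x => ED f x _)).
have [j ->|j ->] := split_ordP i.
  have D : rsubmx (delta_mx 0 (lshift m j) : 'rV[R]_(1 + m)) = 0.
    by apply/matrixP => a b; rewrite !mxE eq_rlshift andbF.
  rewrite D; split => [x _|]; first by rewrite Ed D; exact: derivable0.
  rewrite (_ : (fun x => _) = (fun=> 0 : R)); first exact: Ck_on_cst.
  by apply/funext => x; exact: derive0.
have D : rsubmx (delta_mx 0 (rshift 1 j) : 'rV[R]_(1 + m)) = delta_mx 0 j.
  by apply/matrixP => a b; rewrite !mxE eq_rshift.
rewrite D; have [d1 d2] := df j.
by split => [x Ux|]; [rewrite Ed D; exact: d1 | exact: (IH ('D_(delta_mx 0 j) f))].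
Qed.

Section Cylinder.
Context {R : realType} {m : nat} (M : manifold R m).

Definition cylinder_chart (c : chart R m M) : chart R (1 + m) (R * M)%type :=
  @Chart R (1 + m) (R * M)%type
    [set p | dom c p.2]
    (fun p => row_mx (p.1%:M) (coord c p.2))
    (fun v => (lsubmx v 0 0, inv_coord c (rsubmx v))).

Definition cylinder_atlas : set (chart R (1 + m) (R * M)%type) :=
  cylinder_chart @` @atlas R m M.

Lemma cylinder_codom (c : chart R m M) (U : set M) :
  coord (cylinder_chart c) @` [set p | U p.2] = rsubmx @^-1` (coord c @` U).
Proof.
apply/seteqP; split => v /=.
  by move=> [p Up <-]; exists p.2 => //; rewrite row_mxKr.
move=> [q Uq qv]; exists (lsubmx v 0 0, q) => //=.
by rewrite qv -mx11_scalar hsubmxK.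
Qed.

Lemma continuous_cylinder_coord (c : chart R m M) p :
  {for p.2, continuous (coord c)} ->
  {for p, continuous (coord (cylinder_chart c))}.
Proof.
move=> cc A [P pP PA].
suff : \forall q \near p, forall i j, P i j (coord (cylinder_chart c) q i j).
  by apply: filterS => q; exact: PA.
pose F i j := [set q : R * M | P i j (coord (cylinder_chart c) q i j)].
apply: (@filter_forall (R * M)%type _ (fun i q => forall j, F i j q) (nbhs p) _) => i.
apply: (@filter_forall (R * M)%type _ (F i) (nbhs p) _) => j; rewrite /F.
have := pP i j; rewrite /=.
have [k ->|k ->] := split_ordP j.
  rewrite row_mxEl !ord1 !mxE /= => n1.
  have : \forall q \near p, P 0 (lshift m 0) q.1 by exact: cvg_fst n1.
  by apply: filterS => q; rewrite /= row_mxEl mxE.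
rewrite row_mxEr !ord1 => n1.
have : {for p, continuous (fun q : R * M => coord c q.2 0 k)}.
  apply: (@continuous_comp _ _ _ (coord c \o snd) (fun w : 'rV_m => w 0 k)).
    by apply: continuous_comp; [exact: cvg_snd | exact: cc].
  exact: coord_continuous.
move=> /(_ _ n1) H.
have : \forall q \near p, P 0 (rshift 1 k) (coord c q.2 0 k) by exact: H.
by apply: filterS => q; rewrite /= row_mxEr.
Qed.

Lemma cylinder_hausdorff : hausdorff_space (R * M)%type.
Proof.
move=> [t x] [s y] cl; congr (_, _).
  apply: (@Rhausdorff R) => A B At Bs.
  have [] := cl (A `*` setT) (B `*` setT).
  - by exists (A, setT) => //; split => //; exact: filterT.
  - by exists (B, setT) => //; split => //; exact: filterT.
  by move=> q [[Aq _] [Bq _]]; exists q.1.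
apply: (@manifold_hausdorff R m M) => A B At Bs.
have [] := cl (setT `*` A) (setT `*` B).
- by exists (setT, A) => //; split => //; exact: filterT.
- by exists (setT, B) => //; split => //; exact: filterT.
by move=> q [[_ Aq] [_ Bq]]; exists q.2.
Qed.

Lemma cylinder_second_countable : @second_countable (R * M)%type.
Proof.
have [B cB [oB bB]] := @manifold_second_countable R m M.
pose I (a : rat * rat) : set R := ball (ratr a.1 : R) (ratr a.2).
exists ((fun a => I a.1 `*` a.2) @` (setT `*` B)).
  by apply: (sub_countable (card_image_le _ _)); exact: countableX.
split => [_ [[a U] [_ BU] <-]|[t x] A [[V W] /= [tV xW] VWA]].
  rewrite -[X in open X]/((fst @^-1` I a) `&` (snd @^-1` U)).
  by apply: openI; apply: open_comp => //;
    [move=> *; exact: cvg_fst|exact: ball_open|move=> *; exact: cvg_snd|exact: oB].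
have [U [BU Ux] UW] := bB x W xW.
move: tV; rewrite nbhsE => -[V' [oV' V't] V'V].
have [c [r [cr crV']]] := open_subball_rat oV' (mem_set V't).
exists (I (c, r) `*` U).
  split; first by exists ((c, r), U).
  by split => //; exact/set_mem.
move=> [t' x'] [/= It Ux']; apply: VWA; split => /=.
  by apply: V'V; exact: crV'.
exact: UW.
Qed.

Lemma cylinder_atlas_chart c : cylinder_atlas c -> is_chart c.
Proof.
move=> [d /atlas_chart[od oc dK cd ci] <-].
have codE := cylinder_codom d (dom d).
split => /=.
- apply: (@open_comp _ _ snd (dom d)); last exact: od.
  by move=> *; exact: cvg_snd.
- rewrite codE; apply: open_comp => // v _; exact: continuous_rsubmx.
- by move=> [t x] /= dx; rewrite row_mxKl row_mxKr dK // mxE eqxx.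
- by move=> p dp; apply: continuous_cylinder_coord; exact: cd.
- move=> v dv'; have dv : (coord d @` dom d) (rsubmx v).
    by rewrite -[_ (rsubmx v)]/((rsubmx @^-1` (coord d @` dom d)) v) -codE.
  have c1 : {for v, continuous (fun w : 'rV[R]_(1 + m) => lsubmx w 0 0)}.
    apply: (@continuous_comp _ _ _ lsubmx (fun w : 'rV[R]_1 => w 0 0)).
      exact: continuous_lsubmx.
    exact: coord_continuous.
  have c2 : {for v, continuous (inv_coord d \o rsubmx)}.
    apply: continuous_comp; last exact: ci.
    exact: continuous_rsubmx.
  exact: (cvg_pair c1 c2).
Qed.

Lemma cylinder_atlas_cover p : exists2 c, cylinder_atlas c & dom c p.
Proof.
have [c Ac cp] := atlas_cover p.2.
by exists (cylinder_chart c) => //; exists c.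
Qed.

Lemma cylinder_atlas_compatible c d :
  cylinder_atlas c -> cylinder_atlas d -> compatible c d.
Proof.
move=> [c' Ac <-] [d' Ad <-] j k.
have codE := cylinder_codom c' (dom c' `&` dom d').
suff H : Ck_on k (rsubmx @^-1` (coord c' @` (dom c' `&` dom d')))
    (fun v => coord (cylinder_chart d') (inv_coord (cylinder_chart c') v) 0 j).
  by rewrite -codE in H; exact: H.
have [i ->|i ->] := split_ordP j.
  have E v : coord (cylinder_chart d') (inv_coord (cylinder_chart c') v) 0
      (lshift m i) = v 0 (lshift m i) by rewrite row_mxEl !mxE (ord1 i) mulr1n /= mxE.
  by rewrite (funext E); exact: Ck_on_coord.
have E v : coord (cylinder_chart d') (inv_coord (cylinder_chart c') v) 0
    (rshift 1 i) = ((fun w => coord d' (inv_coord c' w) 0 i) \o rsubmx) v.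
  by rewrite row_mxEr.
by rewrite (funext E); apply: Ck_on_rsubmx; exact: atlas_compatible.
Qed.

Definition cylinder : manifold R (1 + m) :=
  Manifold cylinder_hausdorff cylinder_second_countable cylinder_atlas_chart
    cylinder_atlas_cover cylinder_atlas_compatible.

End Cylinder.

Section Poissonification.
Context {R : realType} {m : nat} (M : manifold R m).
Implicit Types F G : cylinder M -> R.

Definition time_field : vop (cylinder M) :=
  fun F p => derive1 (fun t => F (t, p.2)) p.1.

(** The fields on R x M that are tangent to the slices [{t} x M] and given
    there by [E] and [P]. *)
Definition lift_vector (E : vop M) : vop (cylinder M) :=
  fun F p => E (fun x => F (p.1, x)) p.2.

Definition lift_bivector (P : bop M) : bop (cylinder M) :=
  fun F G p => P (fun x => F (p.1, x)) (fun x => G (p.1, x)) p.2.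

(** The bivector [e^-t (P + d/dt /\ E)]. *)
Definition poissonification (P : bop M) (E : vop M) : bop (cylinder M) :=
  fun F G p => expR (- p.1) *
    (lift_bivector P F G p + wedge11 time_field (lift_vector E) F G p).

End Poissonification.

(* Main.v *)
Require Import Defs.
From HB Require Import structures.
From mathcomp Require Import all_boot all_order all_fingroup all_algebra.
From mathcomp Require Import all_classical all_reals all_analysis.
From mathcomp Require Import ring lra zify.
Import Defs.

Set Implicit Arguments.
Unset Strict Implicit.
Unset Printing Implicit Defensive.

Import Order.TTheory GRing.Theory Num.Theory.
Import numFieldNormedType.Exports.

Local Open Scope classical_set_scope.
Local Open Scope ring_scope.

(** A Jacobi structure [(pi, E)] on [M] is the same thing as the homogeneous
    Poisson structure [e^-t (pi + d/dt /\ E)] on [R x M]: the former is the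
    trace of the latter on the slice [t = 0], and the contact condition on the
    slice is the nondegeneracy of the Poisson structure.  The theorem applies
    this correspondence to the source of a resolution.

    From contact to symplectic ([contact_to_symplectic_resolution]): for a
    contact resolution [phi : S -> M] the map [id x phi : R x S -> R x M]
    intertwines the poissonifications and the fields [d/dt].  The field [d/dt]
    commutes with the lifts of [E] and [pi] because mixed second derivatives
    are symmetric ([schwarz]); then the Jacobi identity on [R x S] is an
    expansion of iterated brackets ([poissonification_iter]).

    From symplectic to contact ([symplectic_to_contact_resolution]): for a
    homogeneous symplectic resolution [phi : S -> R x M] the function
    [tau = t o phi] satisfies [Z tau = 1], so [N = {tau = 0}] is a hypersurface
    transverse to [Z].  It is a manifold by the implicit function theorem
    ([implicit_function], [slice]).  Put [E = P(d tau, .)] and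
    [B = P - Z /\ E]; both are tangent to the level sets of [tau], and their
    restrictions to [N] form a Jacobi structure by the Jacobi identity of [P]
    and its homogeneity ([reeb_tangential], [tangential_cyclic]).  The second
    component of [phi] maps [N] onto [M] since [phi] reaches every [(0, x)].

    In both directions the link between [E /\ B^n <> 0] and nondegeneracy is
    linear algebra.  A vector [(c, v)] in the kernel of the bordered matrix
    of [E] and [B] contracts [E /\ B^n] to zero ([vform_kernel]); conversely,
    if this kernel is trivial, [E /\ B^k] is seen to be nonzero by induction on
    [k] ([vform_exists]).

    Fields are given as operators on functions, so values at a point depend on
    germs.  The calculus rules are proved for [tangent_at], which covers both
    [X f p] and [P f g p]; smoothness of germs rests on the chain rule for
    functions of class C^k ([Ck_on_comp]). *)

(** * Directional derivatives on R^m *)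

Notation "''e_' i" := (delta_mx 0 i) (at level 8, i at level 2, format "''e_' i").
Notation "''d_' i f" := (derive f ^~ 'e_i) (at level 10, i at level 2, f at next level).

Section Partial.
Context {R : realType}.

Lemma cvg_rV (T : Type) (F : set_system T) l (h : T -> 'rV[R]_l) (p : 'rV[R]_l) :
  Filter F -> (forall j, h x 0 j @[x --> F] --> p 0 j) -> h @ F --> p.
Proof.
move=> FF hc A [P pP PA].
suff : \forall q \near F, forall i j, P i j (h q i j).
  by apply: filterS => q; exact: PA.
apply: (@filter_forall T _ (fun i q => forall j, P i j (h q i j)) F) => i.
apply: (@filter_forall T _ (fun j q => P i j (h q i j)) F) => j.
by have := pP i j; rewrite !ord1 => /(hc j).
Qed.

Lemma continuous_rV (T : topologicalType) l p (h : T -> 'rV[R]_l) :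
  (forall j, {for p, continuous (fun x => h x 0 j)}) -> {for p, continuous h}.
Proof. exact: cvg_rV. Qed.

(** Only the values along the line enter the difference quotient.  This
    identifies derivatives of functions on different spaces, such as a function
    on a cylinder and its restriction to a slice. *)
Lemma derive_same_line (U V : normedModType R)
    (f : U -> R) (g : V -> R) (x v : U) (y w : V) :
  (forall h : R, f (h *: v + x) = g (h *: w + y)) ->
  'D_v f x = 'D_w g y /\ (derivable f x v -> derivable g y w).
Proof.
move=> fg; have fg0 : f x = g y by have := fg 0; rewrite !scale0r !add0r.
have E : (fun h : R => h^-1 *: ((f \o shift x) (h *: v) - f x)) =
    (fun h => h^-1 *: ((g \o shift y) (h *: w) - g y)).
  by apply/funext => h; rewrite /= fg fg0.
by rewrite /derive /derivable E.
Qed.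

Lemma derivable_line (V : normedModType R) (f : V -> R) x v :
  derivable f x v -> f (t *: v + x) @[t --> 0^'] --> f x.
Proof.
move=> /derivable1P /derivable1_diffP /differentiable_continuous cf.
have := @continuous_withinNx _ _ (fun t : R => f (t *: v + x)) 0.
by move=> [/(_ cf)] /=; rewrite scale0r add0r.
Qed.

Lemma is_derive_line (V : normedModType R) (f : V -> R) x v (t : R) :
  derivable f (x + t *: v) v ->
  is_derive t 1 (fun t => f (x + t *: v)) ('D_v f (x + t *: v)).
Proof.
have E (h : R) : f (h *: v + (x + t *: v)) = f (x + (h *: 1 + t) *: v).
  by rewrite [h *: 1]mulr1 scalerDl addrCA.
have [D1 D2] := @derive_same_line V R f (fun t => f (x + t *: v)) _ v t 1 E.
by move=> df; split; [exact: D2|rewrite -D1].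
Qed.

Lemma is_derive_comp1 (V : normedModType R) (p : R -> R) (f : V -> R) x v :
  derivable p (f x) 1 -> derivable f x v ->
  is_derive x v (p \o f) ('D_1 p (f x) * 'D_v f x).
Proof.
move=> dp df; rewrite -[x](addr0 x) -(scale0r v) in dp df *.
have [d1 d2] := @is_derive1_comp R p (fun t => f (x + t *: v)) 0 _ _
  (derivableP dp) (is_derive_line df).
have E (h : R) : p (f (x + (h *: 1 + 0) *: v)) = (p \o f) (h *: v + (x + 0 *: v)).
  by rewrite addr0 [h *: 1]mulr1 scale0r addr0 addrC.
have [D1 D2] := @derive_same_line R V (p \o (fun t => f (x + t *: v))) (p \o f) 0 1 _ v E.
by split; [exact: D2|rewrite -D1].
Qed.

Lemma is_derive_coord m (x v : 'rV[R]_m) j :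
  is_derive x v (fun x : 'rV[R]_m => x 0 j) (v 0 j).
Proof.
have dv : derivable (id : 'rV[R]_m -> 'rV[R]_m) x v by exact: derivable_id.
split; first exact: ((derivable_mxP _ _ _).1 dv).
by have /matrixP/(_ 0 j) := derive_mx dv; rewrite derive_id mxE => ->.
Qed.

Lemma MVT_line_ge0 (V : normedModType R) (f : V -> R) x v (s : R) : 0 <= s ->
  (forall t : R, 0 <= t <= s -> derivable f (x + t *: v) v) ->
  exists2 c, 0 <= c <= s & f (x + s *: v) - f x = s * 'D_v f (x + c *: v).
Proof.
move=> s0 df; pose g t := f (x + t *: v).
have dg (t : R) : 0 <= t <= s -> is_derive t 1 (g : R -> R) ('D_v f (x + t *: v)).
  by move=> ts; apply: is_derive_line; exact: df.
have [||c cs] := @MVT_segment R g (fun t => 'D_v f (x + t *: v)) 0 s s0.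
- by move=> t /subset_itv_oo_cc; rewrite in_itv; exact: dg.
- by apply: derivable_within_continuous => t; rewrite in_itv => /dg [].
rewrite /g scale0r addr0 subr0 mulrC => E; exists c => //.
Qed.

Lemma MVT_line (V : normedModType R) (f : V -> R) x v (s : R) :
  (forall t : R, `|t| <= `|s| -> derivable f (x + t *: v) v) ->
  exists2 c, `|c| <= `|s| & f (x + s *: v) - f x = s * 'D_v f (x + c *: v).
Proof.
move=> df; have [s0|s0] := leP 0 s.
  have [t /andP[t0 ts]|c /andP[c0 cs] E] := @MVT_line_ge0 _ f x v s s0.
    by apply: df; rewrite !ger0_norm.
  by exists c => //; rewrite !ger0_norm.
have [|t /andP[t0 ts]|c /andP[c0 cs]] := @MVT_line_ge0 _ f (x + s *: v) v (- s).
- by rewrite oppr_ge0 ltW.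
- rewrite -addrA -scalerDl; apply: df.
  by rewrite [leRHS]ltr0_norm // ler_norml; apply/andP; split; lra.
rewrite -!addrA -!scalerDl subrr scale0r addr0 => E; exists (s + c).
  by rewrite [leRHS]ltr0_norm // ler_norml; apply/andP; split; lra.
by rewrite -opprB E mulNr opprK.
Qed.

Lemma continuous_rV_distP m (q : 'rV[R]_m -> R) (x : 'rV[R]_m) :
  {for x, continuous q} <->
  (forall e, 0 < e -> \forall z \near x, `|q x - q z| < e).
Proof.
split=> [/cvgrPdist_lt//|H].
by apply/(@cvgrPdist_lt _ _ _ (nbhs x) _ q (q x)); exact: H.
Qed.

Lemma nbhs_rVP m (x : 'rV[R]_m) (A : set 'rV[R]_m) :
  nbhs x A <-> exists2 d : R, 0 < d & forall z : 'rV[R]_m, `|z - x| < d -> A z.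
Proof.
split=> [/(@nbhs_ballP R 'rV[R]_m x A)|] [d d0 H].
  by exists d => // z zx; apply: H; rewrite -ball_normE /= distrC.
apply: (@nbhs_ballP R 'rV[R]_m x A).2; exists d => // z.
by rewrite -ball_normE /= distrC; exact: H.
Qed.

Lemma rV_norm_coord m (v : 'rV[R]_m) i : `|v 0 i| <= `|v|.
Proof.
by rewrite [leRHS]/Num.Def.normr/= mx_normrE; exact: (le_bigmax _ _ (0, i)).
Qed.

Lemma rV_norm_le m (v : 'rV[R]_m) (e : R) :
  0 <= e -> (forall i, `|v 0 i| <= e) -> `|v| <= e.
Proof.
move=> e0 ve; rewrite [leLHS]/Num.Def.normr/= mx_normrE.
by apply: bigmax_le => // -[i j] _; rewrite /= (ord1 i); exact: ve.
Qed.

(** A function with continuous partial derivatives is differentiable, in the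
    form due to Caratheodory: the increment from [y] to [z] is a combination of
    the coordinates of [z - y] whose coefficients are continuous at [y].
    These are difference quotients along the steps of the staircase from [y]
    to [z], so each is a partial derivative at a point near [y]. *)
Lemma caratheodory m (f : 'rV[R]_m -> R) (y : 'rV[R]_m) :
  (\forall z \near y, forall i, derivable f z 'e_i) ->
  (forall i, {for y, continuous ('d_i f)}) ->
  exists q : 'I_m -> 'rV[R]_m -> R,
    (forall i, q i y = 'd_i f y /\ {for y, continuous (q i)}) /\
    forall z, f z - f y = \sum_i (z 0 i - y 0 i) * q i z.
Proof.
move=> df cf.
pose tr k (z : 'rV[R]_m) : 'rV[R]_m := \row_j (if (j < k)%N then z 0 j else y 0 j).
pose q (i : 'I_m) (z : 'rV[R]_m) := if z 0 i == y 0 i then 'd_i f y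
  else (f (tr i.+1 z) - f (tr i z)) / (z 0 i - y 0 i).
have trS (i : 'I_m) (z : 'rV[R]_m) : tr i.+1 z = tr i z + (z 0 i - y 0 i) *: 'e_i.
  apply/rowP => j; rewrite !mxE /= ltnS leq_eqVlt.
  have [->|ji] := eqVneq j i; first by rewrite eqxx ltnn mulr1 subrKC.
  by rewrite (inj_eq val_inj) (negPf ji) mulr0 addr0.
have q0 i : q i y = 'd_i f y by rewrite /q eqxx.
exists q; split; last first.
  move=> z; have -> : f z - f y = \sum_(i < m) (f (tr i.+1 z) - f (tr i z)).
    rewrite -(big_mkord xpredT (fun i => f (tr i.+1 z) - f (tr i z))).
    rewrite telescope_sumr //; congr (f _ - f _).
      by apply/rowP => j; rewrite !mxE ltn_ord.
    by apply/rowP => j; rewrite !mxE.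
  apply: eq_bigr => i _; rewrite /q; case: eqVneq => [zy|zy].
    by rewrite trS zy subrr scale0r addr0 subrr mul0r.
  by rewrite mulrCA divff ?subr_eq0 // mulr1.
move=> i; split=> //; apply/continuous_rV_distP => e e0; rewrite q0.
have /continuous_rV_distP/(_ _ e0) cfi := cf i.
have [d d0 yd] := (nbhs_rVP _ _).1 (filterI df cfi).
near=> z; rewrite /q; case: eqVneq => [|zy]; first by rewrite subrr normr0.
have zd : `|z - y| < d.
  by near: z; apply/nbhs_rVP; exists d.
have yd' (t : R) : `|t| <= `|z 0 i - y 0 i| -> `|tr i z + t *: 'e_i - y| < d.
  move=> tv; apply: le_lt_trans zd; apply: rV_norm_le => // j.
  have zj : `|z 0 j - y 0 j| <= `|z - y|.
    by have := rV_norm_coord (z - y) j; rewrite !mxE.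
  rewrite !mxE /=; have [->|ji] := eqVneq j i.
    by rewrite ltnn mulr1 addrAC subrr add0r (le_trans tv)//;
       have := rV_norm_coord (z - y) i; rewrite !mxE.
  by rewrite mulr0 addr0; case: ifP; rewrite ?subrr ?normr0.
rewrite trS.
have [|c cs ->] := @MVT_line _ f (tr i z) 'e_i (z 0 i - y 0 i).
  by move=> t /yd' /yd [+ _]; apply.
rewrite mulrC mulKf ?subr_eq0 //.
by have [_] := yd _ (yd' c cs); exact.
Unshelve. all: by end_near. Qed.

(** The increment of [f] along the curve [t |-> h (t v + x)] is expanded by
    [caratheodory], and the limit is taken in each coefficient. *)
Lemma is_derive_comp_rV (V : normedModType R) m (f : 'rV[R]_m -> R)
    (h : V -> 'rV[R]_m) x v :
  (\forall z \near h x, forall i, derivable f z 'e_i) ->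
  (forall i, {for h x, continuous ('d_i f)}) ->
  (forall i, derivable (fun z => h z 0 i) x v) ->
  is_derive x v (f \o h) (\sum_i 'd_i f (h x) * 'D_v (fun z => h z 0 i) x).
Proof.
move=> df cf dh; have [q [qc fq]] := caratheodory df cf.
suff C : (fun t : R => t^-1 *: (((f \o h) \o shift x) (t *: v) - (f \o h) x)) @ 0^' -->
    (\sum_i 'd_i f (h x) * 'D_v (fun z => h z 0 i) x : R).
  by split; [apply/cvg_ex; eexists; exact: C|exact: cvg_lim C].
rewrite (_ : (fun t : R => _) = fun t => \sum_i
    (t^-1 *: (h (t *: v + x) 0 i - h x 0 i) * q i (h (t *: v + x)))); last first.
  apply/funext => t; rewrite /= fq scaler_sumr; apply: eq_bigr => i _.
  by rewrite scalerAl.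
apply: cvg_big => [|i _]; first exact: add_continuous.
rewrite mulrC; apply: cvgM; first exact: dh.
have [<- qi] := qc i.
apply: (@cvg_comp _ _ _ (fun t : R => h (t *: v + x)) (q i) _ (nbhs (h x))) => //.
apply: cvg_rV => j.
exact: (@derivable_line _ (fun z => h z 0 j) x v (dh j)).
Qed.

End Partial.

(** * Functions of class C^k *)

Section Ck.
Context {R : realType} {m : nat}.
Implicit Types (f g : 'rV[R]_m -> R) (U V : set 'rV[R]_m) (x z : 'rV[R]_m).

Lemma Ck_on_sub k U V f : V `<=` U -> Ck_on k U f -> Ck_on k V f.
Proof.
elim: k f => [|k IH] f VU [cf df]; first by split=> [x /VU /cf|].
split=> [x /VU /cf //|i].
by have [d1 d2] := df i; split=> [x /VU /d1 //|]; exact: IH.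
Qed.

Lemma Ck_on_continuous k U f x : Ck_on k U f -> U x -> {for x, continuous f}.
Proof. by case: k => [|k] [cf _]; exact: cf. Qed.

Lemma Ck_onP k U f : Ck_on k U f <-> forall x, U x -> Ck_on k [set x] f.
Proof.
split=> [Uf x Ux|]; first by apply: Ck_on_sub Uf => _ ->.
elim: k f => [|k IH] f Uf; first by split=> // x /Uf [+ _]; exact.
split=> [x /Uf [+ _]|]; first exact.
move=> i; split=> [x /Uf [_ /(_ i) [+ _]]|]; first exact.
by apply: IH => x /Uf [_ /(_ i) []].
Qed.

Lemma continuous_ext (T X : topologicalType) (V W : T -> X) (x : T) :
  (\forall z \near x, V z = W z) -> {for x, continuous V} -> {for x, continuous W}.
Proof.
move=> VW; rewrite /prop_for /continuous_at -(nbhs_singleton VW).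
by apply: cvg_trans; apply: near_eq_cvg.
Qed.

Lemma Ck_on_ext k U f g : open U -> (forall x, U x -> f x = g x) ->
  Ck_on k U f -> Ck_on k U g.
Proof.
elim: k f g => [|k IH] f g oU fg [cf df].
  split=> // x Ux; apply: continuous_ext (cf x Ux).
  by near=> z; apply: fg; near: z; exact: open_nbhs_nbhs.
have fg' x : U x -> \forall z \near x, f z = g z.
  by move=> Ux; near=> z; apply: fg; near: z; exact: open_nbhs_nbhs.
split=> [x Ux|i]; first exact: continuous_ext (fg' x Ux) (cf x Ux).
have [d1 d2] := df i; split=> [x Ux|].
  exact: near_eq_derivable (fg' x Ux) (d1 x Ux).
by apply: IH d2 => // x Ux; exact: near_eq_derive (fg' x Ux).
Unshelve. all: by end_near. Qed.

Lemma Ck_onS k U f : Ck_on k.+1 U f -> Ck_on k U f.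
Proof.
elim: k f => [|k IH] f [cf df]; first by split.
split=> // i.
by have [d1 d2] := df i; split=> //; exact: IH.
Qed.

Lemma Ck_onD k U f g : open U -> Ck_on k U f -> Ck_on k U g ->
  Ck_on k U (fun x => f x + g x).
Proof.
elim: k f g => [|k IH] f g oU [cf df] [cg dg].
  by split=> // x Ux; apply: continuousD; [exact: cf|exact: cg].
split=> [x Ux|i]; first by apply: continuousD; [exact: cf|exact: cg].
have [f1 f2] := df i; have [g1 g2] := dg i; split=> [x Ux|].
  by apply: derivableD; [exact: f1|exact: g1].
apply: Ck_on_ext (IH _ _ oU f2 g2) => // x Ux.
by rewrite (@deriveD _ _ _ f g) //; [exact: f1|exact: g1].
Qed.

Lemma Ck_onM k U f g : open U -> Ck_on k U f -> Ck_on k U g ->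
  Ck_on k U (fun x => f x * g x).
Proof.
elim: k f g => [|k IH] f g oU Cf Cg.
  have [[cf _] [cg _]] := (Cf, Cg).
  by split=> // x Ux; apply: continuousM; [exact: cf|exact: cg].
have [[cf df] [cg dg]] := (Cf, Cg).
split=> [x Ux|i]; first by apply: continuousM; [exact: cf|exact: cg].
have [f1 f2] := df i; have [g1 g2] := dg i; split=> [x Ux|].
  by apply: derivableM; [exact: f1|exact: g1].
have := Ck_onD oU (IH _ _ oU (Ck_onS Cf) g2) (IH _ _ oU (Ck_onS Cg) f2).
apply: Ck_on_ext => // x Ux.
by rewrite (@deriveM _ _ f g) //; [exact: f1|exact: g1].
Qed.

Lemma Ck_onV k U f : open U -> (forall x, U x -> f x != 0) -> Ck_on k U f ->
  Ck_on k U (fun x => (f x)^-1).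
Proof.
move=> oU f0; elim: k => [|k IH] Cf; have [cf df] := Cf.
  by split=> // x Ux; apply: continuousV; [exact: f0|exact: cf].
split=> [x Ux|i]; first by apply: continuousV; [exact: f0|exact: cf].
have [f1 f2] := df i; have Cv := IH (Ck_onS Cf); split=> [x Ux|].
  by apply: derivableV; [exact: f0|exact: f1].
have := Ck_onM oU (Ck_on_cst k U (-1)) (Ck_onM oU (Ck_onM oU Cv Cv) f2).
apply: Ck_on_ext => // x Ux.
rewrite (@deriveV _ _ f) //; [|exact: f0|exact: f1].
by rewrite -[_ *: _]/(_ * _) expr2 invfM; ring.
Qed.

Lemma Ck_on_sum (I : Type) (r : seq I) k U (f : I -> 'rV[R]_m -> R) :
  open U -> (forall i, Ck_on k U (f i)) -> Ck_on k U (fun x => \sum_(i <- r) f i x).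
Proof.
move=> oU Cf; elim: r => [|i r IH].
  by apply: Ck_on_ext (Ck_on_cst k U 0) => // x _; rewrite big_nil.
by apply: Ck_on_ext (Ck_onD oU (Cf i) IH) => // x _; rewrite big_cons.
Qed.

Lemma Ck_on_expN k U (j : 'I_m) : open U -> Ck_on k U (fun x => expR (- x 0 j)).
Proof.
move=> oU.
have D (x : 'rV[R]_m) i : is_derive x 'e_i (fun x : 'rV[R]_m => expR (- x 0 j))
    (- ('e_i : 'rV[R]_m) 0 j * expR (- x 0 j)).
  have dc : is_derive x 'e_i (fun x : 'rV[R]_m => - x 0 j) (- ('e_i : 'rV[R]_m) 0 j).
    by have dc := is_derive_coord x 'e_i j; exact: is_deriveN.
  have := @is_derive_comp1 _ _ expR (fun x : 'rV[R]_m => - x 0 j) x 'e_i.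
  by rewrite !derive_val mulrC; apply; [exact: derivable_expR|].
have C : forall x : 'rV[R]_m, {for x, continuous (fun x : 'rV[R]_m => expR (- x 0 j))}.
  move=> x.
  apply: (@continuous_comp _ _ _ (fun x : 'rV[R]_m => - x 0 j) expR).
    by apply: continuousN; exact: coord_continuous.
  exact: continuous_expR.
elim: k => [|k IH]; split=> // i.
split=> [x Ux|]; first exact: ex_derive.
apply: Ck_on_ext (Ck_onM oU (Ck_on_cst k U (- ('e_i : 'rV[R]_m) 0 j)) IH) => // x Ux.
by rewrite derive_val.
Qed.

End Ck.

(** By induction on [k]: the chain rule expresses the partial derivatives of
    the composite through functions of class [C^k]. *)
Lemma Ck_on_comp (R : realType) m l k (U : set 'rV[R]_m) (V : set 'rV[R]_l)
    (h : 'rV[R]_m -> 'rV[R]_l) f : open U -> open V -> (forall x, U x -> V (h x)) ->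
  (forall j, Ck_on k U (fun x => h x 0 j)) -> Ck_on k V f -> Ck_on k U (f \o h).
Proof.
move=> oU oV UV; elim: k f => [|k IH] f Ch Cf; have [cf df] := Cf.
  split=> // x Ux; apply: continuous_comp; last exact/cf/UV.
  by apply: continuous_rV => j; have [+ _] := Ch j; exact.
split=> [x Ux|i].
  apply: continuous_comp; last exact/cf/UV.
  by apply: continuous_rV => j; have [+ _] := Ch j; exact.
have D x : U x -> is_derive x 'e_i (f \o h)
    (\sum_j 'd_j f (h x) * 'd_i (fun z => h z 0 j) x).
  move=> Ux; apply: is_derive_comp_rV.
  - near=> z; move=> j; apply: (df j).1.
    near: z; apply: open_nbhs_nbhs; split=> //; exact: UV.
  - by move=> j; apply: (Ck_on_continuous (df j).2); exact: UV.
  - by move=> j; have [_ /(_ i) [+ _]] := Ch j; exact.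
split=> [x Ux|]; first by have [] := D x Ux.
apply: (@Ck_on_ext _ _ _ _ (fun x => \sum_j 'd_j f (h x) * 'd_i (fun z => h z 0 j) x)) => //.
  by move=> x Ux; have := D x Ux => dx; rewrite derive_val.
apply: Ck_on_sum => // j; apply: Ck_onM => //.
  apply: (IH ('d_j f)); last by have [] := df j.
  by move=> j'; exact: Ck_onS.
by have [_ /(_ i) []] := Ch j.
Unshelve. all: by end_near. Qed.

(** * Germs of smooth functions *)

(** One neighbourhood of [x] serves for all orders of differentiation. *)
Definition smooth_rV_at {R : realType} m (x : 'rV[R]_m) (f : 'rV[R]_m -> R) :=
  \forall z \near x, smooth_on_rV [set z] f.

Section SmoothRV.
Context {R : realType}.

Lemma nearW_rV m (x : 'rV[R]_m) (P : 'rV[R]_m -> Prop) :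
  (forall z, P z) -> \forall z \near x, P z.
Proof. by move=> H; exact: (@filterE _ (nbhs x)). Qed.

Lemma filterS_rV m (x : 'rV[R]_m) (P Q : 'rV[R]_m -> Prop) :
  (forall z, P z -> Q z) -> (\forall z \near x, P z) -> \forall z \near x, Q z.
Proof. by move=> PQ; exact: (@filterS _ (nbhs x)). Qed.

Lemma smooth_rV_atP m (x : 'rV[R]_m) f :
  smooth_rV_at x f <-> exists U, [/\ open U, U x & smooth_on_rV U f].
Proof.
split=> [sf|[U [oU Ux sU]]].
  exists (interior [set z | smooth_on_rV [set z] f]); split=> //.
    exact: open_interior.
  by move=> k; apply/Ck_onP => z /interior_subset; exact.
near=> z; move=> k; apply: Ck_on_sub (sU k) => _ ->.
by near: z; exact: open_nbhs_nbhs.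
Unshelve. all: by end_near. Qed.

Lemma near_smooth_rV m (x : 'rV[R]_m) f :
  smooth_rV_at x f -> \forall z \near x, smooth_rV_at z f.
Proof. exact: (@near_join _ _ (fun z => smooth_on_rV [set z] f)). Qed.

Lemma smooth_on_rVP m (U : set 'rV[R]_m) f : open U ->
  smooth_on_rV U f <-> forall x, U x -> smooth_rV_at x f.
Proof.
move=> oU; split=> [sf x Ux|sf k]; first by apply/smooth_rV_atP; exists U.
by apply/Ck_onP => x /sf sx; exact: (nbhs_singleton sx).
Qed.

Lemma smooth_rV_ext m (x : 'rV[R]_m) f g :
  (\forall z \near x, f z = g z) -> smooth_rV_at x f -> smooth_rV_at x g.
Proof.
move=> fg /smooth_rV_atP[U [oU Ux sf]].
have fgU : nbhs x (U `&` [set z | f z = g z]).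
  by apply: filterI => //; exact: open_nbhs_nbhs.
apply/smooth_rV_atP; exists (interior (U `&` [set z | f z = g z])); split=> //.
  exact: open_interior.
move=> k; apply: (@Ck_on_ext _ _ _ _ f); first exact: open_interior.
  by move=> z /interior_subset [].
by apply: Ck_on_sub (sf k) => z /interior_subset [].
Qed.

(** The two germs are smooth on different open sets; the passage to the
    intersection is made once for sums and products. *)
Lemma smooth_rV_op2 m (op : R -> R -> R) (x : 'rV[R]_m) f g :
  (forall k U, open U -> Ck_on k U f -> Ck_on k U g ->
    Ck_on k U (fun z => op (f z) (g z))) ->
  smooth_rV_at x f -> smooth_rV_at x g -> smooth_rV_at x (fun z => op (f z) (g z)).
Proof.
move=> H /smooth_rV_atP[U [oU Ux sf]] /smooth_rV_atP[V [oV Vx sg]].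
apply/smooth_rV_atP; exists (U `&` V); split=> //; first exact: openI.
move=> k; apply: H; first exact: openI.
  by apply: Ck_on_sub (sf k) => z [].
by apply: Ck_on_sub (sg k) => z [].
Qed.

Lemma smooth_rV_cst m (x : 'rV[R]_m) a : smooth_rV_at x (fun=> a).
Proof. by apply: nearW_rV => z k; exact: Ck_on_cst. Qed.

Lemma smooth_rV_coord m (x : 'rV[R]_m) j : smooth_rV_at x (fun z => z 0 j).
Proof. by apply: nearW_rV => z k; exact: Ck_on_coord. Qed.

Lemma smooth_rV_expN m (x : 'rV[R]_m) j :
  smooth_rV_at x (fun z => expR (- z 0 j)).
Proof.
apply/smooth_rV_atP; exists setT; split=> //; first exact: openT.
by move=> k; apply: Ck_on_expN; exact: openT.
Qed.

Lemma smooth_rVD m (x : 'rV[R]_m) f g : smooth_rV_at x f -> smooth_rV_at x g ->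
  smooth_rV_at x (fun z => f z + g z).
Proof. by apply: smooth_rV_op2 => k U; exact: Ck_onD. Qed.

Lemma smooth_rVM m (x : 'rV[R]_m) f g : smooth_rV_at x f -> smooth_rV_at x g ->
  smooth_rV_at x (fun z => f z * g z).
Proof. by apply: smooth_rV_op2 => k U; exact: Ck_onM. Qed.

Lemma smooth_rV_continuous m (x : 'rV[R]_m) f :
  smooth_rV_at x f -> {for x, continuous f}.
Proof. by move=> /nbhs_singleton /(_ 0) /Ck_on_continuous; exact. Qed.

Lemma smooth_rV_derivable m (x : 'rV[R]_m) f i :
  smooth_rV_at x f -> derivable f x 'e_i.
Proof. by move=> /nbhs_singleton /(_ 1) [_ /(_ i) [+ _]]; exact. Qed.

Lemma smooth_rV_derive m (x : 'rV[R]_m) f i :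
  smooth_rV_at x f -> smooth_rV_at x ('d_i f).
Proof.
by apply: filterS => z sz k; have [_ /(_ i) []] := sz k.+1.
Qed.

Lemma smooth_rV_comp m l (x : 'rV[R]_m) (h : 'rV[R]_m -> 'rV[R]_l) f :
  (forall j, smooth_rV_at x (fun z => h z 0 j)) -> smooth_rV_at (h x) f ->
  smooth_rV_at x (f \o h).
Proof.
move=> sh /smooth_rV_atP[V [oV Vx sf]].
pose A := [set z | V (h z) /\ forall j, smooth_on_rV [set z] (fun z => h z 0 j)].
have hA : nbhs x A.
  apply: filterI; last by apply: (@filter_forall _ _ _ (nbhs x)) => j; exact: sh.
  have ch : {for x, continuous h}.
    by apply: continuous_rV => j; exact: smooth_rV_continuous.
  by apply: ch; exact: open_nbhs_nbhs.
apply/smooth_rV_atP; exists (interior A); split=> //; first exact: open_interior.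
move=> k; apply: (Ck_on_comp _ oV _ _ (sf k)); first exact: open_interior.
  by move=> z /interior_subset [].
by move=> j; apply/Ck_onP => z /interior_subset [_ /(_ j k)].
Qed.

Lemma is_derive_smooth_comp (V : normedModType R) m (f : 'rV[R]_m -> R)
    (h : V -> 'rV[R]_m) x v : smooth_rV_at (h x) f ->
  (forall i, derivable (fun z => h z 0 i) x v) ->
  is_derive x v (f \o h) (\sum_i 'd_i f (h x) * 'D_v (fun z => h z 0 i) x).
Proof.
move=> sf; apply: is_derive_comp_rV.
  by apply: filterS (near_smooth_rV sf) => z sz i; exact: smooth_rV_derivable.
by move=> i; apply: smooth_rV_continuous; exact: smooth_rV_derive.
Qed.

(** The mean value theorem is applied to [z |-> f (z + h e_j) - f z] in the
    direction [e_i], and then to ['d_i f] in the direction [e_j]. *)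
Lemma second_difference m (f : 'rV[R]_m -> R) x i j (r h : R) :
  (forall z, `|z - x| < r -> smooth_rV_at z f) -> 0 <= h -> h + h < r ->
  exists2 z, `|z - x| < r &
    f (x + h *: 'e_i + h *: 'e_j) - f (x + h *: 'e_i) - (f (x + h *: 'e_j) - f x)
    = h * h * 'd_j ('d_i f) z.
Proof.
move=> sf h0 hr.
have near_x (a b : R) : 0 <= a <= h -> 0 <= b <= h -> `|x + a *: 'e_i + b *: 'e_j - x| < r.
  move=> /andP[a0 ah] /andP[b0 bh]; apply: le_lt_trans hr.
  apply: rV_norm_le => [|k]; first exact: addr_ge0.
  rewrite !mxE /= addrAC [x 0 k + _ - _]addrAC subrr add0r.
  apply: le_trans (ler_normD _ _) _; rewrite !normrM !ger0_norm // ?lerD //.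
  - by case: eqVneq => _ /=; rewrite ?mulr1 ?mulr0.
  - by case: eqVneq => _ /=; rewrite ?mulr1 ?mulr0.
have h00 : 0 <= (0 : R) <= h by rewrite lexx.
have hh : 0 <= h <= h by rewrite h0 lexx.
pose G z := f (z + h *: 'e_j) - f z.
have dG (c : R) : 0 <= c <= h -> is_derive (x + c *: 'e_i) 'e_i G
    ('d_i f (x + c *: 'e_i + h *: 'e_j) - 'd_i f (x + c *: 'e_i)).
  move=> ch; apply: is_deriveB.
    have df := @smooth_rV_derivable _ _ f i (sf _ (near_x _ _ ch hh)).
    have [D1 D2] := derive_same_line (f := f) (g := fun z => f (z + h *: 'e_j))
      (fun t => congr1 f (addrA (t *: 'e_i) (x + c *: 'e_i) (h *: 'e_j))).
    by split; [exact: D2|rewrite -D1].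
  apply: derivableP; apply: smooth_rV_derivable; apply: sf.
  by have := near_x _ _ ch h00; rewrite scale0r addr0.
have [c ch|c ch E1] := @MVT_line_ge0 _ _ G x 'e_i h h0; first by have [] := dG c ch.
have [t th|c' ch' E2] := @MVT_line_ge0 _ _ ('d_i f) (x + c *: 'e_i) 'e_j h h0.
  by apply: smooth_rV_derivable; apply: smooth_rV_derive; apply: sf; exact: near_x.
exists (x + c *: 'e_i + c' *: 'e_j); first exact: near_x.
rewrite -/(G x) -/(G (x + h *: 'e_i)) E1.
by have [_ ->] := dG c ch; rewrite E2 mulrA.
Qed.

Lemma distr_le_splitl (e a b u v : R) :
  `|a - u| < e / 2 -> `|b - v| < e / 2 -> v = u -> `|a - b| <= e.
Proof. by move=> /ltr_normlP[? ?] /ltr_normlP[? ?] ?; apply/ler_normlP; split; lra. Qed.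

(** Both iterated partial derivatives are limits of the same second
    difference quotient. *)
Lemma schwarz m (f : 'rV[R]_m -> R) x i j :
  smooth_rV_at x f -> 'd_i ('d_j f) x = 'd_j ('d_i f) x.
Proof.
move=> sf; apply/eqP; rewrite -subr_eq0 -normr_le0; apply/ler_addgt0Pl => e e0.
rewrite addr0.
have c i' j' : \forall z \near x, `|'d_i' ('d_j' f) x - 'd_i' ('d_j' f) z| < e / 2.
  apply: (continuous_rV_distP _ _).1; last by rewrite divr_gt0.
  by apply: smooth_rV_continuous; do 2 apply: smooth_rV_derive.
have [r r0 H] := (nbhs_rVP _ _).1 (filterI (near_smooth_rV sf) (filterI (c i j) (c j i))).
have sr z : `|z - x| < r -> smooth_rV_at z f by move=> /H [].
pose h := r / 3.
have h0 : 0 < h by rewrite divr_gt0.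
have hr : h + h < r by rewrite /h; lra.
have [z /H [_ [_ zr]] E] := @second_difference _ f x i j r h sr (ltW h0) hr.
have [z' /H [_ [zr' _]] E'] := @second_difference _ f x j i r h sr (ltW h0) hr.
have cancel_h (a b u v w y : R) : a - b - (u - w) = h * h * v ->
    a - u - (b - w) = h * h * y -> v = y.
  by move=> E1 E2; apply: (mulfI (lt0r_neq0 (mulr_gt0 h0 h0))); rewrite -E1 -E2; ring.
rewrite (addrAC x) in E'.
exact: distr_le_splitl zr' zr (cancel_h _ _ _ _ _ _ E E').
Qed.

End SmoothRV.

(** * The implicit function theorem for one equation *)

Section ContinuousSign.
Context {R : realType} {T : topologicalType}.
Implicit Types (h : T -> R) (x : T).

Lemma continuous_near_gt h x c : {for x, continuous h} -> c < h x ->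
  \forall z \near x, c < h z.
Proof. by move=> ch; exact: cvgr_gt ch c. Qed.

Lemma continuous_near_lt h x c : {for x, continuous h} -> h x < c ->
  \forall z \near x, h z < c.
Proof. by move=> ch; exact: cvgr_lt ch c. Qed.

End ContinuousSign.

Lemma open_rV_ball (R : realType) m (p : 'rV[R]_m) (r : R) :
  open [set x | `|x - p| < r].
Proof.
rewrite openE => x xp; apply/nbhs_rVP; exists (r - `|x - p|).
  by rewrite subr_gt0.
move=> z; rewrite ltrBrDr => zx; apply: le_lt_trans zx.
by rewrite -(subrKA x) ler_normD.
Qed.

Section ImplicitFunction.
Context {R : realType} {m : nat} (i : 'I_m.+1).
Implicit Types (x p : 'rV[R]_m.+1) (y : 'rV[R]_m) (t : R).

(** [insert] and [delete] identify [R x R^m] with [R^(m+1)] by means of the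
    [i]-th coordinate. *)
Definition insert t y : 'rV[R]_m.+1 :=
  \row_j (if unlift i j is Some k then y 0 k else t).

Definition delete x : 'rV[R]_m := \row_k x 0 (lift i k).

Lemma insert_lift t y k : insert t y 0 (lift i k) = y 0 k.
Proof. by rewrite mxE liftK. Qed.

Lemma insert_at t y : insert t y 0 i = t.
Proof. by rewrite mxE unlift_none. Qed.

Lemma delete_insert t y : delete (insert t y) = y.
Proof. by apply/rowP => k; rewrite mxE insert_lift. Qed.

Lemma insert_delete x : insert (x 0 i) (delete x) = x.
Proof.
by apply/rowP => j; rewrite mxE; case: unliftP => [k ->|->//]; rewrite mxE.
Qed.

Lemma insertD t s y : insert (t + s) y = insert t y + s *: 'e_i.
Proof.
apply/rowP => j; rewrite !mxE eqxx /=; case: unliftP => [k ->|->].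
  by rewrite eq_sym (negPf (neq_lift _ _)) mulr0 addr0.
by rewrite eqxx mulr1.
Qed.

Lemma insert_norm t y p (d : R) : 0 < d ->
  `|t - p 0 i| < d -> `|y - delete p| < d -> `|insert t y - p| < d.
Proof.
move=> d0 td yd.
suff : `|insert t y - p| <= Num.max `|t - p 0 i| `|y - delete p|.
  by move=> /le_lt_trans; apply; rewrite gt_max td.
apply: rV_norm_le => [|j]; first by rewrite le_max normr_ge0.
rewrite !mxE le_max; case: unliftP => [k ->|->]; last by rewrite lexx.
by have := rV_norm_coord (y - delete p) k; rewrite !mxE => ->; rewrite orbT.
Qed.

Lemma continuous_insert (h : 'rV[R]_m -> R) y :
  {for y, continuous h} -> {for y, continuous (fun y => insert (h y) y)}.
Proof.
move=> hy; apply: continuous_rV => j; case: (unliftP i j) => [k ->|->].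
  apply: (@continuous_ext _ _ (fun y : 'rV[R]_m => y 0 k)).
    by apply: nearW_rV => z; rewrite insert_lift.
  exact: coord_continuous.
apply: continuous_ext hy.
by apply: nearW_rV => z; rewrite insert_at.
Qed.

(** Let [f] vanish on the graph of a continuous function [g], with a nonzero
    [i]-th partial derivative there.  Then [g] is as smooth as [f]. *)
Section Graph.
Variables (f : 'rV[R]_m.+1 -> R) (V : set 'rV[R]_m.+1) (g : 'rV[R]_m -> R)
  (W : set 'rV[R]_m).
Hypotheses (oV : open V) (oW : open W).
Hypothesis sf : forall x, V x -> smooth_rV_at x f.
Hypothesis fi : forall x, V x -> 'd_i f x != 0.
Hypothesis VW : forall y, W y -> V (insert (g y) y).
Hypothesis fg : forall y, W y -> f (insert (g y) y) = 0.
Hypothesis cg : forall y, W y -> {for y, continuous g}.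

(** The increment of [f] along the graph is zero; by [caratheodory] this is a
    linear relation between the increments of [g] and of the [k]-th coordinate,
    with coefficients that tend to the partial derivatives. *)
Lemma is_derive_graph y k : W y -> is_derive y 'e_k g
  (- ('d_(lift i k) f (insert (g y) y) / 'd_i f (insert (g y) y))).
Proof.
move=> Wy; have Vy := VW Wy; set p := insert (g y) y in Vy *.
have [||q [qc fq]] := @caratheodory _ _ f p.
- by apply: filterS (near_smooth_rV (sf Vy)) => z sz j; exact: smooth_rV_derivable.
- by move=> j; apply: smooth_rV_continuous; apply: smooth_rV_derive; exact: sf.
pose c (t : R) := t *: 'e_k + y.
have c0 : c 0 = y by rewrite /c scale0r add0r.
have cc : {for (0 : R), continuous c}.
  by apply: continuousD; [exact: scalel_continuous|exact: cst_continuous].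
pose x t := insert (g (c t)) (c t).
have x0 : x 0 = p by rewrite /x c0.
have cx : {for (0 : R), continuous x}.
  apply: (@continuous_comp _ _ _ c (fun y => insert (g y) y)) => //.
  by rewrite c0; apply: continuous_insert; exact: cg.
have cq j : {for (0 : R), continuous (q j \o x)}.
  by apply: continuous_comp => //; rewrite x0; have [] := qc j.
have eq_quot : \forall t \near (0 : R)^',
    - (q (lift i k) (x t) / q i (x t)) = t^-1 *: (g (c t) - g y).
  have qi0 : \forall t \near (0 : R), q i (x t) != 0.
    apply: (cq i [set u | u != 0]); apply: open_nbhs_nbhs; split.
      exact: open_neq.
    by rewrite /= x0; have [-> _] := qc i; exact: fi.
  have Wc : \forall t \near (0 : R), W (c t).
    by apply: cc; rewrite c0; exact: open_nbhs_nbhs.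
  near=> t.
  have t0 : t != 0 by near: t; exact: nbhs_dnbhs_neq.
  have qt : q i (x t) != 0 by near: t; apply: nbhs_dnbhs.
  have Wt : W (c t) by near: t; apply: nbhs_dnbhs.
  have := fq (x t); rewrite /x fg // fg // subrr (bigD1_ord i) //= !insert_at.
  rewrite (bigD1 k) //= big1 ?addr0 => [|l lk].
    rewrite !insert_lift !mxE !eqxx mulr1 addrK => /eqP.
    rewrite eq_sym addr_eq0 => /eqP E.
    rewrite -[_ *: _]/(_ * _); apply: (mulIf qt).
    by rewrite mulNr divfK // -mulrA E mulrN mulKf.
  by rewrite !insert_lift !mxE eqxx /= (negPf lk) mulr0 add0r subrr mul0r.
have lim : t^-1 *: (g (c t) - g y) @[t --> 0^'] -->
    - ('d_(lift i k) f p / 'd_i f p).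
  apply: cvg_trans (near_eq_cvg eq_quot) _.
  have [qk _] := qc (lift i k); have [qi _] := qc i.
  rewrite -qk -qi -x0; apply: cvgN; apply: cvgM.
    exact: cvg_within_filter (cq _).
  apply: cvgV; first by rewrite x0 qi; exact: fi.
  exact: cvg_within_filter (cq _).
by split; [apply/cvg_ex; eexists; exact: lim|exact: cvg_lim lim].
Unshelve. all: by end_near. Qed.

(** The formula for the derivatives of [g] involves [g] itself only through
    the point of the graph, so class [C^k] of [g] gives class [C^k] of its
    derivatives. *)
Lemma smooth_graph : smooth_on_rV W g.
Proof.
have Cf k : Ck_on k V f by apply: (smooth_on_rVP _ oV).2.
have Ci k j : Ck_on k V ('d_j f) by have [_ /(_ j) []] := Cf k.+1.
move=> k; elim: k => [|k IH]; first by split=> // y; exact: cg.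
split=> [y /cg//|l]; split=> [y Wy|].
  by have [] := is_derive_graph l Wy.
have C : Ck_on k V (fun x => - 1 * ('d_(lift i l) f x * ('d_i f x)^-1)).
  apply: Ck_onM => //; first exact: Ck_on_cst.
  by apply: Ck_onM => //; apply: Ck_onV => // x; exact: fi.
have Ch j : Ck_on k W (fun y => insert (g y) y 0 j).
  case: (unliftP i j) => [k' ->|->].
    by apply: Ck_on_ext (Ck_on_coord k W k') => // y _; rewrite insert_lift.
  by apply: Ck_on_ext IH => // y _; rewrite insert_at.
apply: Ck_on_ext (Ck_on_comp oW oV VW Ch C) => // y Wy.
by have [_ ->] := is_derive_graph l Wy; rewrite /= mulN1r.
Qed.

End Graph.

(** In a ball where the [i]-th partial derivative is positive, [f] increases
    along the [i]-th direction.  At distance [d] below and above [p] the signs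
    of [f] are negative and positive, and they persist for nearby values of the
    other coordinates; between them there is exactly one zero. *)
Lemma implicit_function_pos f p (A : set 'rV[R]_m.+1) :
  nbhs p A -> smooth_rV_at p f -> f p = 0 -> 0 < 'd_i f p ->
  exists (N : set 'rV[R]_m.+1) (W : set 'rV[R]_m) (g : 'rV[R]_m -> R),
    [/\ open N, N p, N `<=` A, open W & smooth_on_rV W g] /\
    [/\ forall x, N x -> W (delete x),
        forall x, N x -> f x = 0 -> insert (g (delete x)) (delete x) = x &
        forall y, W y -> N (insert (g y) y) /\ f (insert (g y) y) = 0].
Proof.
move=> nA sf fp fi.
have fi_near : \forall z \near p, 0 < 'd_i f z.
  have cfi : {for p, continuous ('d_i f)}.
    by apply: smooth_rV_continuous; exact: smooth_rV_derive.
  exact: continuous_near_gt.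
have [r r0 H] := (nbhs_rVP _ _).1 (filterI nA (filterI (near_smooth_rV sf) fi_near)).
pose a := p 0 i; pose b := delete p; pose B := [set x | `|x - p| < r].
have oB : open B by exact: open_rV_ball.
have Bin t y : `|t - a| < r -> `|y - b| < r -> B (insert t y).
  by move=> ta yb; exact: insert_norm.
have sB x : B x -> smooth_rV_at x f by move=> /H [_ []].
have fB x : B x -> 0 < 'd_i f x by move=> /H [_ []].
have incr t s y : `|t - a| < r -> `|s - a| < r -> `|y - b| < r -> t < s ->
    f (insert t y) < f (insert s y).
  move=> ta sa yb ts; have st0 : 0 <= s - t by rewrite subr_ge0 ltW.
  have Bu u : 0 <= u <= s - t -> B (insert t y + u *: 'e_i).
    move=> /andP[u0 us]; rewrite -insertD; apply: Bin => //.
    move: ta sa => /ltr_normlP[? ?] /ltr_normlP[? ?].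
    by apply/ltr_normlP; split; lra.
  have [u us|c cs E] := @MVT_line_ge0 _ _ f (insert t y) 'e_i (s - t) st0.
    by apply: smooth_rV_derivable; apply: sB; exact: Bu.
  rewrite -subr_gt0; rewrite -insertD subrKC in E; rewrite E mulr_gt0 ?subr_gt0 //.
  by apply: fB; exact: Bu.
(* [d < r] leaves room for the points [g y - h] and [g y + h] used for the
   continuity of [g] *)
pose d := r / 2.
have d0 : 0 < d by rewrite divr_gt0.
have dr : d < r by rewrite /d; lra.
have bb : `|b - b| < r by rewrite subrr normr0.
have cf t y : `|t - a| < r -> `|y - b| < r -> {for y, continuous (fun y => f (insert t y))}.
  move=> ta yb; apply: (@continuous_comp _ _ _ (fun y => insert t y) f).
    by apply: (@continuous_insert (fun=> t)); exact: cst_continuous.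
  by apply: smooth_rV_continuous; apply: sB; exact: Bin.
have near_pos t y : `|t - a| < r -> `|y - b| < r -> 0 < f (insert t y) ->
    \forall z \near y, 0 < f (insert t z).
  by move=> ta yb; apply: continuous_near_gt; exact: cf.
have near_neg t y : `|t - a| < r -> `|y - b| < r -> f (insert t y) < 0 ->
    \forall z \near y, f (insert t z) < 0.
  by move=> ta yb; apply: continuous_near_lt; exact: cf.
have pab : insert a b = p by exact: insert_delete.
have aa : `|a - a| < r by rewrite subrr normr0.
have adN : `|a - d - a| < r by rewrite addrAC subrr add0r normrN gtr0_norm.
have adP : `|a + d - a| < r by rewrite addrAC subrr add0r gtr0_norm.
pose W := interior [set y | `|y - b| < r /\
  (f (insert (a - d) y) < 0 /\ 0 < f (insert (a + d) y))].
have Wsub y : W y -> `|y - b| < r /\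
    (f (insert (a - d) y) < 0 /\ 0 < f (insert (a + d) y)).
  exact: interior_subset.
have oW : open W by exact: open_interior.
have Wb : W b.
  apply: filterI; first by apply/nbhs_rVP; exists r.
  apply: filterI.
    by apply: near_neg => //; rewrite -[0]fp -pab; apply: incr => //; lra.
  by apply: near_pos => //; rewrite -[0]fp -pab; apply: incr => //; lra.
have zero y : exists t, W y -> `|t - a| < d /\ f (insert t y) = 0.
  have [/Wsub [yb [fN fP]]|nW] := pselect (W y); last by exists 0.
  have adad : a - d <= a + d by lra.
  have [||t] := @IVT R (fun t => f (insert t y)) (a - d) (a + d) 0 adad.
  - apply: derivable_within_continuous => t; rewrite in_itv /= => /andP[ta td].
    have tr : `|t - a| < r by apply/ltr_normlP; split; lra.
    have := @is_derive_line _ _ f (insert 0 y) 'e_i t.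
    rewrite -insertD add0r; under eq_fun do rewrite -insertD add0r.
    by case=> //; apply: smooth_rV_derivable; apply: sB; exact: Bin.
  - by rewrite ge_min le_max (ltW fN) (ltW fP) orbT.
  rewrite in_itv /= => /andP[ta td] ft; exists t => _; split=> //.
  have t1 : t != a - d by apply: contraTneq fN => <-; rewrite ft ltxx.
  have t2 : t != a + d by apply: contraTneq fP => <-; rewrite ft ltxx.
  rewrite ltr_distl; apply/andP; split; by rewrite lt_neqAle ?ta ?td ?t2 1?eq_sym ?t1.
have /choice[g Hg] := zero.
have ga y : W y -> `|g y - a| < r by move=> /Hg [/lt_trans gd _]; exact: gd.
have uniq t y : W y -> `|t - a| < r -> f (insert t y) = 0 -> t = g y.
  move=> Wy ta ft; have [_ fg] := Hg y Wy; have [yb _] := Wsub y Wy.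
  have [tg|gt|//] := ltgtP t (g y).
    by have := incr _ _ _ ta (ga y Wy) yb tg; rewrite ft fg ltxx.
  by have := incr _ _ _ (ga y Wy) ta yb gt; rewrite ft fg ltxx.
pose N := [set x | W (delete x) /\ `|x 0 i - a| < d].
have cg y : W y -> {for y, continuous g}.
  move=> Wy; apply/continuous_rV_distP => e e0.
  have [gd fg] := Hg y Wy; have [yb _] := Wsub y Wy.
  pose h := Num.min (e / 2) ((r - d) / 2).
  have h0 : 0 < h by rewrite lt_min !divr_gt0 ?subr_gt0.
  have [he hr] : h <= e / 2 /\ h <= (r - d) / 2.
    by split; rewrite ge_min lexx ?orbT.
  have gP : `|g y + h - a| < r.
    by move: gd => /ltr_normlP[? ?]; apply/ltr_normlP; split; lra.
  have gN : `|g y - h - a| < r.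
    by move: gd => /ltr_normlP[? ?]; apply/ltr_normlP; split; lra.
  have fP : 0 < f (insert (g y + h) y).
    by rewrite -fg; apply: incr => //; [exact: ga|lra].
  have fN : f (insert (g y - h) y) < 0.
    by rewrite -fg; apply: incr => //; [exact: ga|lra].
  have nW : \forall z \near y, W z by exact: open_nbhs_nbhs.
  apply: filterS (filterI nW (filterI (near_pos _ _ gP yb fP) (near_neg _ _ gN yb fN))).
  move=> z [Wz [zP zN]]; have [zd fz] := Hg z Wz; have [zb _] := Wsub z Wz.
  have l1 : g z < g y + h.
    rewrite ltNge; apply/negP; rewrite le_eqVlt => /predU1P[E|].
      by move: zP; rewrite E fz ltxx.
    by move=> /(incr _ _ _ gP (ga z Wz) zb); rewrite fz => /lt_trans/(_ zP); rewrite ltxx.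
  have l2 : g y - h < g z.
    rewrite ltNge; apply/negP; rewrite le_eqVlt => /predU1P[E|].
      by move: zN; rewrite -E fz ltxx.
    by move=> /(incr _ _ _ (ga z Wz) gN zb); rewrite fz => /lt_trans/(_ zN); rewrite ltxx.
  by apply/ltr_normlP; split; lra.
exists N, W, g; split; [split=> //|split].
- rewrite openE => x [Wx xa]; apply: filterI.
    have cd : {for x, continuous delete}.
      apply: continuous_rV => k; apply: (@continuous_ext _ _ (fun x => x 0 (lift i k))).
        by apply: nearW_rV => z; rewrite mxE.
      exact: coord_continuous.
    by apply: cd; exact: open_nbhs_nbhs.
  apply: (@continuous_near_lt _ _ (fun x : 'rV[R]_m.+1 => `|x 0 i - a|)) => //.
  apply: (@continuous_comp _ _ _ (fun x : 'rV[R]_m.+1 => x 0 i - a) Num.norm).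
    by apply: continuousB; [exact: coord_continuous|exact: cst_continuous].
  exact: norm_continuous.
- by split=> //; rewrite subrr normr0.
- move=> x [/Wsub[xb _] xa]; suff /H[] : B x by [].
  by rewrite -(insert_delete x); apply: Bin => //; exact: lt_trans dr.
- apply: (@smooth_graph f B) => //.
  + by move=> x /fB; exact: lt0r_neq0.
  + by move=> y Wy; have [yb _] := Wsub y Wy; apply: Bin => //; exact: ga.
  + by move=> y /Hg[].
- by move=> x [].
- move=> x [Wx xa] fx; rewrite -(@uniq (x 0 i)) ?insert_delete //.
  exact: lt_trans dr.
- by move=> y Wy; have [gd fg] := Hg y Wy; split=> //; split; rewrite ?delete_insert ?insert_at.
Qed.

(** Replacing [f] by [- f] reduces to a positive derivative. *)
Lemma implicit_function f p (A : set 'rV[R]_m.+1) :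
  nbhs p A -> smooth_rV_at p f -> f p = 0 -> 'd_i f p != 0 ->
  exists (N : set 'rV[R]_m.+1) (W : set 'rV[R]_m) (g : 'rV[R]_m -> R),
    [/\ open N, N p, N `<=` A, open W & smooth_on_rV W g] /\
    [/\ forall x, N x -> W (delete x),
        forall x, N x -> f x = 0 -> insert (g (delete x)) (delete x) = x &
        forall y, W y -> N (insert (g y) y) /\ f (insert (g y) y) = 0].
Proof.
move=> nA sf fp fi; have [fi0|fi0] := ltP 0 ('d_i f p).
  exact: implicit_function_pos.
have sNf : smooth_rV_at p (fun x => -1 * f x).
  by apply: smooth_rVM => //; exact: smooth_rV_cst.
have [||N [W [g [H1 [H2 H3 H4]]]]] := implicit_function_pos nA sNf.
- by rewrite fp mulr0.
- have -> : (fun x => -1 * f x) = - f by apply/funext => x; rewrite mulN1r.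
  rewrite deriveN; last exact: smooth_rV_derivable.
  by rewrite oppr_gt0 lt_neqAle fi.
exists N, W, g; split=> //; split=> // [x Nx fx|y Wy].
  by apply: H3 => //; rewrite fx mulr0.
by have [Ny /eqP] := H4 y Wy; rewrite mulN1r oppr_eq0 => /eqP.
Qed.

End ImplicitFunction.

(** * Smooth germs and tangent vectors on a manifold *)

Section Chart.
Context {R : realType} {m : nat} (T : topologicalType) (c : chart R m T).
Hypothesis Hc : is_chart c.

Lemma chart_nbhs p : dom c p -> nbhs p (dom c).
Proof. by move=> cp; apply: open_nbhs_nbhs; split=> //; exact: open_dom. Qed.

Lemma near_inv_coord p (P : T -> Prop) : dom c p ->
  (\forall x \near p, P x) -> \forall v \near coord c p, P (inv_coord c v).
Proof.
move=> cp nP; have := @continuous_inv_coord _ _ _ _ Hc (coord c p).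
by rewrite /prop_for /continuous_at coordK //; apply => //; exists p.
Qed.

Lemma near_coord p (P : 'rV[R]_m -> Prop) : dom c p ->
  (\forall v \near coord c p, P v) -> \forall x \near p, P (coord c x).
Proof. by move=> cp nP; exact: (continuous_coord Hc cp). Qed.

Lemma near_inv_coordK p : dom c p ->
  \forall v \near coord c p, dom c (inv_coord c v) /\ coord c (inv_coord c v) = v.
Proof.
move=> cp; have oc : nbhs (coord c p) (coord c @` dom c).
  by apply: open_nbhs_nbhs; split; [exact: open_codom|exists p].
by apply: filterS_rV oc => _ [q cq <-]; rewrite coordK.
Qed.

Lemma open_coord_image (U : set T) : open U -> open (coord c @` (dom c `&` U)).
Proof.
move=> oU; rewrite openE => _ [p [cp Up] <-].
have nU : \forall x \near p, U x by exact: open_nbhs_nbhs.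
rewrite /interior /=.
apply: filterS_rV (filterI (near_inv_coordK cp) (near_inv_coord cp nU)) => v [[cv vK] Uv].
by exists (inv_coord c v).
Qed.

End Chart.

Section SmoothGerms.
Context {R : realType} {m : nat} (M : manifold R m).
Implicit Types (f g : M -> R) (p : M) (c d : chart R m M).

Lemma smooth_on_atP (U : set M) f : open U ->
  (forall p, U p -> smooth_at p f) <-> smooth_on U f.
Proof.
move=> oU; split=> [sf c Ac|sU p Up]; last by exists U.
have Hc := atlas_chart Ac.
apply/(smooth_on_rVP _ (open_coord_image Hc oU)) => _ [p [cp Up] <-].
have [V [oV Vp sV]] := sf p Up.
apply: (smooth_on_rVP _ (open_coord_image Hc oV)).1; first exact: sV.
by exists p.
Qed.

Lemma near_smooth_at p f : smooth_at p f -> \forall q \near p, smooth_at q f.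
Proof.
move=> [U [oU Up sU]]; apply: (@filterS _ _ _ U) => [q Uq|]; last exact: open_nbhs_nbhs.
by exists U.
Qed.

(** One chart suffices because the changes of coordinates are smooth. *)
Lemma smooth_atP c p f : atlas c -> dom c p ->
  smooth_at p f <-> smooth_rV_at (coord c p) (f \o inv_coord c).
Proof.
move=> Ac cp; have Hc := atlas_chart Ac; split=> [[U [oU Up sU]]|sf].
  apply: (smooth_on_rVP _ (open_coord_image Hc oU)).1; first exact: sU.
  by exists p.
pose A := [set x | dom c x /\ smooth_rV_at (coord c x) (f \o inv_coord c)].
have nA : nbhs p A.
  exact: filterI (chart_nbhs Hc cp) (near_coord Hc cp (near_smooth_rV sf)).
exists (interior A); split=> //; first exact: open_interior.
move=> d Ad; have Hd := atlas_chart Ad.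
apply/(smooth_on_rVP _ (open_coord_image Hd (@open_interior _ A))).
move=> _ [x [dx /interior_subset [cx sx]] <-].
apply: (@smooth_rV_ext _ _ _ ((f \o inv_coord c) \o (coord c \o inv_coord d))).
  have := near_inv_coord Hd dx (chart_nbhs Hc cx).
  by apply: filterS_rV => v cv; rewrite /= coordK.
apply: smooth_rV_comp; last by rewrite /= coordK.
move=> j; have := @atlas_compatible _ _ M d c Ad Ac j.
move=> /(smooth_on_rVP _ (open_coord_image Hd (open_dom Hc))); apply.
by exists x.
Qed.

Lemma smooth_at_ext p f g :
  (\forall x \near p, f x = g x) -> smooth_at p f -> smooth_at p g.
Proof.
move=> fg; have [c Ac cp] := atlas_cover p.
move=> /(smooth_atP _ Ac cp) sf; apply/(smooth_atP _ Ac cp).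
by apply: smooth_rV_ext sf; exact: (near_inv_coord (atlas_chart Ac) cp fg).
Qed.

Lemma smooth_at_cst p (a : R) : smooth_at p (fun _ : M => a).
Proof.
have [c Ac cp] := atlas_cover p.
by apply/(smooth_atP _ Ac cp); exact: smooth_rV_cst.
Qed.

Lemma smooth_atD p f g : smooth_at p f -> smooth_at p g ->
  smooth_at p (fun x => f x + g x).
Proof.
have [c Ac cp] := atlas_cover p.
move=> /(smooth_atP _ Ac cp) sf /(smooth_atP _ Ac cp) sg.
by apply/(smooth_atP _ Ac cp); exact: smooth_rVD sf sg.
Qed.

Lemma smooth_atM p f g : smooth_at p f -> smooth_at p g ->
  smooth_at p (fun x => f x * g x).
Proof.
have [c Ac cp] := atlas_cover p.
move=> /(smooth_atP _ Ac cp) sf /(smooth_atP _ Ac cp) sg.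
by apply/(smooth_atP _ Ac cp); exact: smooth_rVM sf sg.
Qed.

Lemma smooth_atN p f : smooth_at p f -> smooth_at p (fun x => - f x).
Proof.
move=> sf; apply: smooth_at_ext (smooth_atM (smooth_at_cst p (-1)) sf).
by apply: nearW => x; rewrite mulN1r.
Qed.

Lemma smooth_atB p f g : smooth_at p f -> smooth_at p g ->
  smooth_at p (fun x => f x - g x).
Proof. by move=> sf sg; apply: smooth_atD sf (smooth_atN sg). Qed.

Lemma smooth_at_sum (I : Type) (r : seq I) p (f : I -> M -> R) :
  (forall i, smooth_at p (f i)) -> smooth_at p (fun x => \sum_(i <- r) f i x).
Proof.
move=> sf; elim: r => [|i r IH].
  by apply: smooth_at_ext (smooth_at_cst p 0); apply: nearW => x; rewrite big_nil.
apply: smooth_at_ext (smooth_atD (sf i) IH).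
by apply: nearW => x; rewrite big_cons.
Qed.

Lemma smooth_at_comp l p (K : M -> 'rV[R]_l) h :
  (forall j, smooth_at p (fun x => K x 0 j)) -> smooth_rV_at (K p) h ->
  smooth_at p (h \o K).
Proof.
have [c Ac cp] := atlas_cover p.
move=> sK sh; apply/(smooth_atP _ Ac cp).
apply: (@smooth_rV_comp _ _ _ _ (K \o inv_coord c)).
  by move=> j; exact: (smooth_atP _ Ac cp).1 (sK j).
by rewrite /= coordK //; exact: atlas_chart.
Qed.

Lemma smooth_at_coord c p j : atlas c -> dom c p ->
  smooth_at p (fun x => coord c x 0 j).
Proof.
move=> Ac cp; apply/(smooth_atP _ Ac cp).
apply: smooth_rV_ext (smooth_rV_coord (coord c p) j).
by apply: filterS_rV (near_inv_coordK (atlas_chart Ac) cp) => v [_ /= ->].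
Qed.

Lemma smooth_at_continuous p f : smooth_at p f -> {for p, continuous f}.
Proof.
have [c Ac cp] := atlas_cover p.
have Hc := atlas_chart Ac.
move=> /(smooth_atP _ Ac cp)/smooth_rV_continuous cf.
apply: (@continuous_ext _ _ ((f \o inv_coord c) \o coord c)).
  by apply: filterS (chart_nbhs Hc cp) => x cx; rewrite /= coordK.
by apply: continuous_comp => //; exact: continuous_coord.
Qed.

Lemma pderiv_ext c i p f g : atlas c -> dom c p ->
  (\forall x \near p, f x = g x) -> pderiv c i f p = pderiv c i g p.
Proof.
move=> Ac cp fg; apply: near_eq_derive.
exact: (near_inv_coord (atlas_chart Ac) cp fg).
Qed.

Lemma smooth_at_pderiv c i p f : atlas c -> dom c p ->
  smooth_at p f -> smooth_at p (pderiv c i f).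
Proof.
move=> Ac cp /(smooth_atP _ Ac cp) sf; apply/(smooth_atP _ Ac cp).
apply: smooth_rV_ext (smooth_rV_derive i sf).
by apply: filterS_rV (near_inv_coordK (atlas_chart Ac) cp) => v [_ /=]; rewrite /pderiv => ->.
Qed.

Lemma pderiv_derivable c i p f : atlas c -> dom c p -> smooth_at p f ->
  derivable (f \o inv_coord c) (coord c p) 'e_i.
Proof. by move=> Ac cp /(smooth_atP _ Ac cp); exact: smooth_rV_derivable. Qed.

Lemma pderivD c i p f g : atlas c -> dom c p -> smooth_at p f -> smooth_at p g ->
  pderiv c i (fun x => f x + g x) p = pderiv c i f p + pderiv c i g p.
Proof. by move=> Ac cp sf sg; apply: deriveD; exact: pderiv_derivable. Qed.

Lemma pderivM c i p f g : atlas c -> dom c p -> smooth_at p f -> smooth_at p g ->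
  pderiv c i (fun x => f x * g x) p = pderiv c i f p * g p + f p * pderiv c i g p.
Proof.
move=> Ac cp sf sg; rewrite /pderiv.
rewrite (@deriveM _ _ (f \o inv_coord c) (g \o inv_coord c)); try exact: pderiv_derivable.
by rewrite /= (coordK (atlas_chart Ac)) // addrC; congr (_ + _); exact: mulrC.
Qed.

Lemma pderiv_comp l c i p (K : M -> 'rV[R]_l) h : atlas c -> dom c p ->
  (forall j, smooth_at p (fun x => K x 0 j)) -> smooth_rV_at (K p) h ->
  pderiv c i (h \o K) p =
    \sum_j 'd_j h (K p) * pderiv c i (fun x => K x 0 j) p.
Proof.
move=> Ac cp sK sh.
have [|j|_] := @is_derive_smooth_comp R _ _ h (K \o inv_coord c) (coord c p) 'e_i.
- by rewrite /= (coordK (atlas_chart Ac)).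
- exact: pderiv_derivable (sK j).
by rewrite /= (coordK (atlas_chart Ac)).
Qed.

Lemma pderiv_coord c i j p : atlas c -> dom c p ->
  pderiv c i (fun x => coord c x 0 j) p = (i == j)%:R.
Proof.
move=> Ac cp; rewrite /pderiv.
rewrite (@near_eq_derive _ _ _ _ (fun v : 'rV[R]_m => v 0 j)); last first.
  by apply: filterS_rV (near_inv_coordK (atlas_chart Ac) cp) => v [_ /= ->].
by have [_ ->] := is_derive_coord (coord c p) 'e_i j; rewrite mxE eqxx eq_sym.
Qed.

End SmoothGerms.

(** Tangent vectors at [p], as functionals on germs of smooth functions.  Both
    [X f p] for a vector field [X] and [P f g p] for a bivector field [P] and a
    fixed [f] are of this kind, so the rules of calculus are proved once. *)
Section Tangent.
Context {R : realType} {m : nat} (M : manifold R m).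
Implicit Types (f g : M -> R) (p : M) (X : vop M) (P : bop M).

Definition tangent_at p (D : (M -> R) -> R) :=
  exists c, [/\ atlas c, dom c p &
    exists a : 'I_m -> R, forall f, smooth_at p f -> D f = \sum_i a i * pderiv c i f p].

Section Rules.
Variables (p : M) (D : (M -> R) -> R).
Hypothesis HD : tangent_at p D.

Lemma tangent_ext f g : (\forall x \near p, f x = g x) -> smooth_at p f -> D f = D g.
Proof.
have [c [Ac cp [a Da]]] := HD => fg sf.
rewrite !Da //; last exact: smooth_at_ext fg sf.
by apply: eq_bigr => i _; rewrite (pderiv_ext i Ac cp fg).
Qed.

Lemma tangent_cst (a : R) : D (fun=> a) = 0.
Proof.
have [c [Ac cp [b Da]]] := HD.
rewrite Da; last exact: smooth_at_cst.
by rewrite big1 // => i _; rewrite /pderiv (derive_cst (a : R^o)) mulr0.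
Qed.

Lemma tangentD f g : smooth_at p f -> smooth_at p g ->
  D (fun x => f x + g x) = D f + D g.
Proof.
have [c [Ac cp [a Da]]] := HD => sf sg.
rewrite !Da //; last exact: smooth_atD.
by rewrite -big_split; apply: eq_bigr => i _; rewrite pderivD // mulrDr.
Qed.

Lemma tangentM f g : smooth_at p f -> smooth_at p g ->
  D (fun x => f x * g x) = D f * g p + f p * D g.
Proof.
have [c [Ac cp [a Da]]] := HD => sf sg.
rewrite !Da //; last exact: smooth_atM.
rewrite mulr_suml mulr_sumr -big_split; apply: eq_bigr => i _ /=.
by rewrite pderivM //; ring.
Qed.

Lemma tangentZ (a : R) f : smooth_at p f -> D (fun x => a * f x) = a * D f.
Proof.
move=> sf; rewrite tangentM //; last exact: smooth_at_cst.
by rewrite tangent_cst mul0r add0r.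
Qed.

Lemma tangentN f : smooth_at p f -> D (fun x => - f x) = - D f.
Proof.
move=> sf; rewrite -mulN1r -tangentZ //; apply: tangent_ext; last exact: smooth_atN.
by apply: nearW => x; rewrite mulN1r.
Qed.

Lemma tangentB f g : smooth_at p f -> smooth_at p g ->
  D (fun x => f x - g x) = D f - D g.
Proof. by move=> sf sg; rewrite tangentD ?tangentN //; exact: smooth_atN. Qed.

Lemma tangent_sum (I : Type) (r : seq I) (f : I -> M -> R) :
  (forall i, smooth_at p (f i)) ->
  D (fun x => \sum_(i <- r) f i x) = \sum_(i <- r) D (f i).
Proof.
move=> sf; elim: r => [|i r IH].
  rewrite big_nil; transitivity (D (fun=> 0)); last exact: tangent_cst.
  apply/esym/tangent_ext; last exact: smooth_at_cst.
  by apply: nearW => x; rewrite big_nil.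
rewrite big_cons -IH -tangentD //; last exact: smooth_at_sum.
apply: tangent_ext; last exact: smooth_at_sum.
by apply: nearW => x; rewrite big_cons.
Qed.

Lemma tangent_comp l (K : M -> 'rV[R]_l) h :
  (forall j, smooth_at p (fun x => K x 0 j)) -> smooth_rV_at (K p) h ->
  D (h \o K) = \sum_j 'd_j h (K p) * D (fun x => K x 0 j).
Proof.
have [c [Ac cp [a Da]]] := HD => sK sh.
rewrite Da; last exact: smooth_at_comp.
under eq_bigr do rewrite pderiv_comp // mulr_sumr.
rewrite exchange_big; apply: eq_bigr => j _ /=.
by rewrite Da // mulr_sumr; apply: eq_bigr => i _; exact: mulrCA.
Qed.

Lemma tangent_chart c f : atlas c -> dom c p -> smooth_at p f ->
  D f = \sum_i D (fun x => coord c x 0 i) * pderiv c i f p.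
Proof.
move=> Ac cp sf; have Hc := atlas_chart Ac.
rewrite (@tangent_ext f ((f \o inv_coord c) \o coord c)) //; last first.
  by apply: filterS (chart_nbhs Hc cp) => x cx; rewrite /= coordK.
rewrite tangent_comp => [|j|]; last 2 first.
- exact: smooth_at_coord.
- exact/(smooth_atP _ Ac cp).
by apply: eq_bigr => i _; exact: mulrC.
Qed.

End Rules.

Lemma vector_tangent X p : is_vector_field X -> tangent_at p (fun f => X f p).
Proof.
have [c Ac cp] := atlas_cover p; move=> /(_ c Ac)[a [_ Xa]].
by exists c; split=> //; exists (a^~ p) => f sf; exact: Xa.
Qed.

Lemma vector_smooth X p f : is_vector_field X -> smooth_at p f -> smooth_at p (X f).
Proof.
have [c Ac cp] := atlas_cover p; move=> /(_ c Ac)[a [sa Xa]] sf.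
have Hc := atlas_chart Ac.
apply: (@smooth_at_ext _ _ _ _ (fun x => \sum_i a i x * pderiv c i f x)).
  apply: filterS (filterI (chart_nbhs Hc cp) (near_smooth_at sf)) => x [cx sx].
  by rewrite Xa.
apply: smooth_at_sum => i; apply: smooth_atM; last exact: smooth_at_pderiv.
by apply: (smooth_on_atP _ (open_dom Hc)).2 cp; exact: sa.
Qed.

Lemma bivector_skew P p f g : is_bivector_field P ->
  smooth_at p f -> smooth_at p g -> P g f p = - P f g p.
Proof.
have [c Ac cp] := atlas_cover p; move=> /(_ c Ac)[b [_ bN Pb]] sf sg.
rewrite !Pb // exchange_big -sumrN; apply: eq_bigr => i _.
by rewrite -sumrN; apply: eq_bigr => j _; rewrite bN //; ring.
Qed.

Lemma bivector_tangent P p f : is_bivector_field P -> smooth_at p f ->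
  tangent_at p (fun g => P f g p).
Proof.
have [c Ac cp] := atlas_cover p; move=> /(_ c Ac)[b [_ bN Pb]] sf.
exists c; split=> //; exists (fun j => \sum_i b i j p * pderiv c i f p) => g sg.
rewrite Pb // exchange_big; apply: eq_bigr => j _ /=.
by rewrite mulr_suml; apply: eq_bigr => i _; ring.
Qed.

Lemma bivector_tangentl P p g : is_bivector_field P -> smooth_at p g ->
  tangent_at p (fun f => P f g p).
Proof.
have [c Ac cp] := atlas_cover p; move=> /(_ c Ac)[b [_ bN Pb]] sg.
exists c; split=> //; exists (fun i => \sum_j b i j p * pderiv c j g p) => f sf.
rewrite Pb //; apply: eq_bigr => i _.
by rewrite mulr_suml; apply: eq_bigr => j _; ring.
Qed.

Lemma bivector_smooth P p f g : is_bivector_field P ->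
  smooth_at p f -> smooth_at p g -> smooth_at p (P f g).
Proof.
have [c Ac cp] := atlas_cover p; move=> /(_ c Ac)[b [sb _ Pb]] sf sg.
have Hc := atlas_chart Ac.
apply: (@smooth_at_ext _ _ _ _
  (fun x => \sum_i \sum_j b i j x * (pderiv c i f x * pderiv c j g x))).
  apply: filterS (filterI (chart_nbhs Hc cp)
    (filterI (near_smooth_at sf) (near_smooth_at sg))) => x [cx [sx sx']].
  by rewrite Pb.
apply: smooth_at_sum => i; apply: smooth_at_sum => j.
apply: smooth_atM; last by apply: smooth_atM; exact: smooth_at_pderiv.
by apply: (smooth_on_atP _ (open_dom Hc)).2 cp; exact: sb.
Qed.

End Tangent.

Section Pullback.
Context {R : realType} {m l : nat} (N : manifold R m) (M : manifold R l).
Implicit Type phi : N -> M.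

Lemma smooth_at_pullback phi s f : smooth_map phi -> smooth_at (phi s) f ->
  smooth_at s (f \o phi).
Proof.
move=> [cphi sphi]; have [c Ac cs] := atlas_cover s.
have [d Ad ds] := atlas_cover (phi s).
have Hc := atlas_chart Ac; have Hd := atlas_chart Ad.
move=> /(smooth_atP _ Ad ds) sf; apply/(smooth_atP _ Ac cs).
have nd : \forall x \near s, dom d (phi x) by apply: cphi; exact: chart_nbhs.
apply: (@smooth_rV_ext _ _ _ ((f \o inv_coord d) \o (coord d \o phi \o inv_coord c))).
  by apply: filterS_rV (near_inv_coord (P := dom d \o phi) Hc cs nd) => v dv; rewrite /= coordK.
apply: smooth_rV_comp; last by rewrite /= coordK.
move=> j; have := sphi c d Ac Ad j.
have oU : open (phi @^-1` dom d) by apply: open_comp => //; exact: open_dom.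
by move=> /(smooth_on_rVP _ (open_coord_image Hc oU)); apply; exists s.
Qed.

Lemma smooth_mapP phi : continuous phi ->
  (forall s d, atlas d -> dom d (phi s) ->
    forall j, smooth_at s (fun x => coord d (phi x) 0 j)) -> smooth_map phi.
Proof.
move=> cphi sphi; split=> // c d Ac Ad j.
have Hc := atlas_chart Ac; have Hd := atlas_chart Ad.
have oU : open (phi @^-1` dom d) by apply: open_comp => //; exact: open_dom.
apply/(smooth_on_rVP _ (open_coord_image Hc oU)) => _ [s [cs ds] <-].
exact: (smooth_atP _ Ac cs).1 (sphi s d Ad ds j).
Qed.

End Pullback.

(** * The form E /\ B^n *)

Section OddForm.
Context {R : realFieldType} (n : nat).
Notation I := 'I_n.*2.+1.
Implicit Types (s : {perm I}) (i : 'I_n) (E : I -> R) (B : I -> I -> R).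

(** The places [0 .. 2n] of a permutation are the argument of [E], place [0],
    and the two arguments [slot1 i] and [slot2 i] of the [i]-th factor [B]. *)
Definition slot1 i : I := inord i.*2.+1.
Definition slot2 i : I := inord i.*2.+2.

Lemma slot1E i : slot1 i = i.*2.+1 :> nat.
Proof. by rewrite inordK //; have := ltn_ord i; lia. Qed.

Lemma slot2E i : slot2 i = i.*2.+2 :> nat.
Proof. by rewrite inordK //; have := ltn_ord i; lia. Qed.

Lemma slotP (x : I) : [\/ x = ord0, exists i, x = slot1 i | exists i, x = slot2 i].
Proof.
case: (posnP x) => [x0|x0]; first by constructor 1; apply: val_inj.
have := odd_double_half x; have := ltn_ord x; case: (odd x) => /= xn xE.
  have xn' : (x./2 < n)%N by lia.
  by constructor 2; exists (Ordinal xn'); apply: val_inj; rewrite /= slot1E /=; lia.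
have xn' : (x./2.-1 < n)%N by lia.
by constructor 3; exists (Ordinal xn'); apply: val_inj; rewrite /= slot2E /=; lia.
Qed.

Lemma slot1_inj : injective slot1.
Proof. by move=> i j /(congr1 val) /=; rewrite !slot1E => ?; apply: val_inj => /=; lia. Qed.

Lemma slot2_inj : injective slot2.
Proof. by move=> i j /(congr1 val) /=; rewrite !slot2E => ?; apply: val_inj => /=; lia. Qed.

Lemma slot12 i j : (slot1 i == slot2 j) = false.
Proof. by apply/eqP => /(congr1 val) /=; rewrite slot1E slot2E; lia. Qed.

Lemma slot01 i : (ord0 == slot1 i) = false.
Proof. by apply/eqP => /(congr1 val) /=; rewrite slot1E. Qed.

Lemma slot02 i : (ord0 == slot2 i) = false.
Proof. by apply/eqP => /(congr1 val) /=; rewrite slot2E. Qed.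

Definition slotE := (slot12, slot01, slot02, (inj_eq slot1_inj), (inj_eq slot2_inj)).

Lemma slot21 i j : (slot2 i == slot1 j) = false.
Proof. by rewrite eq_sym slot12. Qed.

Lemma slot10 i : (slot1 i == ord0) = false.
Proof. by rewrite eq_sym slot01. Qed.

Lemma slot20 i : (slot2 i == ord0) = false.
Proof. by rewrite eq_sym slot02. Qed.

Lemma sum_slots (U : I -> R) :
  \sum_x U x = U ord0 + \sum_i (U (slot1 i) + U (slot2 i)).
Proof.
pose V x := U (inord x).
rewrite (eq_bigr (fun x : I => V x)) => [|x _]; last by rewrite /V inord_val.
rewrite (eq_bigr (fun i : 'I_n => V (nat_of_ord i).*2.+1 + V (nat_of_ord i).*2.+2)) //.
have -> : U ord0 = V 0%N by rewrite /V; congr U; apply: val_inj; rewrite /= inordK.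
rewrite -(big_mkord xpredT V) -(big_mkord xpredT (fun i : nat => V i.*2.+1 + V i.*2.+2)).
elim: (n) => [|k IH]; first by rewrite big_nat1 big_geq // addr0.
by rewrite doubleS big_nat_recr //= big_nat_recr //= IH [in RHS]big_nat_recr //= !addrA.
Qed.

(** [fixes k s] restricts the sum that defines the odd form [E /\ B^n] to the
    permutations of the first [2k + 1] indices; [odd_form k] is then a positive
    multiple of [E /\ B^k] on these.  Keeping one symmetric group for all [k] makes an induction on [k]
    possible without moving between permutation groups. *)
Definition fixes k s := [forall x : I, (k.*2 < x)%N ==> (s x == x)].

Definition odd_term k E B s : R := (-1) ^+ s * (E (s ord0) *
  \prod_(i < n | (i < k)%N) B (s (slot1 i)) (s (slot2 i))).

Definition odd_form k E B := \sum_(s : {perm I} | fixes k s) odd_term k E B s.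

Lemma fixesP k s : reflect (forall x : I, (k.*2 < x)%N -> s x = x) (fixes k s).
Proof. by apply: (iffP forallP) => H x; [move/implyP: (H x) => /[apply]/eqP|apply/implyP => /H ->]. Qed.

Lemma form_full E B : odd_form n E B =
  \sum_(s : {perm I}) (-1) ^+ s * (E (s ord0) * \prod_i B (s (slot1 i)) (s (slot2 i))).
Proof.
rewrite /odd_form; apply: eq_big => [s|s _].
  by apply/fixesP => x; have := ltn_ord x; lia.
by congr (_ * (_ * _)); apply: eq_bigl => i; rewrite ltn_ord.
Qed.

Lemma odd_form_eq k E E' B B' : (forall x : I, (x <= k.*2)%N -> E x = E' x) ->
  (forall x y : I, (x <= k.*2)%N -> (y <= k.*2)%N -> B x y = B' x y) ->
  odd_form k E B = odd_form k E' B'.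
Proof.
move=> EE BB; apply: eq_bigr => s /fixesP fs.
have sle (x : I) : (x <= k.*2)%N -> (s x <= k.*2)%N.
  by move=> xk; rewrite leqNgt; apply/negP => sx; move: (sx); rewrite ltnNge (perm_inj (fs _ sx)) xk.
rewrite /odd_term EE ?sle //; congr (_ * (_ * _)).
by apply: eq_bigr => i ik; rewrite BB // sle // ?slot1E ?slot2E; lia.
Qed.

Lemma fixes_mul k h s : fixes k h -> fixes k (h * s)%g = fixes k s.
Proof.
move=> /fixesP Hh; apply/fixesP/fixesP => Hs x kx.
  by rewrite -[in LHS](Hh x kx) -permM Hs.
by rewrite permM Hh // Hs.
Qed.

Lemma fixes_tperm k (x y : I) : (x <= k.*2)%N -> (y <= k.*2)%N -> fixes k (tperm x y).
Proof.
move=> xk yk; apply/fixesP => z kz; apply: tpermD.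
  by apply: contraTneq kz => <-; rewrite -leqNgt.
by apply: contraTneq kz => <-; rewrite -leqNgt.
Qed.

(** The sum is organized by the place [x] that carries the index [a], so that
    symmetries and cancellations can be stated for one place at a time. *)
Definition form_at k E B (a x : I) := \sum_(s : {perm I} | fixes k s && (s x == a)) odd_term k E B s.

Lemma form_at_sum k E B a : odd_form k E B = \sum_x form_at k E B a x.
Proof.
rewrite /odd_form (partition_big (fun s => (s^-1)%g a) xpredT) //=.
apply: eq_bigr => x _; apply: eq_bigl => s; congr (_ && _).
by rewrite -(inj_eq (@perm_inj _ s)) permKV eq_sym.
Qed.

Lemma form_at_mul k E B a (h : {perm I}) x (c : R) : fixes k h ->
  (forall s, s (h x) = a -> odd_term k E B (h * s)%g = c * odd_term k E B s) ->
  form_at k E B a x = c * form_at k E B a (h x).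
Proof.
move=> Hh Hc; rewrite /form_at (reindex_inj (mulgI h)) /= mulr_sumr.
apply: eq_big => [s|s /andP[_]]; first by rewrite fixes_mul // permM.
by rewrite permM => /eqP; exact: Hc.
Qed.

Section Skew.
Variables (E : I -> R) (B : I -> I -> R).
Hypothesis skew : forall x y, B y x = - B x y.

(** Exchanging the two arguments of a factor changes the signs of both the
    permutation and the factor. *)
Lemma form_at_slot12 k a i : (i < k)%N ->
  form_at k E B a (slot1 i) = form_at k E B a (slot2 i).
Proof.
move=> ik; rewrite -[RHS]mul1r -(tpermL (slot1 i) (slot2 i)).
apply: form_at_mul => [|s _].
  by apply: fixes_tperm; rewrite ?slot1E ?slot2E; lia.
rewrite /odd_term odd_permM odd_tperm slotE signr_addb expr1 mul1r mulN1r mulNr -mulrN.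
congr (_ * _); rewrite permM tpermD ?slot10 ?slot20 // -mulrN; congr (_ * _).
rewrite (bigD1 i) //= [in RHS](bigD1 i) //= !permM tpermL tpermR skew mulNr.
rewrite opprK; congr (_ * _); apply: eq_bigr => j /andP[_ ji].
by rewrite !permM !tpermD ?slotE ?slot21 // eq_sym.
Qed.

(** Exchanging two factors is an even permutation of the places. *)
Lemma form_at_swap k a (i j : 'I_n) : (i < k)%N -> (j < k)%N ->
  form_at k E B a (slot1 i) = form_at k E B a (slot1 j).
Proof.
move=> ik jk; pose h := (tperm (slot1 i) (slot1 j) * tperm (slot2 i) (slot2 j))%g.
have tperm_slot (slot : 'I_n -> I) l : injective slot ->
    tperm (slot i) (slot j) (slot l) = slot (tperm i j l).
  by move=> slot_inj; rewrite (inj_tperm _ _ _ slot_inj).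
have h1 l : h (slot1 l) = slot1 (tperm i j l).
  rewrite permM tperm_slot; last exact: slot1_inj.
  by rewrite tpermD // slot21.
have h2 l : h (slot2 l) = slot2 (tperm i j l).
  rewrite permM (tpermD (x := slot1 i)) ?slot12 // tperm_slot //.
  exact: slot2_inj.
have h0 : h ord0 = ord0.
  by rewrite permM !tpermD ?slot10 ?slot20.
have hi : h (slot1 i) = slot1 j by rewrite h1 tpermL.
rewrite -[RHS]mul1r -hi.
apply: form_at_mul => [|s _].
  by rewrite fixes_mul; apply: fixes_tperm; rewrite ?slot1E ?slot2E; lia.
rewrite /odd_term odd_permM signr_addb odd_permM !odd_tperm !slotE addbb mul1r mul1r permM h0.
congr (_ * (_ * _)); rewrite (reindex_inj (@perm_inj _ (tperm i j))) /=.
apply: eq_big => [l|l _]; last by rewrite !(permM h s) h1 h2 !tpermK.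
by case: tpermP => // ->; rewrite ik jk.
Qed.

(** The index [slot1 kk] has a nonzero product only with [slot2 kk], so in
    every nonzero term these two indices share a factor; the [2(k + 1)] ways to
    choose this factor and the order of its arguments all contribute the same
    sum. *)
Lemma form_step k (kk : 'I_n) : kk = k :> nat -> E (slot1 kk) = 0 ->
  (forall x : I, (x <= k.*2)%N -> B (slot1 kk) x = 0) ->
  odd_form k.+1 E B = k.+1.*2%:R * B (slot1 kk) (slot2 kk) * odd_form k E B.
Proof.
move=> kE Ea Ba; set a := slot1 kk; set b := slot2 kk.
have aE : a = k.*2.+1 :> nat by rewrite slot1E kE.
have bE : b = k.*2.+2 :> nat by rewrite slot2E kE.
have kn : (k < n)%N by rewrite -kE.
have kS : (kk < k.+1)%N by rewrite kE.
have top : form_at k.+1 E B a a = B a b * odd_form k E B.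
  rewrite /form_at (bigID (fun s : {perm I} => s b == b)) /= addrC big1 ?add0r; last first.
    move=> s /andP[/andP[/fixesP fs /eqP sa] sb].
    rewrite /odd_term (bigD1 kk) //= -/a -/b sa (Ba (s b)) ?mul0r ?mulr0 //.
    rewrite leqNgt; apply/negP => sbk.
    have : s b != a by rewrite -sa (inj_eq perm_inj) slot21.
    have [sbk2|sbk2] := ltnP k.+1.*2 (s b).
      by move: sb; rewrite -(inj_eq (@perm_inj _ s)) (fs (s b)) ?eqxx.
    by move: sb; rewrite -!(inj_eq val_inj) /= aE bE; lia.
  rewrite /odd_form mulr_sumr; apply: eq_big => [s|s].
    apply/andP/fixesP => [[/andP[/fixesP fs /eqP sa] /eqP sb] x kx|fs].
      have [xk|xk] := ltnP k.+1.*2 x; first exact: fs.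
      have [->|xa] := eqVneq x a; first by [].
      have [->|xb] := eqVneq x b; first by [].
      by move: xa xb; rewrite -!(inj_eq val_inj) /= aE bE; lia.
    split; first (apply/andP; split).
    - by apply/fixesP => x kx; apply: fs; lia.
    - by rewrite fs // aE.
    - by rewrite fs // bE; lia.
  move=> /andP[/andP[_ /eqP sa] /eqP sb].
  rewrite /odd_term (bigD1 kk) //= -/a -/b sa sb.
  rewrite (eq_bigl (fun i : 'I_n => (i < k)%N)).
    by rewrite (mulrCA (E _)) [LHS]mulrCA.
  by move=> i; rewrite -(inj_eq val_inj) /= kE; lia.
rewrite (form_at_sum _ _ _ a) sum_slots.
have -> : form_at k.+1 E B a ord0 = 0.
  by apply: big1 => s /andP[_ /eqP s0]; rewrite /odd_term s0 Ea mul0r mulr0.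
rewrite add0r (bigID (fun i : 'I_n => (i < k.+1)%N)) /= [X in _ + X]big1 ?addr0; last first.
  move=> i ik; rewrite /form_at !big1 ?addr0 // => s /andP[/fixesP fs /eqP sa].
    have := sa; rewrite fs ?slot2E; last by lia.
    by move=> /eqP; rewrite slot21.
  have := sa; rewrite fs ?slot1E; last by lia.
  by move=> /slot1_inj ik'; move: ik; rewrite ik' kS.
rewrite (eq_bigr (fun=> 2 * (B a b * odd_form k E B))) => [|i ik]; last first.
  by rewrite -form_at_slot12 // (form_at_swap _ ik kS) top mulr_natl mulr2n.
rewrite (big_ord_narrow kn) sumr_const card_ord.
by rewrite -[LHS]mulr_natl -muln2 natrM !mulrA.
Qed.

End Skew.
End OddForm.

Section OddFormKernel.
Context {R : realFieldType} (n : nat).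
Notation I := 'I_n.*2.+1.
Implicit Types (s : {perm I}) (i : 'I_n) (E : I -> R) (B : I -> I -> R).

(** Contracting [E /\ B^n] with a covector [a] such that [E a = 0] and
    [B a = c E] gives a multiple of [E /\ E /\ B^(n-1)], which is zero.  In the
    sum, the terms with [a] in a given slot cancel in pairs, by exchanging the
    partner of [a] with the argument of [E]. *)
Lemma form_kernel E B a (c : R) : (forall x y, B y x = - B x y) ->
  E a = 0 -> (forall y, B a y = c * E y) -> odd_form n E B = 0.
Proof.
move=> skew Ea Ba; rewrite (form_at_sum _ _ _ a) sum_slots.
have -> : form_at n E B a ord0 = 0.
  by apply: big1 => s /andP[_ /eqP s0]; rewrite /odd_term s0 Ea mul0r mulr0.
rewrite add0r big1 // => i _; rewrite -form_at_slot12 //.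
suff -> : form_at n E B a (slot1 i) = 0 by rewrite addr0.
suff : form_at n E B a (slot1 i) = -1 * form_at n E B a (slot1 i) by lra.
pose h := tperm ord0 (slot2 i).
have hi : h (slot1 i) = slot1 i by rewrite tpermD ?slot01 ?slot21.
rewrite -[in RHS]hi; apply: form_at_mul => [|s].
  by apply: fixes_tperm; rewrite ?slot2E //; have := ltn_ord i; lia.
rewrite hi => sa; rewrite /odd_term odd_permM odd_tperm slotE signr_addb expr1.
rewrite -mulrA; congr (_ * (_ * _)).
rewrite (bigD1 i) // [in RHS](bigD1 i) //= !(permM h s) tpermL tpermR hi sa !Ba.
rewrite mulrCA mulrA; rewrite [RHS]mulrA; congr (_ * _).
  by rewrite mulrCA mulrA.
apply: eq_bigr => j /andP[_ ji].
by rewrite !(permM h s) !tpermD ?slot01 ?slot02 ?slot21 // (inj_eq (@slot2_inj _)) eq_sym.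
Qed.

(** Composing with the transposition of [x] and [y] changes only the sign. *)
Lemma form_alternate E B x y : (forall x y, B y x = - B x y) -> x != y ->
  E x = E y -> (forall z, B x z = B y z) -> odd_form n E B = 0.
Proof.
move=> skew xy Exy Bxy; suff : odd_form n E B = - odd_form n E B by lra.
rewrite {1}form_full (reindex_inj (mulIg (tperm x y))) form_full -sumrN.
apply: eq_bigr => s _; rewrite odd_permM odd_tperm xy signr_addb expr1 mulrN1 mulNr.
have Et z : E (tperm x y z) = E z by case: tpermP => // ->.
have Bt z w : B (tperm x y z) w = B z w by case: tpermP => // ->.
have Bt' z w : B z (tperm x y w) = B z w by rewrite skew Bt -skew.
by rewrite permM Et; congr (- (_ * (_ * _))); apply: eq_bigr => i _; rewrite !permM Bt Bt'.
Qed.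

(** The index [j] occurs exactly once in each term, as the argument of [E] or
    as one argument of one factor [B]. *)
Lemma form_linear (L : finType) (c : L -> R) E B (E_ : L -> I -> R)
    (B_ : L -> I -> I -> R) j :
  (forall x y, B y x = - B x y) -> (forall l x y, B_ l y x = - B_ l x y) ->
  (forall l x, x != j -> E_ l x = E x) ->
  (forall l x y, x != j -> y != j -> B_ l x y = B x y) ->
  E j = \sum_l c l * E_ l j ->
  (forall y, y != j -> B j y = \sum_l c l * B_ l j y) ->
  odd_form n E B = \sum_l c l * odd_form n (E_ l) (B_ l).
Proof.
move=> skew skew_ EE BB Ej Bj.
under eq_bigr do rewrite /odd_form mulr_sumr.
rewrite exchange_big; apply: eq_bigr => s _ /=; rewrite /odd_term.
have js x : x != (s^-1)%g j -> s x != j.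
  by apply: contra => /eqP <-; rewrite permK.
have sj : s ((s^-1)%g j) = j by rewrite permKV.
have Bj' y : y != j -> B y j = \sum_l c l * B_ l y j.
  move=> yj; rewrite skew Bj // -sumrN; apply: eq_bigr => l _.
  by rewrite [in RHS]skew_ mulrN.
have [j0|[i ji]|[i ji]] := slotP ((s^-1)%g j); rewrite ?j0 ?ji in js sj *.
- rewrite sj Ej mulr_suml mulr_sumr; apply: eq_bigr => l _.
  rewrite -mulrA mulrCA; congr (_ * (_ * (_ * _))); apply: eq_bigr => i _.
  by rewrite BB // js // ?slot10 ?slot20.
- have s0j : s ord0 != j by rewrite js // slot01.
  have s2j : s (slot2 i) != j by rewrite js // slot21.
  rewrite (bigD1 i) //= sj Bj // !(mulr_suml, mulr_sumr).
  apply: eq_bigr => l _; rewrite [in RHS](bigD1 i) //= sj EE // -[c l * _ * _]mulrA.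
  rewrite (mulrCA (E _)) (mulrCA _ (c l)); congr (_ * (_ * (_ * (_ * _)))).
  apply: eq_bigr => k /andP[_ ki]; rewrite BB // js // ?slot21 //.
  by rewrite (inj_eq (@slot1_inj _)).
- have s0j : s ord0 != j by rewrite js // slot02.
  have s1j : s (slot1 i) != j by rewrite js // slot12.
  rewrite (bigD1 i) //= sj Bj' // !(mulr_suml, mulr_sumr).
  apply: eq_bigr => l _; rewrite [in RHS](bigD1 i) //= sj EE // -[c l * _ * _]mulrA.
  rewrite (mulrCA (E _)) (mulrCA _ (c l)); congr (_ * (_ * (_ * (_ * _)))).
  apply: eq_bigr => k /andP[_ ki]; rewrite BB // js // ?slot12 //.
  by rewrite (inj_eq (@slot2_inj _)).
Qed.

End OddFormKernel.

Section OddFormVectors.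
Context {R : realFieldType} (n : nat).
Notation I := 'I_n.*2.+1.
Notation V := 'rV[R]_n.*2.+1.
Variables (a : I -> R) (b : I -> I -> R).
Hypothesis bN : forall i j, b j i = - b i j.
Implicit Types (v w : V) (f : I -> V).

Definition dual v : R := \sum_i a i * v 0 i.
Definition bilin v w : R := \sum_i \sum_j b i j * (v 0 i * w 0 j).

Lemma bilinN v w : bilin w v = - bilin v w.
Proof.
rewrite /bilin exchange_big -sumrN; apply: eq_bigr => i _.
rewrite -sumrN; apply: eq_bigr => j _; rewrite bN mulNr; congr (- (_ * _)).
exact: mulrC.
Qed.

Lemma dual_sum (L : finType) (c : L -> R) (g : L -> V) :
  dual (\sum_l c l *: g l) = \sum_l c l * dual (g l).
Proof.
rewrite /dual; under [RHS]eq_bigr do rewrite mulr_sumr.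
rewrite exchange_big; apply: eq_bigr => i _ /=.
by rewrite summxE mulr_sumr; apply: eq_bigr => l _; rewrite mxE mulrCA.
Qed.

Lemma bilin_sum (L : finType) (c : L -> R) (g : L -> V) w :
  bilin (\sum_l c l *: g l) w = \sum_l c l * bilin (g l) w.
Proof.
rewrite /bilin; under [RHS]eq_bigr do rewrite mulr_sumr.
rewrite [RHS]exchange_big; apply: eq_bigr => i _ /=.
under [RHS]eq_bigr do rewrite mulr_sumr.
rewrite [RHS]exchange_big; apply: eq_bigr => j _ /=.
rewrite summxE mulr_suml mulr_sumr; apply: eq_bigr => l _; rewrite mxE.
by rewrite -mulrA mulrCA.
Qed.

Definition vform f := odd_form n (fun i => dual (f i)) (fun i j => bilin (f i) (f j)).

Definition update f j v : I -> V := fun i => if i == j then v else f i.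

(** Of the expansion in the [j]-th vector only the [j]-th term is not killed
    by a repetition. *)
Lemma vform_update f j (c : I -> R) :
  vform (update f j (\sum_l c l *: f l)) = c j * vform f.
Proof.
rewrite /vform (@form_linear _ _ _ c _ _
  (fun l i => dual (update f j (f l) i))
  (fun l i i' => bilin (update f j (f l) i) (update f j (f l) i')) j) //.
- rewrite (bigD1 j) //= big1 ?addr0 => [|l lj].
    congr (_ * _); apply: eq_bigr => s _; rewrite /odd_term /update.
    have E x : (if x == j then f j else f x) = f x by case: eqP => // ->.
    by rewrite E; under eq_bigr do rewrite !E.
  rewrite (form_alternate (x := l) (y := j)) ?mulr0 //.
  - by move=> x y; exact: bilinN.
  - by rewrite /update eqxx (negPf lj).
  - by move=> z; rewrite /update eqxx (negPf lj).
- by move=> x y; exact: bilinN.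
- by move=> l x y; exact: bilinN.
- by move=> l x xj; rewrite /update (negPf xj).
- by move=> l x y xj yj; rewrite /update (negPf xj) (negPf yj).
- by rewrite /update eqxx dual_sum.
- by move=> y yj; rewrite /update eqxx (negPf yj) bilin_sum.
Qed.

(** If the vectors [f l] were dependent, or if [v] were a nonzero combination
    of them, some combination [u = \sum_l k l *: f l] with a coefficient
    [k j != 0] would satisfy the hypotheses on [v].  With [u] in place of [f j]
    the form is [k j] times its original value, and it is zero by
    [form_kernel]. *)
Lemma vform_kernel f v (c : R) : vform f != 0 ->
  dual v = 0 -> (forall w, bilin v w = c * dual w) -> v = 0 /\ c = 0.
Proof.
move=> f0 av bv.
have key (u : V) (k : I -> R) (d : R) j : u = \sum_l k l *: f l -> k j != 0 ->
    dual u = 0 -> (forall w, bilin u w = d * dual w) -> False.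
  move=> ud kj au bu; have := vform_update f j k; rewrite -ud.
  rewrite /vform (@form_kernel _ _ _ _ j d) => [|x y||y]; last 3 first.
  - exact: bilinN.
  - by rewrite /update eqxx.
  - by rewrite /update eqxx.
  move=> /esym/eqP; rewrite mulf_eq0 (negPf kj) /=; exact/negP.
pose D : 'M[R]_(n.*2.+1) := \matrix_i f i.
have DE (k : V) : k *m D = \sum_l k 0 l *: f l.
  apply/rowP => j; rewrite mxE summxE; apply: eq_bigr => l _.
  by rewrite !mxE.
have Du : D \in unitmx.
  rewrite -row_free_unit -kermx_eq0; apply/negPn/negP => /rowV0Pn[k].
  move=> /sub_kermxP kD /rV0Pn[j kj]; apply: (@key 0 (k 0) 0 j) => //.
  - by rewrite -DE.
  - by rewrite /dual big1 // => i _; rewrite mxE mulr0.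
  - by move=> w; rewrite mul0r /bilin big1 // => i _; rewrite big1 // => l _; rewrite mxE mul0r mulr0.
have v0 : v = 0.
  apply/eqP; apply/negPn/negP => v0; pose k := v *m invmx D.
  have vk : v = k *m D by rewrite mulmxKV.
  have /rV0Pn[j kj] : k != 0 by apply: contraNneq v0 => k0; rewrite vk k0 mul0mx.
  by apply: (@key v (k 0) c j) => //; rewrite -DE.
split=> //; apply/eqP; apply/negPn/negP => c0; case/negP: f0.
apply/eqP; apply: big1 => s _; rewrite /odd_term.
have := bv (f (s ord0)); rewrite v0 /bilin big1 => [|i _]; last first.
  by rewrite big1 // => l _; rewrite mxE mul0r mulr0.
by move=> /esym/eqP; rewrite mulf_eq0 (negPf c0) /= => /eqP ->; rewrite mul0r mulr0.
Qed.

(** The multivectors [E /\ B^k] are built up one step at a time: [2k + 2]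
    linear conditions leave room for a covector [v] orthogonal to everything
    used so far, and nondegeneracy provides a partner for it. *)
Lemma vform_exists :
  (forall v (c : R), dual v = 0 -> (forall w, bilin v w = c * dual w) -> v = 0 /\ c = 0) ->
  exists f, vform f != 0.
Proof.
move=> nondeg.
suff H k : (k <= n)%N -> exists f, odd_form k (fun i => dual (f i))
    (fun i j => bilin (f i) (f j)) != 0 by exact: H.
elim: k => [_|k IH kn].
  have [v v0] : exists v, dual v != 0.
    apply: contrapT => H; suff [_ /eqP] : (0 : V) = 0 /\ (1 : R) = 0 by rewrite oner_eq0.
    apply: nondeg => [|w].
      by rewrite /dual big1 // => i _; rewrite mxE mulr0.
    rewrite mul1r /bilin big1 => [|i _]; last by rewrite big1 // => l _; rewrite mxE mul0r mulr0.
    by apply/esym/eqP; apply/negPn/negP => w0; apply: H; exists w.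
  exists (fun=> v); rewrite /odd_form (bigD1 1%g) /=; last first.
    by apply/fixesP => x _; rewrite perm1.
  rewrite big1 ?addr0 => [|s /andP[/fixesP fs /eqP]]; last first.
    case; apply/permP => x; rewrite perm1; case: (posnP x) => [x0|/fs //].
    by case: (posnP (s x)) => [sx0|/fs /perm_inj //]; apply: val_inj; rewrite /= x0.
  by rewrite /odd_term odd_perm1 expr0 mul1r big1 ?mulr1.
have [f fk] := IH (ltnW kn).
pose kk := Ordinal kn.
have kS : (k.*2.+2 < n.*2.+1)%N by lia.
(* a vector is orthogonal to [a] and to [f 0, ..., f (2k)] if it is in the
   kernel of [A]: column [0] is [a], and column [j] comes from [f (j - 1)] *)
pose A : 'M[R]_(n.*2.+1, k.*2.+2) := \matrix_(i, j)
  (if j == ord0 then a i else bilin (delta_mx 0 i) (f (inord j.-1))).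
have /rowV0Pn[v /sub_kermxP vA v0] : kermx A != 0.
  rewrite kermx_eq0 -row_leq_rank -ltnNge; apply: leq_ltn_trans kS.
  exact: rank_leq_col.
have av : dual v = 0.
  have /rowP/(_ ord0) := vA; rewrite !mxE => E; rewrite -[RHS]E.
  by apply: eq_bigr => i _; rewrite mxE eqxx mulrC.
have bv (x : I) : (x <= k.*2)%N -> bilin v (f x) = 0.
  move=> xk; have xk' : (x.+1 < k.*2.+2)%N by lia.
  have /rowP/(_ (Ordinal xk')) := vA; rewrite !mxE => E; rewrite -[RHS]E.
  rewrite [v in LHS]row_sum_delta bilin_sum; apply: eq_bigr => i _.
  by rewrite mxE /= inord_val.
have [w vw] : exists w, bilin v w != 0.
  apply: contrapT => H; case/eqP: v0; apply: (nondeg v 0 av _).1 => w.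
  by rewrite mul0r; apply/eqP; apply/negPn/negP => w0; apply: H; exists w.
pose g := update (update f (slot1 kk) v) (slot2 kk) w.
have g1 : g (slot1 kk) = v by rewrite /g /update slot12 eqxx.
have g2 : g (slot2 kk) = w by rewrite /g /update eqxx.
have gf (x : I) : (x <= k.*2)%N -> g x = f x.
  move=> xk; rewrite /g /update -!(inj_eq val_inj) /= slot1E slot2E /=.
  by rewrite !ifF //; apply/negbTE; lia.
exists g; rewrite (@form_step _ _ _ _ _ k kk) //; first last.
- move=> x xk; rewrite g1 gf //; exact: bv.
- by rewrite g1.
- by move=> x y; exact: bilinN.
rewrite g1 g2; apply: mulf_neq0; first by apply: mulf_neq0; first rewrite pnatr_eq0.
apply: contraNneq fk => <-; apply/eqP; apply: odd_form_eq => [x xk|x y xk yk].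
  by rewrite gf.
by rewrite !gf.
Qed.

End OddFormVectors.

(** * Fields on a cylinder *)

Section FieldConstructions.
Context {R : realType} {m : nat} (M : manifold R m).
Implicit Types (f g : M -> R) (p : M) (X Y : vop M) (P Q : bop M).

Lemma filterS_manifold p (A B : M -> Prop) : (forall q, A q -> B q) ->
  (\forall q \near p, A q) -> \forall q \near p, B q.
Proof. exact: filterS. Qed.

Lemma smooth_at_eq p f g : f =1 g -> smooth_at p f -> smooth_at p g.
Proof. by move=> /funext ->. Qed.

Lemma pderiv_schwarz c i j f p : atlas c -> dom c p -> smooth_at p f ->
  pderiv c i (pderiv c j f) p = pderiv c j (pderiv c i f) p.
Proof.
move=> Ac cp /(smooth_atP _ Ac cp) sf.
have nK := near_inv_coordK (atlas_chart Ac) cp.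
have E k l : pderiv c k (pderiv c l f) p =
    'd_k ('d_l (f \o inv_coord c)) (coord c p).
  by apply: near_eq_derive; apply: filterS_rV nK => v [_ vK]; rewrite /= /pderiv vK.
by rewrite (E i j) (E j i); exact: schwarz.
Qed.

Lemma bivectorD P Q : is_bivector_field P -> is_bivector_field Q ->
  is_bivector_field (fun f g p => P f g p + Q f g p).
Proof.
move=> HP HQ c Ac; have oc := open_dom (atlas_chart Ac).
have [a [sa aN Pa]] := HP c Ac; have [b [sb bN Qb]] := HQ c Ac.
exists (fun i j p => a i j p + b i j p); split.
- move=> i j; apply/smooth_on_atP => // p cp; apply: smooth_atD.
    by apply: (smooth_on_atP _ oc).2 cp; exact: sa.
  by apply: (smooth_on_atP _ oc).2 cp; exact: sb.
- by move=> i j p cp; rewrite aN // bN // opprD.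
- move=> p f g cp sf sg; rewrite Pa // Qb // -big_split; apply: eq_bigr => i _ /=.
  by rewrite -big_split; apply: eq_bigr => j _ /=; rewrite mulrDl.
Qed.

Lemma bivectorZ (h : M -> R) P : (forall p, smooth_at p h) -> is_bivector_field P ->
  is_bivector_field (fun f g p => h p * P f g p).
Proof.
move=> sh HP c Ac; have oc := open_dom (atlas_chart Ac).
have [a [sa aN Pa]] := HP c Ac.
exists (fun i j p => h p * a i j p); split.
- move=> i j; apply/smooth_on_atP => // p cp; apply: smooth_atM => //.
  by apply: (smooth_on_atP _ oc).2 cp; exact: sa.
- by move=> i j p cp; rewrite aN // mulrN.
- move=> p f g cp sf sg; rewrite Pa // mulr_sumr; apply: eq_bigr => i _ /=.
  by rewrite mulr_sumr; apply: eq_bigr => j _ /=; rewrite mulrA.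
Qed.

Lemma bivector_wedge X Y : is_vector_field X -> is_vector_field Y ->
  is_bivector_field (wedge11 X Y).
Proof.
move=> HX HY c Ac; have oc := open_dom (atlas_chart Ac).
have [a [sa Xa]] := HX c Ac; have [b [sb Yb]] := HY c Ac.
have sa' i p : dom c p -> smooth_at p (a i).
  by move=> cp; apply: (smooth_on_atP _ oc).2 cp; exact: sa.
have sb' i p : dom c p -> smooth_at p (b i).
  by move=> cp; apply: (smooth_on_atP _ oc).2 cp; exact: sb.
exists (fun i j p => a i p * b j p - b i p * a j p); split.
- move=> i j; apply/smooth_on_atP => // p cp.
  by apply: smooth_atB; apply: smooth_atM; auto.
- by move=> i j p cp; ring.
- move=> p f g cp sf sg; rewrite /wedge11 !Xa // !Yb // !mulr_suml -sumrB.
  apply: eq_bigr => i _; rewrite !mulr_sumr -sumrB; apply: eq_bigr => j _.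
  ring.
Qed.

Lemma vector_contract P f : is_bivector_field P -> (forall p, smooth_at p f) ->
  is_vector_field (P f).
Proof.
move=> HP sf c Ac; have oc := open_dom (atlas_chart Ac).
have [a [sa aN Pa]] := HP c Ac.
exists (fun j p => \sum_i a i j p * pderiv c i f p); split.
  move=> j; apply/smooth_on_atP => // p cp; apply: smooth_at_sum => i.
  apply: smooth_atM; last exact: smooth_at_pderiv.
  by apply: (smooth_on_atP _ oc).2 cp; exact: sa.
move=> p g cp sg; rewrite Pa // exchange_big; apply: eq_bigr => j _ /=.
by rewrite mulr_suml; apply: eq_bigr => i _; rewrite mulrA.
Qed.

End FieldConstructions.

Section CylinderCalculus.
Context {R : realType} {m : nat} (M : manifold R m).
Notation C := (cylinder M).
Implicit Types (F G H : C -> R) (p : C) (E : vop M) (P : bop M).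

Lemma cylinder_chart_atlas (c : chart R m M) : atlas c ->
  atlas (cylinder_chart c : chart R (1 + m) C).
Proof. by exists c. Qed.

Lemma cylinder_coord0 (c : chart R m M) (p : C) :
  coord (cylinder_chart c) p 0 (lshift m ord0) = p.1.
Proof. by rewrite /= row_mxEl mxE. Qed.

Lemma cylinder_coordS (c : chart R m M) (p : C) i :
  coord (cylinder_chart c) p 0 (rshift 1 i) = coord c p.2 0 i.
Proof. by rewrite /= row_mxEr. Qed.

Lemma cylinder_smooth_fst p : smooth_at p (fst : C -> R).
Proof.
have [c Ac cp] := atlas_cover p.2.
have := @smooth_at_coord _ _ C _ p (lshift m ord0) (cylinder_chart_atlas Ac) cp.
by apply: smooth_at_eq => q; rewrite cylinder_coord0.
Qed.

Lemma cylinder_smooth_snd : smooth_map (snd : C -> M).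
Proof.
apply: smooth_mapP => [p|p d Ad dp j]; first exact: cvg_snd.
have := @smooth_at_coord _ _ C _ p (rshift 1 j) (cylinder_chart_atlas Ad) dp.
by apply: smooth_at_eq => q; rewrite cylinder_coordS.
Qed.

Lemma smooth_to_cylinder l (N : manifold R l) (h : N -> C) : continuous h ->
  (forall s, smooth_at s (fun x => (h x).1)) ->
  (forall s d j, atlas d -> dom d (h s).2 -> smooth_at s (fun x => coord d (h x).2 0 j)) ->
  smooth_map h.
Proof.
move=> ch s1 s2; apply: smooth_mapP => // s d [c Ac <-] cs j.
have [k ->|k ->] := split_ordP j.
  apply: smooth_at_eq (s1 s) => x.
  by rewrite (ord1 k) cylinder_coord0.
apply: smooth_at_eq (s2 s c k Ac cs) => x.
by rewrite cylinder_coordS.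
Qed.

Lemma cylinder_smooth_slice (t : R) : smooth_map ((fun x => (t, x)) : M -> C).
Proof.
apply: smooth_to_cylinder => [x|s|s d j Ad ds].
- have c1 : {for x, continuous (fun _ : M => t)} by exact: cst_continuous.
  have c2 : {for x, continuous (fun y : M => y)} by exact: cvg_id.
  exact: (cvg_pair c1 c2).
- exact: smooth_at_cst.
- exact: smooth_at_coord.
Qed.

Lemma smooth_at_slice p F : smooth_at p F -> smooth_at p.2 (fun x => F (p.1, x)).
Proof.
move=> sF; apply: (@smooth_at_pullback _ _ _ _ _ (fun x => (p.1, x) : C)).
  exact: cylinder_smooth_slice.
by case: p sF.
Qed.

Lemma cylinder_line F (c : chart R m M) (p : C) (v : 'rV[R]_(1 + m)) (h : R) :
  (F \o inv_coord (cylinder_chart c : chart R (1 + m) C))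
    (h *: v + coord (cylinder_chart c : chart R (1 + m) C) p) =
  F (h * v 0 (lshift m ord0) + p.1, inv_coord c (h *: rsubmx v + coord c p.2)).
Proof.
rewrite /=; congr (F (_, inv_coord c _)).
  by rewrite !mxE (unsplitK (inl _)) mxE mulr1n.
by rewrite linearD linearZ /= row_mxKr.
Qed.

Lemma rsubmx_lshift : rsubmx ('e_(lshift m ord0) : 'rV[R]_(1 + m)) = 0.
Proof. by apply/rowP => j; rewrite !mxE eq_rlshift andbF. Qed.

Lemma rsubmx_rshift i : rsubmx ('e_(rshift 1 i) : 'rV[R]_(1 + m)) = 'e_i.
Proof. by apply/rowP => j; rewrite !mxE eq_rshift. Qed.

Lemma pderiv_slice (c : chart R m M) i F p :
  pderiv (cylinder_chart c : chart R (1 + m) C) (rshift 1 i) F p =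
  pderiv c i (fun x => F (p.1, x)) p.2.
Proof.
apply: (derive_same_line _).1 => h.
apply: etrans (cylinder_line F c p _ h) _.
by rewrite mxE eq_lrshift andbF mulr0 add0r rsubmx_rshift.
Qed.

Lemma time_line (c : chart R m M) F p (h : R) : is_chart c -> dom c p.2 ->
  (F \o inv_coord (cylinder_chart c : chart R (1 + m) C))
    (h *: 'e_(lshift m ord0) + coord (cylinder_chart c : chart R (1 + m) C) p) =
  F (h *: 1 + p.1, p.2).
Proof.
move=> Hc cp; rewrite cylinder_line mxE !eqxx rsubmx_lshift scaler0 add0r.
by rewrite coordK.
Qed.

Lemma pderiv_time (c : chart R m M) F p : is_chart c -> dom c p.2 ->
  pderiv (cylinder_chart c : chart R (1 + m) C) (lshift m ord0) F p = time_field F p.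
Proof.
move=> Hc cp; rewrite /time_field derive1E.
by apply: (derive_same_line _).1 => h; exact: time_line.
Qed.

End CylinderCalculus.

Section LiftedFields.
Context {R : realType} {m : nat} (M : manifold R m).
Notation C := (cylinder M).
Notation T := (time_field (M := M)).
Implicit Types (F G H : C -> R) (p : C) (E : vop M) (P : bop M) (c : chart R m M).

Lemma time_derivable p F : smooth_at p F -> derivable (fun t => F (t, p.2)) p.1 1.
Proof.
have [c Ac cp] := atlas_cover p.2; have Hc := atlas_chart Ac => sF.
apply: (derive_same_line (fun h => time_line F h Hc cp)).2.
by have := @pderiv_derivable _ _ _ _ (lshift m ord0) p F (cylinder_chart_atlas Ac) cp sF.
Qed.

Lemma time_vector_field : is_vector_field T.
Proof.
move=> _ [c Ac <-]; exists (fun i _ => (i == lshift m ord0)%:R); split.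
  move=> i; apply/smooth_on_atP => [|p _].
    exact: open_dom (atlas_chart (cylinder_chart_atlas Ac)).
  exact: smooth_at_cst.
move=> p F cp sF; rewrite big_split_ord /= big_ord1 eqxx mul1r.
rewrite big1 ?addr0 => [|i _]; last exact: mul0r.
by rewrite (pderiv_time F (atlas_chart Ac) cp).
Qed.

Lemma smooth_at_snd p (f : M -> R) : smooth_at p.2 f -> smooth_at p (fun q : C => f q.2).
Proof. exact: smooth_at_pullback (cylinder_smooth_snd M). Qed.

Lemma lift_vector_field E : is_vector_field E -> is_vector_field (lift_vector E).
Proof.
move=> HE _ [c Ac <-]; have [a [sa Ea]] := HE c Ac.
have oc := open_dom (atlas_chart Ac).
pose b (j : 'I_(1 + m)) (p : C) := if fintype.split j is inr k then a k p.2 else 0.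
exists b; split.
  move=> j; apply/smooth_on_atP => [|p cp].
    exact: open_dom (atlas_chart (cylinder_chart_atlas Ac)).
  rewrite /b; case: fintype.split => k; first exact: smooth_at_cst.
  by apply: smooth_at_snd; apply: (smooth_on_atP _ oc).2 cp; exact: sa.
move=> p F cp sF; rewrite /lift_vector Ea //; last exact: smooth_at_slice.
rewrite big_split_ord /= big_ord1 /b (unsplitK (inl _)) mul0r add0r.
by apply: eq_bigr => k _; rewrite (unsplitK (inr _)) pderiv_slice.
Qed.

Lemma lift_bivector_field P : is_bivector_field P -> is_bivector_field (lift_bivector P).
Proof.
move=> HP _ [c Ac <-]; have [a [sa aN Pa]] := HP c Ac.
have oc := open_dom (atlas_chart Ac).
pose b (i j : 'I_(1 + m)) (p : C) := match fintype.split i, fintype.split j with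
  | inr k, inr l => a k l p.2 | _, _ => 0 end.
exists b; split.
- move=> i j; apply/smooth_on_atP => [|p cp].
    exact: open_dom (atlas_chart (cylinder_chart_atlas Ac)).
  rewrite /b; case: fintype.split => k; first exact: smooth_at_cst.
  case: fintype.split => l; first exact: smooth_at_cst.
  by apply: smooth_at_snd; apply: (smooth_on_atP _ oc).2 cp; exact: sa.
- move=> i j p cp; rewrite /b; case: (fintype.split i) => k; case: (fintype.split j) => l; rewrite ?oppr0 //.
  exact: aN.
- move=> p F G cp sF sG; rewrite /lift_bivector Pa //; try exact: smooth_at_slice.
  rewrite [RHS]big_split_ord /= big_ord1 [X in _ = X + _]big1 => [|j _]; last first.
    by rewrite /b (unsplitK (inl _)) mul0r.
  rewrite add0r; apply: eq_bigr => k _.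
  rewrite big_split_ord /= big_ord1 /b (unsplitK (inr _)) (unsplitK (inl _)) mul0r add0r.
  by apply: eq_bigr => l _; rewrite (unsplitK (inr _)) !pderiv_slice.
Qed.

Lemma time_snd (f : M -> R) p : T (fun q => f q.2) p = 0.
Proof. exact: (@derive1_cst R R (f p.2) p.1). Qed.

Lemma time_pderiv_slice c k F p : atlas c -> dom c p.2 -> smooth_at p F ->
  T (fun q => pderiv c k (fun x => F (q.1, x)) q.2) p =
  pderiv c k (fun x => T F (p.1, x)) p.2.
Proof.
move=> Ac cp sF; have Hc := atlas_chart Ac.
have At := cylinder_chart_atlas Ac.
have -> : (fun q => pderiv c k (fun x => F (q.1, x)) q.2) =
    pderiv (cylinder_chart c : chart R (1 + m) C) (rshift 1 k) F.
  by apply/funext => q; rewrite pderiv_slice.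
rewrite -(pderiv_time _ Hc cp) (pderiv_schwarz _ _ At cp sF) -pderiv_slice.
apply: (pderiv_ext _ At cp).
apply: filterS_manifold (chart_nbhs (atlas_chart At) cp) => q cq.
 exact: pderiv_time.
Qed.

(** The lifted fields do not depend on the time coordinate, so they commute
    with [time_field]; the second derivatives that appear are mixed ones. *)
Lemma time_lift_vector E F p : is_vector_field E -> smooth_at p F ->
  T (lift_vector E F) p = lift_vector E (T F) p.
Proof.
move=> HE sF; have [c Ac cp] := atlas_cover p.2.
have [a [sa Ea]] := HE c Ac; have oc := open_dom (atlas_chart Ac).
have tT := vector_tangent p time_vector_field.
have sTF : smooth_at p (T F) := vector_smooth time_vector_field sF.
have sa' k : smooth_at p (fun q : C => a k q.2).
  by apply: smooth_at_snd; apply: (smooth_on_atP _ oc).2 cp; exact: sa.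
have sd k : smooth_at p (fun q => pderiv c k (fun x => F (q.1, x)) q.2).
  apply: smooth_at_eq (smooth_at_pderiv (rshift 1 k) (cylinder_chart_atlas Ac) cp sF).
  by move=> q; rewrite pderiv_slice.
rewrite (tangent_ext tT (g := fun q =>
    \sum_k a k q.2 * pderiv c k (fun x => F (q.1, x)) q.2)); last 2 first.
- apply: filterS_manifold (filterI (chart_nbhs (atlas_chart (cylinder_chart_atlas Ac)) cp)
    (near_smooth_at sF)) => q.
  by move=> [cq sq]; rewrite /lift_vector Ea //; exact: smooth_at_slice.
- exact: vector_smooth (lift_vector_field HE) sF.
rewrite (tangent_sum tT) => [|k]; last exact: smooth_atM.
rewrite /lift_vector Ea //; last exact: smooth_at_slice.
apply: eq_bigr => k _.
by rewrite (tangentM tT) // time_snd mul0r add0r time_pderiv_slice.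
Qed.

Lemma time_lift_bivector P F G p : is_bivector_field P ->
  smooth_at p F -> smooth_at p G ->
  T (lift_bivector P F G) p = lift_bivector P (T F) G p + lift_bivector P F (T G) p.
Proof.
move=> HP sF sG; have [c Ac cp] := atlas_cover p.2.
have [a [sa _ Pa]] := HP c Ac; have oc := open_dom (atlas_chart Ac).
have tT := vector_tangent p time_vector_field.
have sT H : smooth_at p H -> smooth_at p (T H) := vector_smooth time_vector_field.
have sa' k l : smooth_at p (fun q : C => a k l q.2).
  by apply: smooth_at_snd; apply: (smooth_on_atP _ oc).2 cp; exact: sa.
have sd k H : smooth_at p H -> smooth_at p (fun q => pderiv c k (fun x => H (q.1, x)) q.2).
  move=> sH.
  apply: smooth_at_eq (smooth_at_pderiv (rshift 1 k) (cylinder_chart_atlas Ac) cp sH).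
  by move=> q; rewrite pderiv_slice.
have sl H : smooth_at p H -> smooth_at p.2 (fun x => H (p.1, x)) by exact: smooth_at_slice.
rewrite (tangent_ext tT (g := fun q => \sum_k \sum_l a k l q.2 *
  (pderiv c k (fun x => F (q.1, x)) q.2 * pderiv c l (fun x => G (q.1, x)) q.2))); last 2 first.
- apply: filterS_manifold (filterI (chart_nbhs (atlas_chart (cylinder_chart_atlas Ac)) cp)
    (filterI (near_smooth_at sF) (near_smooth_at sG))) => q.
  by move=> [cq [sq sq']]; rewrite /lift_bivector Pa //; exact: smooth_at_slice.
- exact: bivector_smooth (lift_bivector_field HP) sF sG.
rewrite (tangent_sum tT) => [|k]; last first.
  by apply: smooth_at_sum => l; apply: smooth_atM => //; apply: smooth_atM; exact: sd.
rewrite /lift_bivector (Pa _ _ _ cp (sl _ (sT _ sF)) (sl _ sG)).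
rewrite (Pa _ _ _ cp (sl _ sF) (sl _ (sT _ sG))).
rewrite -big_split; apply: eq_bigr => k _ /=.
rewrite (tangent_sum tT) => [|l]; last first.
  by apply: smooth_atM => //; apply: smooth_atM; exact: sd.
rewrite -big_split; apply: eq_bigr => l _ /=.
have [sk sl'] := (sd k F sF, sd l G sG).
rewrite (tangentM tT) //; last exact: smooth_atM.
rewrite (time_snd (a k l)) mul0r add0r (tangentM tT sk sl').
by rewrite (time_pderiv_slice k Ac cp sF) (time_pderiv_slice l Ac cp sG) mulrDr.
Qed.

End LiftedFields.

(** * The poissonification of a Jacobi manifold *)

Lemma add_self_inj (R : numFieldType) (s t : R) : s + s = 2%:R * t -> s = t.
Proof.
rewrite -mulr2n -[_ *+ 2]mulr_natl => /mulfI; apply.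
by rewrite pnatr_eq0.
Qed.

Lemma solve_first (R : zmodType) (s t u v : R) : s + t + u = v -> s = v - t - u.
Proof. by move=> <-; rewrite (addrAC s) !addrK. Qed.

Lemma jacobi_cyclic (R : realType) m (M : manifold R m) (P : bop M) (E : vop M)
    p f g h : is_jacobi P E -> smooth_at p f -> smooth_at p g -> smooth_at p h ->
  P (P f g) h p + P (P g h) f p + P (P h f) g p =
  E f p * P g h p + E g p * P h f p + E h p * P f g p.
Proof. by move=> [_ _ J _] sf sg sh; apply: add_self_inj; exact: J. Qed.

Section PoissonificationStructure.
Context {R : realType} {m : nat} (M : manifold R m) (P : bop M) (E : vop M).
Hypothesis HJ : is_jacobi P E.
Notation C := (cylinder M).
Notation T := (time_field (M := M)).
Notation e := (lift_vector E).
Notation q := (lift_bivector P).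
Notation PP := (poissonification P E).
Implicit Types (F G H : C -> R) (p : C).

(** The poissonification is the product of [w] and [Y]. *)
Let w : C -> R := fun p => expR (- p.1).
Let Y F G : C -> R := fun p => q F G p + wedge11 T e F G p.

Let HP : is_bivector_field P. Proof. by case: HJ. Qed.
Let HE : is_vector_field E. Proof. by case: HJ. Qed.
Let HT : is_vector_field T := time_vector_field (M := M).
Let He : is_vector_field e := lift_vector_field HE.
Let Hq : is_bivector_field q := lift_bivector_field HP.
Let HY : is_bivector_field Y := bivectorD Hq (bivector_wedge HT He).

Lemma smooth_exp_time p : smooth_at p w.
Proof.
have [c Ac cp] := atlas_cover p.2.
apply: (@smooth_at_eq _ _ _ _ ((fun v : 'rV_(1 + m) => expR (- v 0 (lshift m ord0))) \o
    coord (cylinder_chart c : chart R (1 + m) C))).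
  by move=> x; rewrite /w -(cylinder_coord0 c).
apply: smooth_at_comp => [j|]; last exact: smooth_rV_expN.
exact: (smooth_at_coord _ (cylinder_chart_atlas Ac) cp).
Qed.

Lemma poissonification_bivector : is_bivector_field PP.
Proof. exact: bivectorZ smooth_exp_time HY. Qed.

Lemma time_exp p : T w p = - w p.
Proof.
rewrite /time_field derive1E.
have [||_ ->] := @is_derive_comp1 R _ expR (fun t : R => - t) p.1 1.
- exact: derivable_expR.
- exact: derivable_opp.
by rewrite derive_val deriveN // derive_id mulrN1.
Qed.

Lemma lift_vector_exp p : e w p = 0.
Proof. exact: tangent_cst (vector_tangent p.2 HE) (expR (- p.1)). Qed.

Lemma lift_bivector_exp p G : smooth_at p G -> q w G p = 0.
Proof.
move=> sG; have sG' := smooth_at_slice sG.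
exact: tangent_cst (bivector_tangentl HP sG') (expR (- p.1)).
Qed.

Section AtPoint.
Variable p : C.
Let sT F : smooth_at p F -> smooth_at p (T F) := vector_smooth HT.
Let se F : smooth_at p F -> smooth_at p (e F) := vector_smooth He.
Let tT := vector_tangent p HT.
Let te := vector_tangent p He.

(** Leibniz rule for [Y F G]; applied with [D] equal to [T], to [E], and to
    the bracket with a third function. *)
Lemma tangent_wedge (D : (C -> R) -> R) F G : tangent_at p D ->
  smooth_at p F -> smooth_at p G ->
  D (Y F G) = D (q F G) + (D (T F) * e G p + T F p * D (e G)
    - (D (e F) * T G p + e F p * D (T G))).
Proof.
move=> tD sF sG; have sq : smooth_at p (q F G) := bivector_smooth Hq sF sG.
have s1 := smooth_atM (sT sF) (se sG); have s2 := smooth_atM (se sF) (sT sG).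
rewrite (tangentD tD sq (smooth_atB s1 s2)) (tangentB tD s1 s2).
by rewrite (tangentM tD (sT sF) (se sG)) (tangentM tD (se sF) (sT sG)).
Qed.

Lemma lift_vector_bivector F G : smooth_at p F -> smooth_at p G ->
  e (q F G) p = q (e F) G p + q F (e G) p.
Proof.
move=> sF sG; have [_ _ _ /(_ p.2 _ _ (smooth_at_slice sF) (smooth_at_slice sG))] := HJ.
by rewrite /schouten12 -addrA -opprD => /eqP; rewrite subr_eq0 => /eqP.
Qed.

(** The exponential is differentiated by [T] only, which produces the term
    [- Y F G * E H].  In the cyclic sum these terms cancel the defect
    [E /\ P] of the Jacobi identity of [P], and the iterated derivatives cancel
    in pairs. *)
Lemma poissonification_iter F G H : smooth_at p F -> smooth_at p G -> smooth_at p H ->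
  PP (PP F G) H p = w p * w p * (q (q F G) H p
   + (q (T F) H p * e G p + T F p * q (e G) H p
      - (q (e F) H p * T G p + e F p * q (T G) H p))
   + (q (T F) G p - q (T G) F p + (T (T F) p * e G p + T F p * e (T G) p
      - (e (T F) p * T G p + e F p * T (T G) p))
      - (q F G p + (T F p * e G p - e F p * T G p))) * e H p
   - (q (e F) G p - q (e G) F p + (e (T F) p * e G p + T F p * e (e G) p
      - (e (e F) p * T G p + e F p * e (T G) p))) * T H p).
Proof.
move=> sF sG sH; have sw := smooth_exp_time p.
have sY : smooth_at p (Y F G) := bivector_smooth HY sF sG.
have tq : tangent_at p (fun f => q f H p) := bivector_tangentl Hq sH.
transitivity (w p * (q (fun x => w x * Y F G x) H p +
  (T (fun x => w x * Y F G x) p * e H p - e (fun x => w x * Y F G x) p * T H p))).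
  by [].
rewrite (tangentM tq sw sY) (tangentM tT sw sY) (tangentM te sw sY).
rewrite (lift_bivector_exp sH) time_exp lift_vector_exp.
rewrite (tangent_wedge tq sF sG) (tangent_wedge tT sF sG) (tangent_wedge te sF sG).
rewrite (time_lift_bivector HP sF sG) (lift_vector_bivector sF sG).
rewrite (time_lift_vector HE sF) (time_lift_vector HE sG).
rewrite (bivector_skew Hq (sT sG) sF) (bivector_skew Hq (se sG) sF).
rewrite -[Y F G p]/(q F G p + (T F p * e G p - e F p * T G p)).
move: (w p) (q (q F G) H p) (q (T F) H p) (q (e G) H p) (q (e F) H p) (q (T G) H p)
  (q (T F) G p) (q (T G) F p) (q (e F) G p) (q (e G) F p)
  (T (T F) p) (T (T G) p) (e (T F) p) (e (T G) p) (e (e F) p) (e (e G) p)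
  (T F p) (T G p) (T H p) (e F p) (e G p) (e H p) (q F G p) => *.
ring.
Qed.

End AtPoint.

Lemma poissonification_poisson : is_poisson PP.
Proof.
split; first exact: poissonification_bivector.
move=> p F G H sF sG sH; rewrite /schouten22.
rewrite (poissonification_iter sF sG sH) (poissonification_iter sG sH sF).
rewrite (poissonification_iter sH sF sG).
have J : q (q F G) H p + q (q G H) F p + q (q H F) G p =
    e F p * q G H p + e G p * q H F p + e H p * q F G p.
  exact: jacobi_cyclic HJ (smooth_at_slice sF) (smooth_at_slice sG) (smooth_at_slice sH).
rewrite (solve_first J).
move: (w p) (q (T F) H p) (q (e G) H p) (q (e F) H p) (q (T G) H p)
  (q (T F) G p) (q (T G) F p) (q (e F) G p) (q (e G) F p)
  (q (T H) F p) (q (T H) G p) (q (e H) F p) (q (e H) G p)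
  (T (T F) p) (T (T G) p) (T (T H) p) (e (T F) p) (e (T G) p) (e (T H) p)
  (e (e F) p) (e (e G) p) (e (e H) p) (q (q G H) F p) (q (q H F) G p)
  (T F p) (T G p) (T H p) (e F p) (e G p) (e H p) (q F G p) (q G H p) (q H F p) => *.
ring.
Qed.

(** The flow of [T] is translation in time. *)
Lemma time_complete : complete T.
Proof.
move=> p; exists (fun t => (t + p.1, p.2) : C); first by rewrite add0r; case: p.
split.
  move=> t; have c1 : {for t, continuous (fun t : R => t + p.1)}.
    by apply: continuousD; [exact: cvg_id|exact: cst_continuous].
  have c2 : {for t, continuous (fun _ : R => p.2)} by exact: cst_continuous.
  exact: (cvg_pair c1 c2).
move=> t F sF; have dF := time_derivable sF.
have [D1 D2] := @derive_same_line _ R R (fun t => F (t, p.2)) (fun s => F (s + p.1, p.2))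
  (t + p.1) 1 t 1 (fun h => congr1 (fun s => F (s, p.2)) (addrA _ _ _)).
split; first exact: D2.
by rewrite -D1 /time_field derive1E.
Qed.

Lemma poissonification_homogeneous : is_homogeneous_poisson PP T.
Proof.
split=> //; [exact: poissonification_poisson|exact: time_complete|].
move=> p F G sF sG; rewrite /schouten12.
have sw := smooth_exp_time p; have sY : smooth_at p (Y F G) := bivector_smooth HY sF sG.
have tT := vector_tangent p HT.
rewrite (tangentM tT sw sY) time_exp (tangent_wedge tT sF sG).
rewrite (time_lift_bivector HP sF sG) (time_lift_vector HE sF) (time_lift_vector HE sG).
rewrite -[Y F G p]/(q F G p + (T F p * e G p - e F p * T G p)).
rewrite -[PP (T F) G p]/(w p * (q (T F) G p + (T (T F) p * e G p - e (T F) p * T G p))).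
rewrite -[PP F (T G) p]/(w p * (q F (T G) p + (T F p * e (T G) p - e F p * T (T G) p))).
rewrite -[PP F G p]/(w p * (q F G p + (T F p * e G p - e F p * T G p))).
move: (w p) (q (T F) G p) (q F (T G) p) (T (T F) p) (T (T G) p) (e (T F) p) (e (T G) p)
  (T F p) (T G p) (e F p) (e G p) (q F G p) => *.
ring.
Qed.

End PoissonificationStructure.

Section Gradient.
Context {R : realType} {m : nat} (M : manifold R m).
Implicit Types (f g : M -> R) (p : M) (c : chart R m M).

Definition grad c p f : 'rV[R]_m := \row_i pderiv c i f p.

Lemma pderiv_tangent c i p : atlas c -> dom c p -> tangent_at p (fun f => pderiv c i f p).
Proof.
move=> Ac cp; exists c; split=> //; exists (fun j => (j == i)%:R) => f _.
rewrite (bigD1 i) //= eqxx mul1r big1 ?addr0 // => j /negPf ->.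
by rewrite mul0r.
Qed.

(** Germs with a prescribed differential. *)
Definition linear_germ c (v : 'rV[R]_m) : M -> R := fun x => \sum_l v 0 l * coord c x 0 l.

Lemma smooth_linear_germ c v p : atlas c -> dom c p -> smooth_at p (linear_germ c v).
Proof.
move=> Ac cp; apply: smooth_at_sum => l; apply: smooth_atM; first exact: smooth_at_cst.
exact: smooth_at_coord.
Qed.

Lemma grad_linear_germ c v p : atlas c -> dom c p -> grad c p (linear_germ c v) = v.
Proof.
move=> Ac cp; apply/rowP => i; rewrite mxE.
have ti := pderiv_tangent i Ac cp.
have sl l := @smooth_at_coord _ _ _ _ _ l Ac cp.
rewrite (tangent_sum ti) => [|l]; last first.
  by apply: smooth_atM => //; exact: smooth_at_cst.
rewrite (bigD1 i) //= big1 ?addr0 => [|l li].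
  by rewrite (tangentZ ti) // pderiv_coord // eqxx mulr1.
by rewrite (tangentZ ti) // pderiv_coord // eq_sym (negPf li) mulr0.
Qed.

End Gradient.

Section ContactNondegenerate.
Context {R : realType} {n : nat} (M : manifold R n.*2.+1) (P : bop M) (E : vop M).
Notation C := (cylinder M).

Lemma wedge_powerE (f : 'I_n.*2.+1 -> M -> R) p :
  wedge_power E P f p =
  2%:R ^- n * odd_form n (fun i => E (f i) p) (fun i j => P (f i) (f j) p).
Proof. by rewrite form_full. Qed.

(** If [dF] is in the kernel of [e^-t (P + d/dt /\ E)], its restriction [v] to
    the slice satisfies [E v = 0] and [P v] is a multiple of [E]; as
    [E /\ P^n <> 0], both [v] and the multiple, which is [dF/dt] up to sign,
    are zero. *)
Lemma poissonification_nondegenerate : is_contact P E ->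
  nondegenerate (poissonification P E).
Proof.
move=> [HJ HC] p F sF F0 _ [c Ac <-] cp.
have [HP HE _ _] := HJ; have cp2 : dom c p.2 by [].
have [a [_ Ea]] := HE c Ac; have [b [_ bN Pb]] := HP c Ac.
pose f0 x := F (p.1, x).
have sf0 : smooth_at p.2 f0 := smooth_at_slice sF.
have w0 : expR (- p.1) != 0 by apply: lt0r_neq0; exact: expR_gt0.
pose a' k := a k p.2; pose b' k l := b k l p.2.
have E1 f : smooth_at p.2 f -> E f p.2 = dual a' (grad c p.2 f).
  by move=> sf; rewrite Ea //; apply: eq_bigr => i _; rewrite mxE.
have P1 f g : smooth_at p.2 f -> smooth_at p.2 g ->
    P f g p.2 = bilin b' (grad c p.2 f) (grad c p.2 g).
  move=> sf sg; rewrite Pb //; apply: eq_bigr => i _; apply: eq_bigr => j _.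
  by rewrite !mxE.
have b'N i j : b' j i = - b' i j by exact: bN.
have [f [sf]] := HC p.2; rewrite wedge_powerE mulf_eq0 negb_or => /andP[_ f_neq0].
have Ef0 : E f0 p.2 = 0.
  have := F0 fst (cylinder_smooth_fst p).
  rewrite /poissonification /wedge11 /lift_bivector /lift_vector /=.
  rewrite (tangent_cst (bivector_tangent HP sf0) p.1).
  rewrite (tangent_cst (vector_tangent p.2 HE) p.1).
  have -> : time_field (M := M) fst p = 1 by rewrite /time_field derive1_id.
  by rewrite mulr0 mulr1 add0r sub0r => /eqP; rewrite mulf_eq0 (negPf w0) oppr_eq0 => /eqP.
have Pf0 v : bilin b' (grad c p.2 f0) v = - time_field F p * dual a' v.
  pose g := linear_germ c v; have sg : smooth_at p.2 g := smooth_linear_germ v Ac cp2.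
  have := F0 (fun x => g x.2) (smooth_at_snd sg).
  rewrite /poissonification /wedge11 /lift_bivector /lift_vector /=.
  rewrite time_snd mulr0 subr0 (P1 f0) // E1 // grad_linear_germ //.
  move=> /eqP; rewrite mulf_eq0 (negPf w0) /= addr_eq0 => /eqP ->.
  by rewrite mulNr.
have [v0 t0] : grad c p.2 f0 = 0 /\ - time_field F p = 0.
  apply: (@vform_kernel _ _ a' b' b'N (fun i => grad c p.2 (f i))) => //.
    apply: contraNneq f_neq0 => <-; apply/eqP; apply: eq_bigr => s _.
    rewrite /odd_term E1 //; congr (_ * (_ * _)); apply: eq_bigr => i _.
    by rewrite P1.
  by rewrite -E1.
move=> i; have [k ->|k ->] := split_ordP i.
  rewrite (ord1 k) (pderiv_time _ (atlas_chart Ac) cp2).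
  by apply/eqP; rewrite -oppr_eq0 t0.
by rewrite pderiv_slice; have /rowP/(_ k) := v0; rewrite !mxE.
Qed.

End ContactNondegenerate.

Lemma contact_to_symplectic_resolution (R : realType) (n : nat)
    (M S : manifold R n.*2.+1) (piM : bop M) (EM : vop M) (P : bop S) (E : vop S)
    (phi : S -> M) :
  contact_resolution piM EM P E phi ->
  homogeneous_symplectic_resolution (poissonification piM EM) (time_field (M := M))
    (poissonification P E) (time_field (M := S))
    ((fun p => (p.1, phi p.2)) : cylinder S -> cylinder M).
Proof.
move=> [HC [sphi pP pE] surj]; have [HJ _] := HC.
have c_phi := sphi.1.
split.
- split.
  + by split; [exact: poissonification_poisson|exact: poissonification_nondegenerate].
  + split.
      apply: smooth_to_cylinder => [p|p|p d j Ad dp].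
      * have c1 : {for p, continuous (fun q : cylinder S => q.1)} by exact: cvg_fst.
        have c2 : {for p, continuous (fun q : cylinder S => phi q.2)}.
          by apply: continuous_comp; [exact: cvg_snd|exact: c_phi].
        exact: (cvg_pair c1 c2).
      * exact: cylinder_smooth_fst.
      * apply: (@smooth_at_snd _ _ _ p (fun x => coord d (phi x) 0 j)).
        apply: (smooth_at_pullback (f := fun x => coord d x 0 j) sphi).
        exact: smooth_at_coord.
    move=> p F G sF sG; rewrite /poissonification /= /wedge11 /lift_bivector /lift_vector.
    have sF' := smooth_at_slice sF; have sG' := smooth_at_slice sG.
    congr (_ * (_ + (_ * _ - _ * _))).
    * exact: pP sF' sG'.
    * exact: pE sG'.
    * exact: pE sF'.
  + move=> [t x] _; have [s _ sx] := surj x I.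
    by exists (t, s) => //=; rewrite sx.
- exact: poissonification_homogeneous.
- by [].
Qed.

(** * The zero set of a function as a manifold *)

Section SubspaceTopology.
Context {T : topologicalType} (K : set T).

Definition incl (s : set_type K) : T := set_val s.

Lemma incl_inj : injective incl.
Proof. by move=> [x Kx] [y Ky]; rewrite /incl !set_valE /= => xy; exact: eq_exist. Qed.

Lemma incl_mem s : K (incl s).
Proof. by case: s => x Kx; rewrite /incl set_valE /=; exact: set_mem. Qed.

Lemma continuous_incl : continuous incl.
Proof. exact: (@initial_continuous (set_type K) T set_val). Qed.

(** The topology of the subspace is the initial one for the inclusion. *)
Lemma nbhs_incl s (A : set (set_type K)) :
  nbhs s A <-> exists2 B, nbhs (incl s) B & forall s', B (incl s') -> A s'.
Proof.
split=> [|[B nB BA]]; last first.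
  by have nB' : nbhs s (incl @^-1` B) := continuous_incl nB; apply: filterS nB' => s'; exact: BA.
move=> [_ /= [[B oB <-] Bs BA]]; exists B; last by move=> s'; exact: BA.
exact: open_nbhs_nbhs.
Qed.

Lemma continuous_to_incl (U : topologicalType) (h : U -> set_type K) u :
  {for u, continuous (incl \o h)} -> {for u, continuous h}.
Proof.
move=> ch A /nbhs_incl[B nB BA].
have nB' : nbhs u ((incl \o h) @^-1` B) := ch _ nB.
by apply: (@filterS _ (nbhs u) _ _ _ _ nB') => v; exact: BA.
Qed.

Lemma incl_hausdorff : hausdorff_space T -> hausdorff_space (set_type K).
Proof.
move=> HT x y xy; apply: incl_inj; apply: HT => A B nA nB.
have [z [Az Bz]] := xy _ _ (continuous_incl nA) (continuous_incl nB).
by exists (incl z).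
Qed.

Lemma incl_second_countable : @second_countable T -> @second_countable (set_type K).
Proof.
move=> [B cB [oB bB]]; exists ((fun U => incl @^-1` U) @` B).
  by apply: (sub_countable (card_image_le _ _)).
split=> [_ [U BU <-]|s A /nbhs_incl[U nU UA]].
  by apply: open_comp; [move=> x _; exact: continuous_incl|exact: oB].
have [V [BV Vs] VU] := bB _ _ nU.
exists (incl @^-1` V); first by split=> //; exists V.
by move=> s' /VU; exact: UA.
Qed.

End SubspaceTopology.

Section Slice.
Context {R : realType} {m : nat} (S : manifold R m.+1) (tau : S -> R).
Hypothesis stau : forall p, smooth_at p tau.
Hypothesis dtau : forall p, tau p = 0 ->
  exists c i, [/\ atlas c, dom c p & pderiv c i tau p != 0].

Let K := [set p | tau p = 0].
Notation level := (set_type K).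
Notation iota := (@incl S K).
Implicit Types (s : level) (d : chart R m level).

Lemma tau_incl s : tau (iota s) = 0.
Proof. exact: (@incl_mem S K s). Qed.

(** A maximal atlas: the inclusion is smooth in these charts and their
    coordinates extend locally to smooth functions on the ambient manifold.
    Changes of coordinates are then composites of smooth maps, and only the
    existence of charts requires the implicit function theorem. *)
Definition slice_atlas : set (chart R m level) := [set d | [/\ is_chart d,
  forall s, dom d s -> forall F, smooth_at (iota s) F ->
    smooth_rV_at (coord d s) (F \o iota \o inv_coord d) &
  forall s, dom d s -> exists Y : S -> 'rV[R]_m,
    (forall j, smooth_at (iota s) (fun x => Y x 0 j)) /\
    \forall s' \near s, coord d s' = Y (iota s')]].

Lemma slice_atlas_compatible d d' : slice_atlas d -> slice_atlas d' -> compatible d d'.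
Proof.
move=> [Hd sd _] [Hd' _ ed'] j.
apply/(smooth_on_rVP _ (open_coord_image Hd (open_dom Hd'))) => _ [s [ds d's] <-].
have [Y [sY dY]] := ed' s d's.
apply: smooth_rV_ext (sd s ds _ (sY j)).
by apply: filterS_rV (near_inv_coord Hd ds dY) => v /= ->.
Qed.

(** What the implicit function theorem yields for [tau] in the chart [c]: the
    image of the zero set in [N] is the graph of [g] over [W]. *)
Definition graph_chart (s0 : level) (c : chart R m.+1 S) (i : 'I_m.+1)
    (N : set 'rV[R]_m.+1) (W : set 'rV[R]_m) (g : 'rV[R]_m -> R) : Prop :=
  [/\ [/\ is_chart c, atlas c & dom c (iota s0)],
      [/\ open N, N (coord c (iota s0)), N `<=` coord c @` dom c, open W & smooth_on_rV W g],
      'd_i (tau \o inv_coord c) (coord c (iota s0)) != 0 &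
      [/\ forall x, N x -> W (delete i x),
          forall x, N x -> tau (inv_coord c x) = 0 ->
            insert i (g (delete i x)) (delete i x) = x &
          forall y, W y -> N (insert i (g y) y) /\ tau (inv_coord c (insert i (g y) y)) = 0]].

Lemma graph_chart_exists s0 : exists c i N W g, graph_chart s0 c i N W g.
Proof.
have [c [i [Ac cs ti]]] := dtau (tau_incl s0); have Hc := atlas_chart Ac.
have nA : nbhs (coord c (iota s0)) (coord c @` dom c).
  by apply: open_nbhs_nbhs; split; [exact: open_codom|exists (iota s0)].
have st := (smooth_atP _ Ac cs).1 (stau (iota s0)).
have [|N [W [g [H1 H2]]]] := implicit_function nA st _ ti.
  by rewrite /= coordK // tau_incl.
by exists c, i, N, W, g.
Qed.

Section GraphChart.
Variables (s0 : level) (c : chart R m.+1 S) (i : 'I_m.+1).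
Variables (N : set 'rV[R]_m.+1) (W : set 'rV[R]_m) (g : 'rV[R]_m -> R).
Hypothesis Hg : graph_chart s0 c i N W g.

Definition graph_point (y : 'rV[R]_m) : S := inv_coord c (insert i (g y) y).

(** The coordinates of a point of the graph are its coordinates other than the
    [i]-th.  Outside [W] the inverse takes the value [s0] as a default. *)
Definition slice_chart : chart R m level := @Chart R m level
  [set s | dom c (iota s) /\ N (coord c (iota s))]
  (fun s => delete i (coord c (iota s)))
  (fun y => if pselect (K (graph_point y)) is left Ky
            then exist _ (graph_point y) (mem_set Ky) else s0).

Lemma slice_chart_inv y : W y -> iota (inv_coord slice_chart y) = graph_point y.
Proof.
have [_ _ _ [_ _ Wg]] := Hg => /Wg [_ ty] /=.
by case: pselect => // Ky; rewrite /incl set_valE.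
Qed.

Lemma smooth_graph_insert y j : W y -> smooth_rV_at y (fun y => insert i (g y) y 0 j).
Proof.
have [_ [_ _ _ oW sg] _ _] := Hg => Wy.
case: (unliftP i j) => [k ->|->].
  by apply: smooth_rV_ext (smooth_rV_coord y k); apply: nearW_rV => z; rewrite insert_lift.
have sgy := (smooth_on_rVP _ oW).1 sg y Wy.
by apply: smooth_rV_ext sgy; apply: nearW_rV => z; rewrite insert_at.
Qed.

Lemma graph_chart_coord s : N (coord c (iota s)) -> dom c (iota s) ->
  insert i (g (delete i (coord c (iota s)))) (delete i (coord c (iota s)))
    = coord c (iota s).
Proof.
have [[Hc _ _] _ _ [_ NK _]] := Hg => Ns cs.
by apply: NK => //; rewrite coordK // tau_incl.
Qed.

Lemma continuous_graph_point y : W y -> {for y, continuous graph_point}.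
Proof.
have [[Hc _ _] [_ _ Nc _ _] _ [_ _ Wg]] := Hg => Wy.
have [/Nc Ny _] := Wg y Wy.
apply: (@continuous_comp _ _ _ (fun y => insert i (g y) y) (inv_coord c)).
  by apply: continuous_rV => j; apply: smooth_rV_continuous; exact: smooth_graph_insert.
exact: (@continuous_inv_coord _ _ _ _ Hc _ Ny).
Qed.

Lemma slice_chart_codom : coord slice_chart @` dom slice_chart = W.
Proof.
have [[Hc _ _] [oN _ Nc oW _] _ [NW NK Wg]] := Hg.
apply/seteqP; split=> [_ [s [cs Ns] <-]|y Wy]; first exact: NW.
have [Ny ty] := Wg y Wy; have [x cx xE] := Nc _ Ny.
have iy := slice_chart_inv Wy.
have gx : graph_point y = x by rewrite /graph_point -xE coordK.
exists (inv_coord slice_chart y); first by split; rewrite iy gx // xE.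
by rewrite -[LHS]/(delete i (coord c (iota _))) iy gx xE delete_insert.
Qed.

Lemma slice_chart_is_chart : is_chart slice_chart.
Proof.
have [[Hc _ _] [oN _ Nc oW _] _ [NW NK Wg]] := Hg.
have cont_delete (x : 'rV[R]_m.+1) : {for x, continuous (delete i : 'rV[R]_m.+1 -> 'rV[R]_m)}.
  apply: continuous_rV => k; apply: (@continuous_ext _ _ (fun x : 'rV[R]_m.+1 => x 0 (lift i k))).
    by apply: nearW_rV => z; rewrite mxE.
  exact: coord_continuous.
split.
- rewrite openE => s [cs Ns].
  have nN : \forall x \near coord c (iota s), N x by exact: open_nbhs_nbhs.
  exact: continuous_incl (filterI (chart_nbhs Hc cs) (near_coord Hc cs nN)).
- by rewrite slice_chart_codom.
- move=> s [cs Ns]; apply: incl_inj.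
  rewrite slice_chart_inv; last exact: NW.
  by rewrite /graph_point graph_chart_coord // coordK.
- move=> s [cs Ns].
  apply: (@continuous_comp _ _ _ (coord c \o iota) (delete i)); last exact: cont_delete.
  apply: continuous_comp; first exact: continuous_incl.
  exact: (@continuous_coord _ _ _ _ Hc _ cs).
- rewrite slice_chart_codom => y Wy; apply: continuous_to_incl.
  have gy := continuous_graph_point Wy.
  have nW : \forall z \near y, W z by exact: open_nbhs_nbhs.
  apply: continuous_ext gy.
  by apply: filterS_rV nW => z Wz; rewrite /= slice_chart_inv.
Qed.

Lemma slice_chart_in_atlas : slice_atlas slice_chart.
Proof.
have [[Hc Ac _] [oN _ Nc oW _] _ [NW NK Wg]] := Hg.
split; first exact: slice_chart_is_chart.
- move=> s [cs Ns] F sF; set y := coord slice_chart s.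
  have Wy : W y by exact: NW.
  have nW : \forall z \near y, W z by exact: open_nbhs_nbhs.
  apply: (@smooth_rV_ext _ _ _ ((F \o inv_coord c) \o (fun y => insert i (g y) y))).
    by apply: filterS_rV nW => z Wz; rewrite /= slice_chart_inv.
  apply: smooth_rV_comp => [j|]; first exact: smooth_graph_insert.
  rewrite /y -[coord slice_chart s]/(delete i (coord c (iota s))) graph_chart_coord //.
  exact: (smooth_atP _ Ac cs).1.
- move=> s [cs Ns]; exists (delete i \o coord c); split=> [j|].
    apply: smooth_at_eq (smooth_at_coord (lift i j) Ac cs) => x.
    by rewrite /= mxE.
  by apply: (@filterE _ (nbhs s)).
Qed.

End GraphChart.

Lemma slice_atlas_cover s : exists2 d, slice_atlas d & dom d s.
Proof.
have [c [i [N [W [g Hg]]]]] := graph_chart_exists s.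
exists (slice_chart s c i N g); first exact: slice_chart_in_atlas Hg.
by have [[_ _ cs] [_ Ns _ _ _] _ _] := Hg.
Qed.

Definition slice : manifold R m :=
  Manifold (incl_hausdorff (@manifold_hausdorff _ _ S))
    (@incl_second_countable S K (@manifold_second_countable _ _ S))
    (fun d (Ad : slice_atlas d) => let: And3 Hd _ _ := Ad in Hd)
    slice_atlas_cover slice_atlas_compatible.

End Slice.

(** * Restriction of tangent fields to the zero set *)

Section SliceFields.
Context {R : realType} {m : nat} (S : manifold R m.+1) (tau : S -> R).
Hypothesis stau : forall p, smooth_at p tau.
Hypothesis dtau : forall p, tau p = 0 ->
  exists c i, [/\ atlas c, dom c p & pderiv c i tau p != 0].

Notation N := (slice stau dtau).
Definition iota (s : N) : S := @incl S _ s.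
Implicit Types (s : N) (f g h : N -> R) (F G H : S -> R).

Lemma tau_iota s : tau (iota s) = 0.
Proof. exact: tau_incl. Qed.

Lemma continuous_iota : continuous iota.
Proof. exact: continuous_incl. Qed.

Lemma near_iota s (A : S -> Prop) :
  (\forall x \near iota s, A x) -> \forall s' \near s, A (iota s').
Proof. by move=> nA; exact: (continuous_iota nA). Qed.

Lemma slice_smooth s F : smooth_at (iota s) F -> smooth_at s (F \o iota).
Proof.
move=> sF; have [d Ad ds] := @atlas_cover _ _ N s.
by apply/(smooth_atP _ Ad ds); have [_ sd _] := Ad; exact: sd.
Qed.

Lemma iota_smooth_map : smooth_map iota.
Proof.
apply: smooth_mapP => [|s c Ac cs j]; first exact: continuous_iota.
apply: (@slice_smooth s (fun x => coord c x 0 j)).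
exact: smooth_at_coord.
Qed.

Definition extends s f F := smooth_at (iota s) F /\ \forall s' \near s, f s' = F (iota s').

Lemma extends_smooth s f F : extends s f F -> smooth_at s f.
Proof.
move=> [sF fF]; apply: smooth_at_ext (slice_smooth sF).
by apply: filterS_manifold fF.
Qed.

Lemma extends_incl s F : smooth_at (iota s) F -> extends s (F \o iota) F.
Proof. by move=> sF; split=> //; apply: (@filterE _ (nbhs s)). Qed.

Lemma near_extends s f F : extends s f F -> \forall s' \near s, extends s' f F.
Proof.
move=> [sF fF]; apply: (filterS_manifold _ (filterI (near_iota (near_smooth_at sF)) (near_join fF))).
by move=> s' [].
Qed.

(** Functions on the zero set extend locally, since coordinates do. *)
Lemma slice_coord_extends (d : chart R m N) s : atlas d -> dom d s ->
  exists Y : S -> 'rV[R]_m, [/\ forall j, smooth_at (iota s) (fun x => Y x 0 j),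
    forall j, extends s (fun s' => coord d s' 0 j) (fun x => Y x 0 j),
    Y (iota s) = coord d s &
    forall f, smooth_at s f -> extends s f ((f \o inv_coord d) \o Y)].
Proof.
move=> Ad ds; have [Hd _ /(_ s ds) [Y [sY dY]]] := Ad.
have {}dY : \forall s' \near s, coord d s' = Y (iota s') by exact: dY.
have ncd : nbhs s (dom d) by exact: chart_nbhs.
have Ys : Y (iota s) = coord d s by rewrite (nbhs_singleton dY).
exists Y; split=> // [j|f sf].
  by split=> //; apply: filterS_manifold dY => s' ->.
split.
  by apply: smooth_at_comp => //; rewrite Ys; exact: (smooth_atP _ Ad ds).1.
apply: (filterS_manifold _ (filterI dY ncd)) => s' [E ds'].
by rewrite /= -[Y _]E coordK.
Qed.

Lemma extends_exists s f : smooth_at s f -> exists F, extends s f F.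
Proof.
move=> sf; have [d Ad ds] := @atlas_cover _ _ N s.
have [Y [_ _ _ fY]] := slice_coord_extends Ad ds.
by eexists; exact: fY.
Qed.

(** A vector tangent to the level set of [tau] only sees the restriction of a
    function to it: compare [F] with its composition with the projection [r]
    onto the graph along the [i]-th coordinate. *)
Lemma slice_tangent s (D : (S -> R) -> R) F : tangent_at (iota s) D -> D tau = 0 ->
  extends s (fun=> 0) F -> D F = 0.
Proof.
move=> tD Dtau [sF F0].
have [c [i [V [W [g Hg]]]]] := graph_chart_exists stau dtau s.
have [[Hc Ac cs] [oV Vs Vc oW sg] ti [VW VK Wg]] := Hg.
pose del x := delete i (coord c x).
pose r x := insert i (g (del x)) (del x).
have Ws : W (del (iota s)) by exact: VW.
have rs : r (iota s) = coord c (iota s) by exact: (graph_chart_coord Hg).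
have sdel k : smooth_at (iota s) (fun x => del x 0 k).
  by apply: smooth_at_eq (smooth_at_coord (lift i k) Ac cs) => x; rewrite mxE.
have sr j : smooth_at (iota s) (fun x => r x 0 j).
  apply: (@smooth_at_comp _ _ _ _ _ del (fun y => insert i (g y) y 0 j)) => //.
  exact: (smooth_graph_insert Hg).
have cdel : {for iota s, continuous del}.
  by apply: continuous_rV => k; exact: smooth_at_continuous (sdel k).
have nW : \forall x \near iota s, W (del x).
  by apply: cdel; exact: open_nbhs_nbhs.
have r0 G : extends s (fun=> 0) G -> D G = 'd_i (G \o inv_coord c) (coord c (iota s)) *
    (D (fun x => coord c x 0 i) - D (fun x => r x 0 i)).
  move=> [sG G0].
  have sG' := (smooth_atP _ Ac cs).1 sG.
  have /nbhs_incl[B nB BG] := G0.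
  have Dr : D ((G \o inv_coord c) \o r) = 0.
    rewrite -[RHS](tangent_cst tD 0); apply: (tangent_ext tD); last first.
      by apply: smooth_at_comp => //; rewrite rs.
    have cgp : {for iota s, continuous (graph_point c i g \o del)}.
      by apply: continuous_comp => //; exact: (continuous_graph_point Hg).
    have nB' : \forall x \near iota s, B (graph_point c i g (del x)).
      apply: cgp; rewrite /= -[graph_point _ _ _ _]/(inv_coord c (r (iota s))) rs coordK //.
    apply: (filterS_manifold _ (filterI nW nB')) => x [Wx Bx].
    have tx : tau (inv_coord c (r x)) = 0 by have [] := Wg _ Wx.
    pose s' : N := exist _ (inv_coord c (r x)) (mem_set tx).
    have Es : iota s' = inv_coord c (r x) by rewrite /iota /incl set_valE.
    by have := BG s'; rewrite -[incl s']/(iota s') Es /= => <-.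
  rewrite (tangent_comp tD sr) rs // in Dr.
  transitivity (\sum_j D (fun x => coord c x 0 j) * pderiv c j G (iota s) -
      \sum_j 'd_j (G \o inv_coord c) (coord c (iota s)) * D (fun x => r x 0 j)).
    by rewrite Dr subr0; exact: tangent_chart.
  rewrite (bigD1_ord i) // [X in _ - X](bigD1_ord i) //= opprD addrACA -sumrB big1 => [|k _].
    by rewrite addr0 mulrBr; congr (_ - _); exact: mulrC.
  have -> : (fun x => r x 0 (lift i k)) = (fun x => coord c x 0 (lift i k)).
    by apply/funext => x; rewrite /r insert_lift mxE.
  by rewrite mulrC subrr.
have /eqP : D tau = 0 by [].
rewrite r0; last by split=> //; apply: (@filterE _ (nbhs s)) => s'; rewrite tau_iota.
rewrite mulf_eq0 (negPf ti) /= => /eqP xr.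
by rewrite r0 // xr mulr0.
Qed.

Lemma slice_tangent_eq s (D : (S -> R) -> R) f F G : tangent_at (iota s) D -> D tau = 0 ->
  extends s f F -> extends s f G -> D F = D G.
Proof.
move=> tD Dtau [sF fF] [sG fG]; apply/eqP; rewrite -subr_eq0.
rewrite -(tangentB tD) //; apply/eqP; apply: (slice_tangent tD Dtau); split.
  exact: smooth_atB.
by apply: (filterS_manifold _ (filterI fF fG)) => s' [<- <-]; rewrite subrr.
Qed.

Definition extension s f : S -> R :=
  if pselect (exists F, extends s f F) is left h then projT1 (cid h) else 0.

Lemma extension_extends s f : smooth_at s f -> extends s f (extension s f).
Proof.
move=> sf; rewrite /extension; case: pselect => [h|/(_ (extends_exists sf)) //].
exact: projT2 (cid h).
Qed.

(** The extensions are chosen arbitrarily; for fields tangent to the zero set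
    the values do not depend on the choice ([slice_vectorE] and
    [slice_bivectorE]). *)
Definition slice_vector (X : vop S) : vop N := fun f s => X (extension s f) (iota s).

Definition slice_bivector (B : bop S) : bop N :=
  fun f g s => B (extension s f) (extension s g) (iota s).

Section SliceVector.
Variable X : vop S.
Hypotheses (HX : is_vector_field X) (Xtau : forall p, X tau p = 0).

Lemma slice_vectorE s f F : extends s f F -> slice_vector X f s = X F (iota s).
Proof.
move=> fF; have sf := extends_smooth fF.
exact: (slice_tangent_eq (vector_tangent _ HX) (Xtau _) (extension_extends sf) fF).
Qed.

Lemma slice_vector_extends s f F : extends s f F -> extends s (slice_vector X f) (X F).
Proof.
move=> fF; have [sF _] := fF; split; first exact: vector_smooth.
by apply: (filterS_manifold _ (near_extends fF)) => s'; exact: slice_vectorE.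
Qed.

Lemma slice_vector_field : is_vector_field (slice_vector X).
Proof.
move=> d Ad; exists (fun k => slice_vector X (fun s => coord d s 0 k)); split=> [k|s f ds sf].
  have Hd := @atlas_chart _ _ N _ Ad; apply/(smooth_on_atP _ (open_dom Hd)) => s ds.
  have [Y [_ dY _ _]] := slice_coord_extends Ad ds.
  exact: extends_smooth (slice_vector_extends (dY k)).
have [Y [sY dY Ys fY]] := slice_coord_extends Ad ds.
rewrite (slice_vectorE (fY f sf)) (tangent_comp (vector_tangent _ HX) sY); last first.
  by rewrite Ys; exact: (smooth_atP _ Ad ds).1.
by apply: eq_bigr => k _; rewrite (slice_vectorE (dY k)) Ys mulrC.
Qed.

End SliceVector.

Section SliceBivector.
Variable B : bop S.
Hypothesis HB : is_bivector_field B.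
Hypothesis Btau : forall p F, smooth_at p F -> B tau F p = 0.

Lemma slice_bivectorE s f g F G : extends s f F -> extends s g G ->
  slice_bivector B f g s = B F G (iota s).
Proof.
move=> fF gG; have sf := extends_smooth fF; have sg := extends_smooth gG.
have ef := extension_extends sf; have eg := extension_extends sg.
have [[sef _] [seg _]] := (ef, eg); have [[sF _] [sG _]] := (fF, gG).
transitivity (B (extension s f) G (iota s)).
  apply: (slice_tangent_eq (bivector_tangent HB sef) _ eg gG).
  by rewrite (bivector_skew HB) // Btau // oppr0.
apply: (slice_tangent_eq (bivector_tangentl HB sG) _ ef fF).
exact: Btau.
Qed.

Lemma slice_bivector_extends s f g F G : extends s f F -> extends s g G ->
  extends s (slice_bivector B f g) (B F G).
Proof.
move=> fF gG; have [[sF _] [sG _]] := (fF, gG); split; first exact: bivector_smooth.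
apply: (filterS_manifold _ (filterI (near_extends fF) (near_extends gG))) => s' [].
exact: slice_bivectorE.
Qed.

Lemma slice_bivector_field : is_bivector_field (slice_bivector B).
Proof.
move=> d Ad; have Hd := @atlas_chart _ _ N _ Ad.
exists (fun k l => slice_bivector B (fun s => coord d s 0 k) (fun s => coord d s 0 l)).
split=> [k l|k l s ds|s f g ds sf sg].
- apply/(smooth_on_atP _ (open_dom Hd)) => s ds.
  have [Y [_ dY _ _]] := slice_coord_extends Ad ds.
  exact: extends_smooth (slice_bivector_extends (dY k) (dY l)).
- have [Y [sY dY _ _]] := slice_coord_extends Ad ds.
  rewrite (slice_bivectorE (dY l) (dY k)) (slice_bivectorE (dY k) (dY l)).
  exact: bivector_skew.
- have [Y [sY dY Ys fY]] := slice_coord_extends Ad ds.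
  have fF := fY f sf; have gG := fY g sg.
  have [[sF _] [sG _]] := (fF, gG).
  have sh h : smooth_at s h -> smooth_rV_at (Y (iota s)) (h \o inv_coord d).
    by move=> sh; rewrite Ys; exact: (smooth_atP _ Ad ds).1.
  rewrite (slice_bivectorE fF gG).
  rewrite (tangent_comp (bivector_tangentl HB sG) sY); last exact: sh.
  apply: eq_bigr => k _.
  rewrite (tangent_comp (bivector_tangent HB (sY k)) sY); last exact: sh.
  rewrite mulr_sumr; apply: eq_bigr => l _.
  rewrite (slice_bivectorE (dY k) (dY l)) Ys /pderiv.
  by rewrite mulrA mulrC.
Qed.

End SliceBivector.

End SliceFields.

(** * The tangential part of a homogeneous Poisson structure *)

Section HomogeneousSplitting.
Context {R : realType} {m : nat} (S : manifold R m) (P : bop S) (Z : vop S).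
Variable tau : S -> R.
Hypothesis HPZ : is_homogeneous_poisson P Z.
Hypothesis stau : forall p, smooth_at p tau.
Hypothesis Ztau : forall p, Z tau p = 1.

Let HP : is_bivector_field P. Proof. by case: HPZ => -[]. Qed.
Let HZ : is_vector_field Z. Proof. by case: HPZ. Qed.

(** As [Z tau = 1], the bivector splits as [P = B + Z /\ E] with
    [E = P(d tau, .)] and [B] tangent to the level sets of [tau].  In a
    splitting [S = R x N] along [Z] with coordinate [tau], the fields that are
    constant along [R] are [e^tau E] and [e^tau B]; on [tau = 0], where
    these fields are restricted, the factor is [1]. *)
Definition reeb : vop S := P tau.

Definition tangential : bop S := fun F G p => P F G p + -1 * wedge11 Z reeb F G p.

Notation E := reeb.
Notation B := tangential.

Lemma reeb_vector_field : is_vector_field E.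
Proof. exact: vector_contract. Qed.

Lemma tangential_bivector_field : is_bivector_field B.
Proof.
apply: bivectorD => //; apply: (bivectorZ (fun p => smooth_at_cst p (-1))).
exact: bivector_wedge HZ reeb_vector_field.
Qed.

Lemma reeb_tau p : E tau p = 0.
Proof.
have := bivector_skew HP (stau p) (stau p); rewrite -/(E tau p) => e0.
by apply/eqP; rewrite -[_ == _](mulrn_eq0 _ 2) mulr2n {1}e0 addNr eqxx.
Qed.

Lemma tangential_tau p G : smooth_at p G -> B tau G p = 0.
Proof.
by move=> sG; rewrite /B /wedge11 Ztau reeb_tau mul1r mul0r subr0 mulN1r subrr.
Qed.

Section AtPoint.
Variable p : S.
Implicit Types F G H : S -> R.
Let sZ F : smooth_at p F -> smooth_at p (Z F) := vector_smooth HZ.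
Let sE F : smooth_at p F -> smooth_at p (E F) := vector_smooth reeb_vector_field.
Let sP F G : smooth_at p F -> smooth_at p G -> smooth_at p (P F G) := bivector_smooth HP.
Let tZ := vector_tangent p HZ.
Let tE := vector_tangent p reeb_vector_field.

Lemma poisson_cyclic F G H : smooth_at p F -> smooth_at p G -> smooth_at p H ->
  P (P F G) H p + P (P G H) F p + P (P H F) G p = 0.
Proof.
have [[_ J] _ _ _] := HPZ => sF sG sH; apply: add_self_inj.
by rewrite mulr0; exact: J.
Qed.

Lemma homogeneous_leibniz F G : smooth_at p F -> smooth_at p G ->
  Z (P F G) p = P (Z F) G p + P F (Z G) p - P F G p.
Proof.
have [_ _ _ L] := HPZ => sF sG; rewrite -L // /schouten12; ring.
Qed.

(** The Jacobi identity for [tau], [F] and [G]: Hamiltonian fields preserve the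
    bracket. *)
Lemma reeb_leibniz F G : smooth_at p F -> smooth_at p G ->
  E (P F G) p = P (E F) G p + P F (E G) p.
Proof.
move=> sF sG; have st := stau p.
have := poisson_cyclic st sF sG; rewrite -/(E F).
rewrite (bivector_skew HP st (sP sF sG)) -/(E (P F G)).
have tF := bivector_tangentl HP sF.
rewrite (tangent_ext tF (g := fun x => - E G x)); last exact: sP.
  rewrite (tangentN tF (sE sG)) (bivector_skew HP sF (sE sG)) opprK.
  by move=> /eqP; rewrite addrAC subr_eq0 => /eqP.
apply: (filterS_manifold _ (near_smooth_at sG)) => x sx.
by rewrite (bivector_skew HP (stau x) sx).
Qed.

(** Homogeneity applied to [tau] and [F], where [Z tau] is constant: the
    bracket of [E] and [Z] is [E]. *)
Lemma reeb_homogeneous F : smooth_at p F -> E (Z F) p = Z (E F) p + E F p.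
Proof.
move=> sF; have := homogeneous_leibniz (stau p) sF.
have -> : Z tau = fun=> 1 by apply/funext.
rewrite (tangent_cst (bivector_tangentl HP sF)) add0r -/(E F) => ->.
by rewrite -/(E (Z F) p) -/(E F p) subrK.
Qed.

Lemma tangent_tangential (D : (S -> R) -> R) F G : tangent_at p D ->
  smooth_at p F -> smooth_at p G ->
  D (B F G) = D (P F G) - (D (Z F) * E G p + Z F p * D (E G)
    - (D (E F) * Z G p + E F p * D (Z G))).
Proof.
move=> tD sF sG.
have s1 := smooth_atM (sZ sF) (sE sG); have s2 := smooth_atM (sE sF) (sZ sG).
have sw : smooth_at p (wedge11 Z E F G) := smooth_atB s1 s2.
rewrite (tangentD tD (sP sF sG)); last by apply: smooth_atM => //; exact: smooth_at_cst.
rewrite (tangentZ tD _ sw) mulN1r (tangentB tD s1 s2).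
by rewrite (tangentM tD (sZ sF) (sE sG)) (tangentM tD (sE sF) (sZ sG)).
Qed.

Lemma tangentialE F G : B F G p = P F G p - (Z F p * E G p - E F p * Z G p).
Proof. by rewrite /B mulN1r. Qed.

(** [E] preserves [P], and [L_E (Z /\ E) = [E, Z] /\ E = E /\ E = 0]. *)
Lemma reeb_tangential F G : smooth_at p F -> smooth_at p G ->
  E (B F G) p = B (E F) G p + B F (E G) p.
Proof.
move=> sF sG; rewrite (tangent_tangential tE sF sG) !tangentialE.
rewrite reeb_leibniz // !reeb_homogeneous //.
move: (P (E F) G p) (P F (E G) p) (Z (E F) p) (Z (E G) p) (E (E F) p) (E (E G) p)
  (Z F p) (Z G p) (E F p) (E G p) => *; ring.
Qed.

Lemma tangential_iter F G H : smooth_at p F -> smooth_at p G -> smooth_at p H ->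
  B (B F G) H p = P (P F G) H p
    - (P (Z F) H p * E G p + Z F p * P (E G) H p
      - (P (E F) H p * Z G p + E F p * P (Z G) H p))
    - (P (Z F) G p - P (Z G) F p - P F G p
       - (Z (Z F) p * E G p + Z F p * Z (E G) p
          - (Z (E F) p * Z G p + E F p * Z (Z G) p))) * E H p
    + (P (E F) G p - P (E G) F p
       - ((Z (E F) p + E F p) * E G p + Z F p * E (E G) p
          - (E (E F) p * Z G p + E F p * (Z (E G) p + E G p)))) * Z H p.
Proof.
move=> sF sG sH; rewrite tangentialE.
rewrite (tangent_tangential (bivector_tangentl HP sH) sF sG).
rewrite (tangent_tangential tZ sF sG) (tangent_tangential tE sF sG).
rewrite homogeneous_leibniz // reeb_leibniz // !reeb_homogeneous //.
rewrite (bivector_skew HP (sZ sG) sF) (bivector_skew HP (sE sG) sF).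
move: (P (P F G) H p) (P (Z F) H p) (P (E G) H p) (P (E F) H p) (P (Z G) H p)
  (P (Z F) G p) (P (Z G) F p) (P (E F) G p) (P (E G) F p) (P F G p)
  (Z (Z F) p) (Z (Z G) p) (Z (E F) p) (Z (E G) p) (E (E F) p) (E (E G) p)
  (Z F p) (Z G p) (Z H p) (E F p) (E G p) (E H p) => *; ring.
Qed.

(** The Jacobi identity of [P] disposes of the terms [P (P F G) H].  The
    correction [- P F G] in the homogeneity of [P] gives the right-hand side,
    and all iterated derivatives cancel. *)
Lemma tangential_cyclic F G H : smooth_at p F -> smooth_at p G -> smooth_at p H ->
  B (B F G) H p + B (B G H) F p + B (B H F) G p =
  E F p * B G H p + E G p * B H F p + E H p * B F G p.
Proof.
move=> sF sG sH.
rewrite (tangential_iter sF sG sH) (tangential_iter sG sH sF) (tangential_iter sH sF sG).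
rewrite (solve_first (poisson_cyclic sF sG sH)) !tangentialE.
move: (P (P G H) F p) (P (P H F) G p) (P (Z F) H p) (P (E G) H p) (P (E F) H p) (P (Z G) H p)
  (P (Z F) G p) (P (Z G) F p) (P (E F) G p) (P (E G) F p) (P F G p) (P G H p) (P H F p)
  (P (Z H) F p) (P (Z H) G p) (P (E H) F p) (P (E H) G p)
  (Z (Z F) p) (Z (Z G) p) (Z (Z H) p) (Z (E F) p) (Z (E G) p) (Z (E H) p)
  (E (E F) p) (E (E G) p) (E (E H) p)
  (Z F p) (Z G p) (Z H p) (E F p) (E G p) (E H p) => *; ring.
Qed.

End AtPoint.
End HomogeneousSplitting.

(** * The contact structure on the zero set *)

Section Pushforward.
Context {R : realType} {m l : nat} (N : manifold R m) (M : manifold R l).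

Lemma tangent_push (phi : N -> M) s (D : (N -> R) -> R) : smooth_map phi ->
  tangent_at s D -> tangent_at (phi s) (fun F => D (F \o phi)).
Proof.
move=> sphi tD; have [c Ac cs] := atlas_cover (phi s); have Hc := atlas_chart Ac.
exists c; split=> //; exists (fun j => D (fun x => coord c (phi x) 0 j)) => F sF.
have sc j : smooth_at s (fun x => coord c (phi x) 0 j).
  apply: (smooth_at_pullback (f := fun x => coord c x 0 j) sphi).
  exact: smooth_at_coord.
have sF' := smooth_at_pullback sphi sF.
have nc : \forall x \near s, dom c (phi x) by apply: sphi.1; exact: chart_nbhs.
rewrite (tangent_ext tD (g := (F \o inv_coord c) \o (coord c \o phi))) //; last first.
  by apply: (filterS_manifold _ nc) => x cx; rewrite /= coordK.
rewrite (tangent_comp tD (K := coord c \o phi) sc); last exact: (smooth_atP _ Ac cs).1.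
by apply: eq_bigr => j _; exact: mulrC.
Qed.

Lemma differential_zero_tangent p F (D : (M -> R) -> R) : differential_zero p F ->
  smooth_at p F -> tangent_at p D -> D F = 0.
Proof.
move=> dF sF [c [Ac cp [a Da]]]; rewrite Da // big1 // => i _.
by rewrite dF // mulr0.
Qed.

End Pushforward.

Section SliceContact.
Context {R : realType} {n : nat} (S : manifold R n.*2.+2) (P : bop S) (Z : vop S).
Variable tau : S -> R.
Hypothesis HPZ : is_homogeneous_poisson P Z.
Hypothesis nondegP : nondegenerate P.
Hypothesis stau : forall p, smooth_at p tau.
Hypothesis Ztau : forall p, Z tau p = 1.

Let HP : is_bivector_field P. Proof. by case: HPZ => -[]. Qed.
Let HZ : is_vector_field Z. Proof. by case: HPZ. Qed.

(** Otherwise [Z tau] would vanish. *)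
Lemma dtau_neq0 p : tau p = 0 ->
  exists c i, [/\ atlas c, dom c p & pderiv c i tau p != 0].
Proof.
move=> _; have [c Ac cp] := atlas_cover p.
apply: contrapT => H; have := Ztau p; have [a [_ Za]] := HZ Ac.
rewrite Za // big1 => [/eqP|i _]; first by rewrite eq_sym oner_eq0.
case: (eqVneq (pderiv c i tau p) 0) => [->|ti]; first by rewrite mulr0.
by case: H; exists c, i.
Qed.

Notation N := (slice stau dtau_neq0).
Notation E := (reeb P tau).
Notation B := (tangential P Z tau).

Definition slice_reeb : vop N := @slice_vector _ _ _ _ stau dtau_neq0 E.
Definition slice_tangential : bop N := @slice_bivector _ _ _ _ stau dtau_neq0 B.

Let HE := reeb_vector_field HPZ stau.
Let HB := tangential_bivector_field HPZ stau.
Let Etau := reeb_tau HPZ stau.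
Let Btau := tangential_tau HPZ stau Ztau.
Let vecE (s : N) f F : extends s f F -> slice_reeb f s = E F (iota s).
Proof. exact: slice_vectorE HE Etau s f F. Qed.

Let bivE (s : N) f g F G : extends s f F -> extends s g G ->
  slice_tangential f g s = B F G (iota s).
Proof. exact: slice_bivectorE HB Btau s f g F G. Qed.


(** Iterated brackets on the zero set are restrictions of iterated brackets
    of extensions, because a bracket of extensions extends the bracket. *)
Lemma slice_jacobi : is_jacobi slice_tangential slice_reeb.
Proof.
split.
- exact: slice_bivector_field.
- exact: slice_vector_field.
- move=> s f g h sf sg sh.
  have [[[F fF] [G gG]] [H hH]] := (extends_exists sf, extends_exists sg, extends_exists sh).
  have [[[sF _] [sG _]] [sH _]] := (fF, gG, hH).
  have cyc f' g' h' F' G' H' : extends s f' F' -> extends s g' G' -> extends s h' H' ->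
      slice_tangential (slice_tangential f' g') h' s = B (B F' G') H' (iota s).
    move=> f1 g1 h1; apply: bivE => //.
    exact: slice_bivector_extends.
  rewrite /schouten22 /wedge12 (cyc _ _ _ _ _ _ fF gG hH) (cyc _ _ _ _ _ _ gG hH fF).
  rewrite (cyc _ _ _ _ _ _ hH fF gG) (tangential_cyclic HPZ stau Ztau sF sG sH).
  rewrite (vecE fF) (vecE gG) (vecE hH) (bivE gG hH) (bivE hH fF) (bivE fF gG).
  by rewrite mulr_natl mulr2n.
- move=> s f g sf sg.
  have [[F fF] [G gG]] := (extends_exists sf, extends_exists sg).
  have [[sF _] [sG _]] := (fF, gG).
  have fE := slice_vector_extends HE Etau fF; have gE := slice_vector_extends HE Etau gG.
  have fgB := slice_bivector_extends HB Btau fF gG.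
  rewrite /schouten12 (vecE fgB) (bivE fE gG) (bivE fF gE).
  by rewrite (reeb_tangential HPZ stau Ztau sF sG) addrAC addrK subrr.
Qed.

(** A pair [(c, v)] in the kernel of the matrix of [E] and [B] on the slice is
    the differential of a function [F] with [P F = 0]: extend the germ with
    differential [v] and add the multiple of [tau] for which [Z F = - c]. *)
Lemma slice_contact : is_contact slice_tangential slice_reeb.
Proof.
split=> [|s]; first exact: slice_jacobi.
have [d Ad ds] := @atlas_cover _ _ N s.
have [HTr HRe _ _] := slice_jacobi.
have [a [_ Ea]] := HRe d Ad; have [b [_ bN Bb]] := HTr d Ad.
pose a' k := a k s; pose b' k l := b k l s.
have b'N i j : b' j i = - b' i j by exact: bN.
have E1 f : smooth_at s f -> slice_reeb f s = dual a' (grad d s f).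
  by move=> sf; rewrite Ea //; apply: eq_bigr => i _; rewrite mxE.
have B1 f g : smooth_at s f -> smooth_at s g ->
    slice_tangential f g s = bilin b' (grad d s f) (grad d s g).
  move=> sf sg; rewrite Bb //; apply: eq_bigr => i _; apply: eq_bigr => j _.
  by rewrite !mxE.
have sl v : smooth_at s (linear_germ d v) := smooth_linear_germ v Ad ds.
have gl v : grad d s (linear_germ d v) = v := grad_linear_germ v Ad ds.
have [|f f0] := @vform_exists _ _ a' b' b'N; last first.
  exists (fun i => linear_germ d (f i)); split=> [i|]; first exact: sl.
  rewrite wedge_powerE mulf_neq0 ?invr_neq0 ?expf_neq0 ?pnatr_eq0 //.
  apply: contraNneq f0 => <-; apply/eqP; apply: eq_bigr => t _.
  rewrite /odd_term E1 // gl; congr (_ * (_ * _)); apply: eq_bigr => i _.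
  by rewrite B1 // !gl.
move=> v c av bv; have [F0 kF0] := extends_exists (sl v).
have [sF0 _] := kF0; set p := iota s in sF0.
have tZ := vector_tangent p HZ; have tE := vector_tangent p HE.
have EF0 : E F0 p = 0 by rewrite -(vecE kF0) E1 // gl.
have BF0 G : smooth_at p G -> B F0 G p = c * E G p.
  move=> sG; have gG := extends_incl sG; have sg := extends_smooth gG.
  by rewrite -(bivE kF0 gG) B1 // gl bv -E1 // (vecE gG).
pose mu := - c - Z F0 p; pose F x := F0 x + mu * tau x.
have st := stau p; have smt : smooth_at p (fun x => mu * tau x).
  by apply: smooth_atM => //; exact: smooth_at_cst.
have sF : smooth_at p F := smooth_atD sF0 smt.
have ZF : Z F p = - c.
  by rewrite (tangentD tZ sF0 smt) (tangentZ tZ mu st) Ztau mulr1 /mu addrC subrK.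
have EF : E F p = 0.
  by rewrite (tangentD tE sF0 smt) (tangentZ tE mu st) Etau EF0 mulr0 addr0.
have BF G : smooth_at p G -> B F G p = c * E G p.
  move=> sG; have tB := bivector_tangentl HB sG.
  by rewrite (tangentD tB sF0 smt) (tangentZ tB mu st) Btau // mulr0 addr0 BF0.
have dF : differential_zero p F.
  apply: nondegP => // G sG; have := BF G sG; rewrite tangentialE ZF EF mul0r subr0.
  by rewrite mulNr opprK -[RHS]add0r => /addIr.
have kF : extends s (linear_germ d v) F.
  split=> //; have [_ kF0'] := kF0; apply: (filterS_manifold _ kF0') => s' ->.
  by rewrite /F tau_iota mulr0 addr0.
split; last first.
  by apply/eqP; rewrite -oppr_eq0 -ZF (differential_zero_tangent dF sF tZ).
rewrite -(gl v); apply/rowP => j; rewrite !mxE.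
have tj := pderiv_tangent j Ad ds.
rewrite (tangent_ext tj (g := F \o iota (dtau := dtau_neq0) (stau := stau))) //; last by case: kF.
exact: (differential_zero_tangent dF sF
  (tangent_push (iota_smooth_map stau dtau_neq0) tj)).
Qed.

End SliceContact.

Section SliceResolution.
Context {R : realType} {n : nat} (M : manifold R n.*2.+1) (piM : bop M) (EM : vop M).
Hypothesis HM : is_jacobi piM EM.
Context (S : manifold R n.*2.+2) (P : bop S) (Z : vop S) (phi : S -> cylinder M).
Hypothesis HS : homogeneous_symplectic_resolution (poissonification piM EM)
  (time_field (M := M)) P Z phi.

(** A function [f] on [M] is pulled back to [N] as the restriction of
    [f o snd o phi], which is constant along [Z] and whose brackets on [S] are
    given by the poissonification at [t = 0]. *)
Lemma symplectic_to_contact_resolution :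
  exists (N : manifold R n.*2.+1) (P' : bop N) (E' : vop N) (psi : N -> M),
    contact_resolution piM EM P' E' psi.
Proof.
have [[[_ nondegP] [sphi phiP] surj] HPZ phiZ] := HS.
have [[HP _] HZ _ _] := HPZ; have [HpiM HEM _ _] := HM.
pose tau : S -> R := fst \o phi.
have stau p : smooth_at p tau.
  exact: smooth_at_pullback sphi (cylinder_smooth_fst (phi p)).
have Ztau p : Z tau p = 1.
  rewrite [LHS]phiZ; last exact: cylinder_smooth_fst.
  by rewrite /time_field derive1_id.
pose N := slice stau (dtau_neq0 HPZ stau Ztau).
pose io : N -> S := @iota _ _ _ _ stau (dtau_neq0 HPZ stau Ztau).
have HC := slice_contact HPZ nondegP stau Ztau.
pose psi : N -> M := snd \o phi \o io.
have phi_io s : phi (io s) = (0, psi s).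
  by rewrite [LHS]surjective_pairing; congr (_, _); exact: (@tau_iota _ _ _ _ stau (dtau_neq0 HPZ stau Ztau) s).
have lift_smooth s f : smooth_at (psi s) f ->
    smooth_at (phi (io s)) (f \o snd : cylinder M -> R).
  by move=> sf; apply: smooth_at_snd; rewrite phi_io.
have lift_ext s f : smooth_at (psi s) f -> extends s (f \o psi) (f \o snd \o phi).
  move=> sf; apply: (@extends_incl _ _ _ _ stau (dtau_neq0 HPZ stau Ztau) s).
  exact: smooth_at_pullback sphi (lift_smooth s f sf).
have HE := reeb_vector_field HPZ stau; have Et := reeb_tau HPZ stau.
have HB := tangential_bivector_field HPZ stau; have Bt := tangential_tau HPZ stau Ztau.
have Zlift s f : smooth_at (psi s) f -> Z (f \o snd \o phi) (io s) = 0.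
  move=> sf; rewrite (phiZ _ (f \o snd)); last exact: lift_smooth.
  exact: time_snd.
exists N, (slice_tangential (Ztau := Ztau)), (slice_reeb (Ztau := Ztau)), psi; split=> //.
- split.
  + apply: smooth_mapP => [s|s d Ad ds j].
      apply: (@continuous_comp _ _ _ (phi \o io) snd); last exact: cvg_snd.
      by apply: continuous_comp; [exact: continuous_iota|exact: sphi.1].
    have sc : smooth_at (psi s) (fun x => coord d x 0 j) by exact: smooth_at_coord.
    exact: extends_smooth (lift_ext s _ sc).
  + move=> s f g sf sg.
    apply: etrans (slice_bivectorE HB Bt (lift_ext s f sf) (lift_ext s g sg)) _.
    rewrite tangentialE !Zlift // mul0r mulr0 subrr subr0.
    rewrite (phiP _ (f \o snd) (g \o snd)); try exact: lift_smooth.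
    rewrite /poissonification /wedge11 /lift_bivector !time_snd mul0r mulr0 subrr addr0.
    by rewrite phi_io /= oppr0 expR0 mul1r.
  + move=> s f sf; apply: etrans (slice_vectorE HE Et (lift_ext s f sf)) _; rewrite /reeb.
    rewrite (phiP _ fst (f \o snd)); last exact: lift_smooth; last exact: cylinder_smooth_fst.
    rewrite /poissonification /wedge11 /lift_bivector /lift_vector time_snd mulr0 subr0.
    have -> : time_field (M := M) fst (phi (io s)) = 1 by rewrite /time_field derive1_id.
    rewrite phi_io /= oppr0 expR0 !mul1r.
    by rewrite (tangent_cst (bivector_tangentl HpiM sf)) add0r.
- move=> x _; have [s _ sx] := surj (0, x) I.
  have ts : tau s = 0 by rewrite /tau /= sx.
  exists (exist _ s (mem_set ts)) => //.
  by rewrite /psi /= /io /iota /incl set_valE /= sx.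
Qed.

End SliceResolution.

Theorem theorem3p2 (R : realType) (n : nat) (M : manifold R n.*2.+1)
    (piM : bop M) (EM : vop M) (HM : is_jacobi piM EM) :
  (exists (S : manifold R n.*2.+1) (P : bop S) (E : vop S) (phi : S -> M),
      contact_resolution piM EM P E phi)
  <->
  (exists (S : manifold R (1 + n.*2.+1)) (P : bop S) (Z : vop S)
          (phi : S -> cylinder M),
      homogeneous_symplectic_resolution
        (poissonification piM EM) (time_field (M := M)) P Z phi).
Proof.
split=> [[S [P [E [phi H]]]]|[S [P [Z [phi H]]]]].
  by do 4 eexists; exact: contact_to_symplectic_resolution H.
exact: (@symplectic_to_contact_resolution _ _ _ _ _ HM S P Z phi H).
Qed.
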